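(* Let $q\in L^1[0,1]$ be real-valued and consider the problem $u_t=u_{xx}-q(x)u$, $0\le x\le1$, $t>0$, $u(x,0)=0$, $u(0,t)=0$, $u(1,t)=a(t)$, where $a\in L^1(\mathbb{R}_+)$, $a\not\equiv0$, $a(t)=0$ for $t>T$ (for some $T>0$). Let $v(x,\lambda):=\int_0^\infty u(x,t)e^{-\lambda t}\,dt$, $A(\lambda):=v(1,\lambda)$, $B(\lambda):=v_x(1,\lambda)$. Then the data $\{A(\lambda),B(\lambda)\}$, known on a set of $\lambda\in(0,\infty)$ which has a finite positive limit point, determine $q$ uniquely.
   Context: The function $v$ satisfies $-v''+q(x)v+\lambda v=0$, $0\le x\le1$, $v(0,\lambda)=0$, $v(1,\lambda)=A(\lambda)$, $v'(1,\lambda)=B(\lambda)$ (prime is $d/dx$), and $A(\lambda)=\int_0^\infty a(t)e^{-\lambda t}\,dt$. ''Determine $q$ uniquely'' means: if two real-valued potentials $q_1,q_2\in L^1[0,1]$ give rise to functions $v_1,v_2$ with the same $A(\lambda)$ and the same $B(\lambda)$ for all $\lambda$ in the given set, then $q_1=q_2$. *)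

(* Defs.v *)
From HB Require Import structures.
From mathcomp Require Import all_boot all_order all_algebra.
From mathcomp Require Import all_classical all_reals all_analysis.
Import Order.TTheory GRing.Theory Num.Theory.
Import numFieldNormedType.Exports.

Set Implicit Arguments.
Unset Strict Implicit.
Unset Printing Implicit Defensive.

Local Open Scope classical_set_scope.
Local Open Scope ring_scope.

Definition L1_on (R : realType) (D : set R) (f : R -> R) : Prop :=
  (@lebesgue_measure R).-integrable D (EFin \o f).

(* [boundary_datum a]: a is in L^1(R_+), is not the zero class, and vanishes
   (a.e.) beyond some T > 0. *)
Definition boundary_datum (R : realType) (a : R -> R) : Prop :=
  [/\ L1_on `[0, +oo[ a,
      ~ {ae (@lebesgue_measure R), forall t, 0 <= t -> a t = 0} &
      exists2 T : R, 0 < T &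
        {ae (@lebesgue_measure R), forall t, T < t -> a t = 0}].

(* f is in C([0,1]; L^1(D)): the map x |-> f x takes values in L^1(D) and is
   continuous on [0,1] for the L^1(D) norm. *)
Definition continuous_into_L1 (R : realType) (D : set R) (f : R -> R -> R)
    : Prop :=
  (forall x, 0 <= x <= 1 -> L1_on D (f x)) /\
  (forall x0, 0 <= x0 <= 1 ->
    (\int[@lebesgue_measure R]_(t in D) `|f x t - f x0 t|%:E)%E
      @[x --> within `[0, 1] (nbhs x0)] --> 0%E).

Definition is_Cn (R : realType) (n : nat) (f : R -> R) : Prop :=
  (forall k : nat, (k < n)%N -> forall x : R, derivable (derive1n k f) x 1) /\
  continuous (derive1n n f).

(* Space test functions vanish near 0 and 1, time test functions only vanish
   for large t: nothing is imposed on psi at t = 0. *)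
Definition space_test (R : realType) (phi : R -> R) : Prop :=
  is_Cn 2 phi /\
  exists c d : R, [/\ 0 < c, d < 1 &
    forall x, ~~ (c <= x <= d) -> phi x = 0].

Definition time_test (R : realType) (psi : R -> R) : Prop :=
  is_Cn 1 psi /\ exists tau : R, forall t, tau <= t -> psi t = 0.

(* The initial boundary value problem
     u_t = u_xx - q(x) u  (0 <= x <= 1, t > 0),
     u(x,0) = 0,  u(0,t) = 0,  u(1,t) = a(t).
   For q and a merely integrable u has no classical derivatives in general, so
   the equation is understood in the sense of distributions, tested against
   products phi(x) psi(t).  As psi(0) need not vanish, integration by parts in t
   produces the term u(x,0) phi(x) psi(0): its absence is the initial condition
   u(x,0) = 0.  The lateral boundary values are traces: x |-> u x is continuous
   from [0,1] into L^1_loc([0,oo)), with u 0 = 0 and u 1 = a in that space. *)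
Definition solves_ibvp (R : realType) (q a : R -> R) (u : R -> R -> R) : Prop :=
  [/\ measurable_fun (`[0, 1] `*` `[0, +oo[ : set (R * R))
        (fun p : R * R => u p.1 p.2),
      forall tau : R, continuous_into_L1 `[0, tau] u,
      {ae (@lebesgue_measure R), forall t, 0 <= t -> u 0 t = 0},
      {ae (@lebesgue_measure R), forall t, 0 <= t -> u 1 t = a t} &
      forall phi psi : R -> R, space_test phi -> time_test psi ->
        (\int[(@lebesgue_measure R \x @lebesgue_measure R)%E]_(p in
            `[0, 1] `*` `[0, +oo[)
          (u p.1 p.2 * (- (phi p.1 * derive1 psi p.2)
                        - derive1n 2 phi p.1 * psi p.2
                        + q p.1 * phi p.1 * psi p.2)) = 0)].

(* The Laplace integral of u(x,.) converges absolutely at lambda, continuously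
   in x on [0,1], that is, e^{-lambda t} u is in C([0,1]; L^1(R_+)).  When q is
   very negative u may grow exponentially in t, so this can fail at small
   lambda > 0, where v(x,lambda) is then undefined. *)
Definition has_laplace (R : realType) (u : R -> R -> R) (lambda : R) : Prop :=
  continuous_into_L1 `[0, +oo[ (fun x t => u x t * expR (- (lambda * t))).

Definition laplace_v (R : realType) (u : R -> R -> R) (x lambda : R) : R :=
  \int[@lebesgue_measure R]_(t in `[0, +oo[) (u x t * expR (- (lambda * t))).

Definition data_A (R : realType) (u : R -> R -> R) (lambda : R) : R :=
  laplace_v u 1 lambda.

(* v(.,lambda) lives on [0,1], so v_x(1,lambda) is the left derivative. *)
Definition data_B (R : realType) (u : R -> R -> R) (lambda : R) : R :=
  lim ((laplace_v u x lambda - laplace_v u 1 lambda) / (x - 1)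
         @[x --> (1 : R)^'-]).

(* Main.v *)
(* The Laplace transform turns the weak parabolic problem into
   v'' = (q + lambda) v, v 0 = 0 on [0,1].  Near a limit point lambda0 of the
   data, A(lambda) <> 0 for lambda <> lambda0, since otherwise all the moments of
   a(t) exp(- lambda0 t) on [0,T] would vanish.  Normalizing v by v'(0) = 1, the
   data fix v'(1) / v(1), so the Wronskian of the two solutions vanishes at 1 and
   \int (q1 - q2) phi1 phi2 = 0 for lambda = lambda0 + mu with mu -> 0.

   It remains to see that the products phi1 phi2 are complete on such a set.  A
   Gronwall argument for the characteristic triangles of the wave equation bounds
   any linear combination of the phi1 phi2, minus the same combination for q = 0,
   by the primitive of the latter.  For q = 0 the span, taken as mu -> 0,
   contains the even powers of x in its uniform closure, hence (Bernoulli)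
   polynomials that converge boundedly to indicators of intervals.  So
   p = q1 - q2 satisfies |\int_x1^x2 p| <= C (x2 - x1) \int_x1^1 |p|, and
   Lebesgue differentiation and Gronwall from the right end give p = 0. *)
Require Import Defs.
From HB Require Import structures.
From mathcomp Require Import all_boot all_order all_algebra.
From mathcomp Require Import all_classical all_reals all_analysis.
From mathcomp Require Import measurable_realfun ring lra.
Import Order.TTheory GRing.Theory Num.Theory.
Import numFieldNormedType.Exports.

Set Implicit Arguments.
Unset Strict Implicit.
Unset Printing Implicit Defensive.

Local Open Scope classical_set_scope.
Local Open Scope ring_scope.

(** The data sit near one finite [lambda0], so no asymptotics in lambda is available: information
    enters through Taylor coefficients in mu, reached by combinations whose coefficients are out of
    control as mu -> 0. Every comparison must therefore hold for whole linear combinations, with a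
    constant depending on the potentials only and not on the number of terms, the coefficients or
    mu. No transformation kernel is constructed; only such bounds are proved. The comparison gains
    one integration: the error at x is bounded by primitives of the unperturbed combination over
    subintervals of [0, x] that start at 0. For an approximate indicator of [x1, x2] these are
    nearly zero up to x1 and nearly at most x2 - x1 beyond, whence both the factor x2 - x1 and the
    restriction of |p| to [x1, 1]. All the even powers produced vanish at 0, so constants cannot be
    approximated; indicators are reached as differences of two step polynomials whose constant terms
    cancel. *)

Notation leb R := (@lebesgue_measure R).

(** * Integrable functions and their primitives *)

Lemma L1_onS (R : realType) (D E : set R) (f : R -> R) :
  measurable D -> measurable E -> D `<=` E -> L1_on E f -> L1_on D f.
Proof. by move=> mD mE DE; exact: integrableS. Qed.

Lemma L1_on_le (R : realType) (b x : R) (f : R -> R) :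
  x <= b -> L1_on `[0, b] f -> L1_on `[0, x] f.
Proof.
move=> xb; apply: L1_onS => // y /=; rewrite !in_itv/= => /andP[-> yx].
exact: le_trans yx xb.
Qed.

Lemma eq_L1_on (R : realType) (D : set R) (f g : R -> R) : measurable D ->
  (forall x, D x -> f x = g x) -> L1_on D f -> L1_on D g.
Proof.
move=> mD fg fi; apply: (@eq_integrable _ _ _ (leb R) D mD (EFin \o f) (EFin \o g) _ fi).
by move=> x; rewrite inE => Dx /=; rewrite fg.
Qed.

Lemma L1_onD (R : realType) (D : set R) (f g : R -> R) : measurable D ->
  L1_on D f -> L1_on D g -> L1_on D (fun x => f x + g x).
Proof.
by move=> mD fi gi; exact: (@integrableD _ _ _ (leb R) D mD _ _ fi gi).
Qed.

Lemma L1_onZ (R : realType) (D : set R) (c : R) (f : R -> R) : measurable D ->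
  L1_on D f -> L1_on D (fun x => c * f x).
Proof.
by move=> mD fi; exact: (@integrableZl _ _ _ (leb R) D mD c _ fi).
Qed.

Lemma L1_on_norm (R : realType) (D : set R) (f : R -> R) : measurable D ->
  L1_on D f -> L1_on D (fun x => `|f x|).
Proof. by move=> mD fi; exact: integrable_norm. Qed.

Lemma L1_on_measurable (R : realType) (D : set R) (f : R -> R) :
  L1_on D f -> measurable_fun D f.
Proof. by move=> /(measurable_int (leb R))/measurable_EFinP. Qed.

Lemma L1_onM (R : realType) (D : set R) (f g : R -> R) (M : R) :
  measurable D -> L1_on D f -> measurable_fun D g ->
  (forall x, D x -> `|g x| <= M) -> L1_on D (fun x => f x * g x).
Proof.
move=> mD fi mg gM.
apply: (@integrableMl _ _ _ (leb R) D mD (EFin \o f) g fi mg).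
exists M; split; first by rewrite num_real.
by move=> y My x Dx /=; rewrite (le_trans (gM _ Dx))// ltW.
Qed.

Lemma continuous_itv_bounded (R : realType) (a b : R) (f : R -> R) :
  {within `[a, b], continuous f} ->
  exists2 M, 0 <= M & forall x, a <= x <= b -> `|f x| <= M.
Proof.
move=> cf; have [ab|ba] := leP a b; last first.
  by exists 0 => // x /andP[ax xb]; move: (le_trans ax xb); rewrite leNgt ba.
have [c _ cM] := EVT_max ab cf; have [d _ dM] := EVT_min ab cf.
exists (`|f c| + `|f d|); first exact: addr_ge0.
move=> x axb; rewrite ler_norml.
have := cM x; have := dM x; rewrite !in_itv/= axb => /(_ isT) + /(_ isT).
have := ler_norm (f c); have := ler_norm (- f d); rewrite normrN.
have := normr_ge0 (f c); have := normr_ge0 (f d).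
by move=> *; apply/andP; split; lra.
Qed.

Lemma L1_onM_continuous (R : realType) (b : R) (f g : R -> R) :
  L1_on `[0, b] f -> {within `[0, b], continuous g} ->
  L1_on `[0, b] (fun x => f x * g x).
Proof.
move=> fi cg; have [M M0 gM] := continuous_itv_bounded cg.
apply: (@L1_onM _ _ _ _ M) => //.
exact: subspace_continuous_measurable_fun.
Qed.

Lemma L1_on_continuous (R : realType) (a b : R) (g : R -> R) :
  {within `[a, b], continuous g} -> L1_on `[a, b] g.
Proof.
by move=> cg; apply: continuous_compact_integrable => //; exact: segment_compact.
Qed.

Lemma ler_norm_Rintegral (R : realType) (D : set R) (f g : R -> R) :
  measurable D -> L1_on D f -> L1_on D g ->
  (forall x, D x -> `|f x| <= g x) ->
  `|\int[leb R]_(x in D) f x| <= \int[leb R]_(x in D) g x.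
Proof.
move=> mD fi gi fg; apply: le_trans (le_normr_Rintegral _ _) _ => //.
by apply: le_Rintegral => //; exact: integrable_norm.
Qed.

(** Absolute continuity with the density as part of the data, since the derivative exists only
    almost everywhere. A second-order equation with integrable potential becomes two such
    relations. *)
Definition ac_on (R : realType) (b : R) (F f : R -> R) : Prop :=
  L1_on `[0, b] f /\
  forall x, 0 <= x <= b -> F x = F 0 + \int[leb R]_(s in `[0, x]) f s.

Lemma ac_on_le (R : realType) (b x : R) (F f : R -> R) :
  x <= b -> ac_on b F f -> ac_on x F f.
Proof.
move=> xb [fi Ff]; split; first exact: L1_on_le fi.
by move=> y /andP[y0 yx]; rewrite Ff// y0 (le_trans yx).
Qed.

Lemma ac_on_continuous (R : realType) (b : R) (F f : R -> R) : 0 <= b ->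
  ac_on b F f -> {within `[0, b], continuous F}.
Proof.
move=> b0 [fi Ff].
have /= c := @parameterized_integral_continuous R 0 b f b0 fi.
apply: (@subspace_eq_continuous _ _ _
  (fun x => F 0 + parameterized_integral (leb R) 0 x f)).
  by move=> x; rewrite inE/= in_itv/= => xb; exact/esym/Ff.
by move=> x; apply: cvgD; [exact: cvg_cst|exact: c].
Qed.

Lemma ac_onD (R : realType) (b : R) (F f G g : R -> R) :
  ac_on b F f -> ac_on b G g ->
  ac_on b (fun x => F x + G x) (fun x => f x + g x).
Proof.
move=> [fi Ff] [gi Gg]; split; first exact: L1_onD.
move=> x /[dup] /andP[x0 xb] x0b; rewrite RintegralD//; last 2 first.
- exact: L1_on_le fi.
- exact: L1_on_le gi.
by rewrite (Ff x)// (Gg x)//; ring.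
Qed.

Lemma ac_onZ (R : realType) (b c : R) (F f : R -> R) :
  ac_on b F f -> ac_on b (fun x => c * F x) (fun x => c * f x).
Proof.
move=> [fi Ff]; split; first exact: L1_onZ.
move=> x /[dup] /andP[x0 xb] x0b; rewrite RintegralZl//; last exact: L1_on_le fi.
by rewrite (Ff x)//; ring.
Qed.

Lemma eq_ac_on (R : realType) (b : R) (F f G g : R -> R) : 0 <= b ->
  (forall x, 0 <= x <= b -> F x = G x) -> (forall x, 0 <= x <= b -> f x = g x) ->
  ac_on b F f -> ac_on b G g.
Proof.
move=> b0 FG fg [fi Ff]; split.
  by apply: eq_L1_on fi => // x /=; rewrite in_itv/= => /fg.
move=> x /[dup] /andP[x0 xb] x0b; rewrite -!FG ?lexx// Ff//; congr (_ + _).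
apply: eq_Rintegral => y; rewrite inE/= in_itv/= => /andP[y0 yx].
by rewrite fg// y0 (le_trans yx).
Qed.

(** Fubini on the triangle y <= x of the square [0, b]^2. With [f] and [g] merely integrable the
    primitives need not be differentiable everywhere, so a classical product rule does not apply. *)
Lemma Rintegral_primitive_by_parts (R : realType) (b : R) (f g : R -> R) :
  0 <= b -> L1_on `[0, b] f -> L1_on `[0, b] g ->
  \int[leb R]_(x in `[0, b]) (f x * \int[leb R]_(y in `[0, x]) g y) =
  (\int[leb R]_(x in `[0, b]) f x) * (\int[leb R]_(x in `[0, b]) g x) -
  \int[leb R]_(y in `[0, b]) (g y * \int[leb R]_(x in `[0, y]) f x).
Proof.
move=> b0 fi gi.
pose f0 := f \_ `[0, b]; pose g0 := g \_ `[0, b].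
have f0i : L1_on setT f0.
  rewrite /L1_on /f0 -restrict_EFin.
  by apply/(@integrable_mkcond _ _ _ (leb R) _ (EFin \o f)) => //; exact: fi.
have g0i : L1_on setT g0.
  rewrite /L1_on /g0 -restrict_EFin.
  by apply/(@integrable_mkcond _ _ _ (leb R) _ (EFin \o g)) => //; exact: gi.
have mf0 := L1_on_measurable f0i; have mg0 := L1_on_measurable g0i.
pose L : set (R * R) := [set p | p.2 <= p.1].
have mL : measurable L.
  have /(_ measurableT [set true] I) : measurable_fun setT (fun p : R * R => p.2 <= p.1).
    exact: measurable_fun_ler.
  by rewrite setTI; congr (measurable _); apply/seteqP; split.
pose K (p : R * R) : R := f0 p.1 * g0 p.2 * \1_L p.
have mK : measurable_fun setT K.
  apply: measurable_funM; last exact: measurable_indic.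
  by apply: measurable_funM; exact: measurableT_comp.
have Ki : (leb R \x leb R)%E.-integrable setT (EFin \o K).
  apply/(@integrable12ltyP _ _ _ _ _ (leb R) (leb R)).
    exact/measurable_EFinP.
  pose c := (\int[leb R]_y `|g0 y|)%R.
  apply: (@le_lt_trans _ _ (\int[leb R]_x (`|f0 x| * c)%:E)%E); last first.
    have : L1_on setT (fun x => c * `|f0 x|).
      by apply: L1_onZ => //; exact: L1_on_norm.
    move=> /(@integrable_lty _ _ _ (leb R) _ measurableT); apply: le_lt_trans.
    by rewrite le_eqVlt; apply/orP; left; apply/eqP; apply: eq_integral => x _;
      rewrite /= mulrC.
  apply: ge0_le_integral => //.
  - by move=> x _; exact: integral_ge0.
  - apply: (@measurable_fun_fubini_tonelli_F _ _ _ _ _ (leb R) (fun p => `|(K p)%:E|%E)) => //.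
    by apply: measurableT_comp => //; exact/measurable_EFinP.
  - apply/measurable_EFinP; apply: measurable_funM => //.
    exact: measurableT_comp.
  - move=> x _.
    have -> : (`|f0 x| * c)%:E = (\int[leb R]_y (`|f0 x| * `|g0 y|)%:E)%E.
      rewrite /c -RintegralZl//; last exact: L1_on_norm.
      rewrite /Rintegral fineK//; apply: integrable_fin_num => //.
      by apply: L1_onZ => //; exact: L1_on_norm.
    apply: ge0_le_integral => //.
    + apply: measurableT_comp => //; apply/measurable_EFinP.
      by apply: (measurableT_comp mK); exact: pair1_measurable.
    + by apply/measurable_EFinP; apply: measurable_funM => //; exact: measurableT_comp.
    + move=> y _ /=; rewrite lee_fin /K /= !normrM -[leRHS]mulr1.
      apply: ler_wpM2l; first by rewrite mulr_ge0.
      by rewrite indicE; case: (_ \in _); rewrite ?normr1 ?normr0.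
have LE (x y : R) : \1_L (x, y) = (y <= x)%R%:R :> R.
  by rewrite indicE; congr (_ %:R); congr nat_of_bool; apply/idP/idP; rewrite inE.
pose P1 (x : R) := f x * \int[leb R]_(y in `[0, x]) g y.
pose P2 (y : R) := (\int[leb R]_(x in `[0, b]) f x) * g y -
  g y * \int[leb R]_(x in `[0, y]) f x.
pose P1' : R -> R := P1 \_ `[0, b]; pose P2' : R -> R := P2 \_ `[0, b].
have E1 : (\int[leb R]_x \int[leb R]_y (EFin \o K) (x, y) =
    \int[leb R]_x (EFin \o P1') x)%E.
  apply: eq_integral => x _ /=; rewrite /K /P1' /P2' /=.
  rewrite patchE; case: ifPn => xb; last first.
    apply: integral0_eq => y _ /=.
    by rewrite /f0 patchE (negbTE xb) !mul0r.
  move: xb; rewrite inE/= in_itv/= => /andP[x0 xb].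
  rewrite /P1 -RintegralZl//; last exact: L1_on_le gi.
  rewrite /Rintegral fineK; last first.
    by apply: integrable_fin_num => //; apply: L1_onZ => //; exact: L1_on_le gi.
  rewrite [RHS]integral_mkcond; apply: eq_integral => y _ /=.
  rewrite /f0 /g0 !patchE !mem_setE !in_itv/= x0 xb/= LE.
  case: (boolP (0 <= y)) => y0 /=; last by rewrite mulr0 mul0r.
  case: (boolP (y <= x)) => yx /=.
    by rewrite (le_trans yx xb) mulr1.
  by rewrite mulr0.
have E2 : (\int[leb R]_y \int[leb R]_x (EFin \o K) (x, y) =
    \int[leb R]_y (EFin \o P2') y)%E.
  apply: eq_integral => y _ /=; rewrite /K /P1' /P2' /=.
  rewrite patchE; case: ifPn => yb; last first.
    apply: integral0_eq => x _ /=.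
    by rewrite /g0 patchE (negbTE yb) mulr0 !mul0r.
  move: yb; rewrite inE/= in_itv/= => /andP[y0 yb].
  have -> : P2 y = \int[leb R]_(x in `[y, b]) (g y * f x).
    rewrite /P2.
    rewrite RintegralZl//; last first.
      by apply: L1_onS fi => // z /=; rewrite !in_itv/= => /andP[/(le_trans y0) -> ->].
    have := @Rintegral_itvB R f (BLeft 0) (BRight b) y fi.
    rewrite !bnd_simp => /(_ y0 yb); rewrite Rintegral_itv_obnd_cbnd; last first.
      by apply: L1_onS fi => // z /=; rewrite !in_itv/= => /andP[/ltW/(le_trans y0) -> ->].
    move=> <-.
    by ring.
  rewrite /Rintegral fineK; last first.
    apply: integrable_fin_num => //; apply: L1_onZ => //.
    by apply: L1_onS fi => // z /=; rewrite !in_itv/= => /andP[/(le_trans y0) -> ->].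
  rewrite [RHS]integral_mkcond; apply: eq_integral => x _ /=.
  rewrite /f0 /g0 !patchE !mem_setE !in_itv/= y0 yb/= LE.
  case: (boolP (y <= x)) => yx /=; last by rewrite mulr0.
  rewrite (le_trans y0 yx)/=; case: ifP => _; last by rewrite !mul0r.
  by rewrite mulr1 mulrC.
have := etrans (etrans (esym E1) (Fubini Ki)) E2.
rewrite /P1' /P2' -!restrict_EFin -!integral_mkcond => /(congr1 fine).
rewrite -/(Rintegral _ _ _) => ->.
have cg (h : R -> R) : L1_on `[0, b] h ->
    {within `[0, b], continuous (fun x => \int[leb R]_(y in `[0, x]) h y)}.
  exact: parameterized_integral_continuous.
rewrite -/(Rintegral (leb R) `[0, b] P2) /P2.
rewrite RintegralB//; last 2 first.
- exact: L1_onZ.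
- by apply: L1_onM_continuous => //; exact: cg.
by rewrite RintegralZl.
Qed.

Lemma ac_onM (R : realType) (b : R) (F f G g : R -> R) : 0 <= b ->
  ac_on b F f -> ac_on b G g ->
  ac_on b (fun x => F x * G x) (fun x => f x * G x + F x * g x).
Proof.
move=> b0 FA GA; have cF := ac_on_continuous b0 FA.
have cG := ac_on_continuous b0 GA.
have [fi Ff] := FA; have [gi Gg] := GA; split.
  apply: L1_onD => //; first exact: L1_onM_continuous.
  have -> : (fun x => F x * g x) = (fun x => g x * F x).
    by apply/funext => x; rewrite mulrC.
  exact: L1_onM_continuous.
move=> x /[dup] x0b /andP[x0 xb].
have fix_ := L1_on_le xb fi; have gix := L1_on_le xb gi.
have cP (h : R -> R) : L1_on `[0, x] h ->
    {within `[0, x], continuous (fun x => \int[leb R]_(y in `[0, x]) h y)}.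
  exact: parameterized_integral_continuous.
have e1 := Rintegral_primitive_by_parts x0 fix_ gix.
rewrite (_ : \int[leb R]_(s in `[0, x]) _ =
  \int[leb R]_(s in `[0, x]) (G 0 * f s + (f s * \int[leb R]_(y in `[0, s]) g y)
   + (F 0 * g s + (g s * \int[leb R]_(y in `[0, s]) f y)))); last first.
  apply: eq_Rintegral => s; rewrite inE/= in_itv/= => /andP[s0 sx].
  rewrite (Ff s) ?s0 ?(le_trans sx)// (Gg s) ?s0 ?(le_trans sx)//.
  by ring.
have i1 : L1_on `[0, x] (fun s => f s * \int[leb R]_(y in `[0, s]) g y).
  by apply: L1_onM_continuous => //; exact: cP.
have i2 : L1_on `[0, x] (fun s => g s * \int[leb R]_(y in `[0, s]) f y).
  by apply: L1_onM_continuous => //; exact: cP.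
have i3 : L1_on `[0, x] (fun s => G 0 * f s) by exact: L1_onZ.
have i4 : L1_on `[0, x] (fun s => F 0 * g s) by exact: L1_onZ.
rewrite RintegralD//; [|exact: L1_onD|exact: L1_onD].
rewrite RintegralD// RintegralD// !RintegralZl// e1 (Ff x)// (Gg x)//.
by ring.
Qed.

(** * Solutions of y'' = mu y and their iterated primitives *)

Lemma eq_is_derive (R : realType) (f g : R -> R) (x d e : R) :
  f =1 g -> d = e -> is_derive x 1 f d -> is_derive x 1 g e.
Proof. by move=> /funext-> ->. Qed.

Lemma is_derive_add (R : realType) (f g : R -> R) (x df dg : R) :
  is_derive x 1 f df -> is_derive x 1 g dg ->
  is_derive x 1 (fun y => f y + g y) (df + dg).
Proof. by move=> f' g'; exact: is_deriveD. Qed.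

Lemma is_derive_scale (R : realType) (c : R) (f : R -> R) (x df : R) :
  is_derive x 1 f df -> is_derive x 1 (fun y => c * f y) (c * df).
Proof. by move=> f'; exact: (is_deriveZ c). Qed.

Lemma is_derive_mul (R : realType) (f g : R -> R) (x df dg : R) :
  is_derive x 1 f df -> is_derive x 1 g dg ->
  is_derive x 1 (fun y => f y * g y) (df * g x + f x * dg).
Proof.
move=> f' g'; have := is_deriveM f' g'.
by apply: eq_is_derive => //; rewrite /GRing.scale/=; ring.
Qed.

Lemma is_derive_affine (R : realType) (a b : R) (f : R -> R) (x df : R) :
  is_derive (a * x + b) 1 f df -> is_derive x 1 (fun y => f (a * y + b)) (a * df).
Proof.
move=> f'.
have g' : is_derive x 1 (fun y => a * y + b) (a * 1 + 0).
  exact: (is_derive_add (is_derive_scale a (is_derive_id x 1)) (is_derive_cst b x 1)).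
have := @is_derive1_comp _ f (fun y => a * y + b) x _ _ f' g'.
by apply: eq_is_derive => //; ring.
Qed.

Lemma is_derive_sumf (R : realType) n (f : 'I_n -> R -> R) (x : R) (df : 'I_n -> R) :
  (forall j, is_derive x 1 (f j) (df j)) ->
  is_derive x 1 (fun y => \sum_(j < n) f j y) (\sum_(j < n) df j).
Proof.
move=> f'; have -> : (fun y => \sum_(j < n) f j y) = \sum_(j < n) f j.
  by apply/funext => y; rewrite fct_sumE.
exact: is_derive_sum.
Qed.

Lemma is_derive_pow (R : realType) (n : nat) (x : R) :
  is_derive x 1 (fun y => y ^+ n.+1) (n.+1%:R * x ^+ n).
Proof.
have := @is_deriveX R _ id n.+1 x 1 1 (is_derive_id _ _).
by apply: eq_is_derive => [y|]; rewrite ?exprfctE// /GRing.scale/= mulr1.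
Qed.

Lemma is_derive_continuous (R : realType) (f df : R -> R) :
  (forall x : R, is_derive x 1 f (df x)) -> continuous f.
Proof.
move=> f' x; apply/differentiable_continuous/derivable1_diffP.
by have [] := f' x.
Qed.

Lemma ler_norm_increment (R : realType) (f df : R -> R) (a b K : R) : a <= b ->
  (forall x : R, is_derive x 1 f (df x)) ->
  (forall x, a <= x <= b -> `|df x| <= K) ->
  `|f b - f a| <= K * (b - a).
Proof.
move=> ab f' dK.
have cf : {within `[a, b], continuous f}.
  by apply: continuous_subspaceT; exact: is_derive_continuous f'.
have [c cab ->] := MVT_segment ab (fun x _ => f' x) cf.
rewrite normrM (ger0_norm (_ : 0 <= b - a)) ?subr_ge0//.
by apply: ler_wpM2r; [rewrite subr_ge0|apply: dK; move: cab; rewrite in_itv].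
Qed.

Lemma is_derive_ac_on (R : realType) (b : R) (F f : R -> R) :
  (forall x : R, is_derive x 1 F (f x)) -> continuous f -> ac_on b F f.
Proof.
move=> F' cf; split.
  by apply: L1_on_continuous; exact: continuous_subspaceT.
move=> x /andP[]; rewrite le_eqVlt => /predU1P[<- _|x0 xb].
  by rewrite set_itv1 Rintegral_set1 addr0.
have cF := is_derive_continuous F'.
rewrite /Rintegral (@continuous_FTC2 _ f F 0 x)//=; first by ring.
- exact: continuous_subspaceT.
- split.
  + by move=> y _; have [] := F' y.
  + by apply: cvg_at_right_filter; exact: cF.
  + by apply: cvg_at_left_filter; exact: cF.
- by move=> y _; rewrite derive1E; have [_ ->] := F' y.
Qed.

(* cosh (t sqrt mu) and sinh (t sqrt mu) / sqrt mu for both signs of mu; at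
   mu = 0 they take junk values, and mu <> 0 is assumed throughout. *)
Definition gcos (R : realType) (mu t : R) : R :=
  if 0 <= mu then
    (expR (Num.sqrt mu * t) + expR (- (Num.sqrt mu * t))) / 2
  else cos (Num.sqrt (- mu) * t).

Definition gsin (R : realType) (mu t : R) : R :=
  if 0 <= mu then
    (expR (Num.sqrt mu * t) - expR (- (Num.sqrt mu * t))) / 2 / Num.sqrt mu
  else sin (Num.sqrt (- mu) * t) / Num.sqrt (- mu).

(* The k-th primitive of gcos vanishing at 0, as (mu^-1) times a Taylor remainder. *)
Fixpoint gprim (R : realType) (k : nat) (mu t : R) : R :=
  match k with
  | 0%N => gcos mu t
  | 1%N => gsin mu t
  | k'.+2 => (gprim k' mu t - t ^+ k' / k'`!%:R) / mu
  end.

Lemma gsqrt_pos (R : realType) (mu : R) : 0 < mu ->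
  Num.sqrt mu * Num.sqrt mu = mu /\ Num.sqrt mu != 0.
Proof.
move=> m0; split; first by rewrite -expr2 sqr_sqrtr// ltW.
by rewrite gt_eqF// sqrtr_gt0.
Qed.

Lemma gcosD (R : realType) (mu x y : R) : mu != 0 ->
  gcos mu (x + y) = gcos mu x * gcos mu y + mu * (gsin mu x * gsin mu y).
Proof.
move=> mu0; rewrite /gcos /gsin; case: ifPn => [m0|]; last first.
  rewrite -ltNge -oppr_gt0 => /gsqrt_pos[]; set k := Num.sqrt _ => kk k0.
  rewrite mulrDr cosD; have -> : mu = - (k * k) by rewrite kk opprK.
  by field.
have [] := @gsqrt_pos _ mu; first by rewrite lt_def mu0.
set k := Num.sqrt _ => kk k0.
rewrite mulrDr opprD !expRD -[in mu * _]kk.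
by field.
Qed.

Lemma gsinD (R : realType) (mu x y : R) : mu != 0 ->
  gsin mu (x + y) = gsin mu x * gcos mu y + gcos mu x * gsin mu y.
Proof.
move=> mu0; rewrite /gcos /gsin; case: ifPn => [m0|]; last first.
  rewrite -ltNge -oppr_gt0 => /gsqrt_pos[]; set k := Num.sqrt _ => kk k0.
  by rewrite mulrDr sinD; field.
have [] := @gsqrt_pos _ mu; first by rewrite lt_def mu0.
set k := Num.sqrt _ => kk k0.
by rewrite mulrDr opprD !expRD; field.
Qed.

Lemma gcos0 (R : realType) (mu : R) : gcos mu 0 = 1.
Proof.
rewrite /gcos; case: ifPn => _; last by rewrite mulr0 cos0.
by rewrite mulr0 oppr0 expR0; field.
Qed.

Lemma gsin0 (R : realType) (mu : R) : gsin mu 0 = 0.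
Proof.
rewrite /gsin; case: ifPn => _; last by rewrite mulr0 sin0 mul0r.
by rewrite mulr0 oppr0 expR0 subrr !mul0r.
Qed.

Lemma gcosN (R : realType) (mu x : R) : gcos mu (- x) = gcos mu x.
Proof.
rewrite /gcos; case: ifPn => _; last by rewrite mulrN cosN.
by rewrite mulrN opprK addrC.
Qed.

Lemma gsinN (R : realType) (mu x : R) : gsin mu (- x) = - gsin mu x.
Proof.
rewrite /gsin; case: ifPn => _; last by rewrite mulrN sinN mulNr.
by rewrite mulrN opprK -opprB !mulNr.
Qed.

Lemma is_derive_gcos (R : realType) (mu x : R) : mu != 0 ->
  is_derive x 1 (gcos mu) (mu * gsin mu x).
Proof.
move=> mu0; rewrite /gcos /gsin; case: ifPn => [m0|]; last first.
  rewrite -ltNge -oppr_gt0 => /gsqrt_pos[]; set k := Num.sqrt _ => kk k0.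
  have := @is_derive_affine _ k 0 cos x _ (is_derive_cos _).
  have -> : (fun y => cos (k * y + 0)) = (fun y => cos (k * y)).
    by apply/funext => y; rewrite addr0.
  apply: eq_is_derive => //; rewrite addr0; have -> : mu = - (k * k) by rewrite kk opprK.
  by field.
have [] := @gsqrt_pos _ mu; first by rewrite lt_def mu0.
set k := Num.sqrt _ => kk k0.
have h1 := @is_derive_affine _ k 0 expR x _ (is_derive_expR _).
have h2 := @is_derive_affine _ (- k) 0 expR x _ (is_derive_expR _).
have := is_derive_scale (2^-1) (is_derive_add h1 h2).
have -> : (fun y => 2^-1 * (expR (k * y + 0) + expR (- k * y + 0))) =
    (fun y => (expR (k * y) + expR (- (k * y))) / 2).
  by apply/funext => y; rewrite !addr0 !mulNr mulrC.
apply: eq_is_derive => //; rewrite !addr0 !mulNr -[in mu * _]kk.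
by field.
Qed.

Lemma is_derive_gsin (R : realType) (mu x : R) : mu != 0 ->
  is_derive x 1 (gsin mu) (gcos mu x).
Proof.
move=> mu0; rewrite /gcos /gsin; case: ifPn => [m0|]; last first.
  rewrite -ltNge -oppr_gt0 => /gsqrt_pos[]; set k := Num.sqrt _ => kk k0.
  have := is_derive_scale k^-1 (@is_derive_affine _ k 0 sin x _ (is_derive_sin _)).
  have -> : (fun y => k^-1 * sin (k * y + 0)) = (fun y => sin (k * y) / k).
    by apply/funext => y; rewrite addr0 mulrC.
  by apply: eq_is_derive => //; rewrite addr0; field.
have [] := @gsqrt_pos _ mu; first by rewrite lt_def mu0.
set k := Num.sqrt _ => kk k0.
have h1 := @is_derive_affine _ k 0 expR x _ (is_derive_expR _).
have h2 := is_derive_scale (-1) (@is_derive_affine _ (- k) 0 expR x _ (is_derive_expR _)).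
have := is_derive_scale (2^-1 / k) (is_derive_add h1 h2).
have -> : (fun y => 2^-1 / k * (expR (k * y + 0) + -1 * expR (- k * y + 0))) =
    (fun y => (expR (k * y) - expR (- (k * y))) / 2 / k).
  by apply/funext => y; rewrite !addr0 !mulNr; field.
by apply: eq_is_derive => //; rewrite !addr0 !mulNr; field.
Qed.

Lemma is_derive_exp_coeff (R : realType) (k : nat) (x : R) :
  is_derive x 1 (fun y => y ^+ k.+1 / k.+1`!%:R) (x ^+ k / k`!%:R).
Proof.
have := is_derive_scale (k.+1`!%:R^-1) (is_derive_pow k x).
have -> : (fun y : R => k.+1`!%:R^-1 * y ^+ k.+1) = (fun y => y ^+ k.+1 / k.+1`!%:R).
  by apply/funext => y; rewrite mulrC.
apply: eq_is_derive => //; rewrite factS natrM.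
have ? : k`!%:R != 0 :> R by rewrite pnatr_eq0 -lt0n fact_gt0.
have ? : 1 + k%:R != 0 :> R by rewrite addrC natr1 pnatr_eq0.
by field; apply/andP; split.
Qed.

(** The recursion of [gprim] descends by two, so two consecutive orders are carried through the
    induction. *)
Lemma is_derive_gprim (R : realType) (k : nat) (mu x : R) : mu != 0 ->
  is_derive x 1 (gprim k.+1 mu) (gprim k mu x).
Proof.
move=> mu0; suff [] : is_derive x 1 (gprim k.+1 mu) (gprim k mu x) /\
  is_derive x 1 (gprim k.+2 mu) (gprim k.+1 mu x) by [].
elim: k => [|k [IH1 IH2]].
  split; first exact: is_derive_gsin.
  have h : is_derive x 1 (gprim 2 mu) (mu^-1 * (mu * gsin mu x + 0)).
    have -> : gprim 2 mu = (fun y => mu^-1 * (gcos mu y + - 1)).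
      by apply/funext => y /=; rewrite expr0 fact0 divr1 mulrC.
    exact: (is_derive_scale mu^-1
      (is_derive_add (is_derive_gcos x mu0) (is_derive_cst (- 1 : R) x 1))).
  by move: h; apply: eq_is_derive => // => /=; field.
split => //.
have -> : gprim k.+3 mu = (fun y => mu^-1 * (gprim k.+1 mu y + -1 * (y ^+ k.+1 / k.+1`!%:R))).
  by apply/funext => y /=; rewrite mulN1r [RHS]mulrC.
have := is_derive_scale mu^-1 (is_derive_add IH1 (is_derive_scale (-1) (is_derive_exp_coeff k x))).
by apply: eq_is_derive => // => /=; rewrite mulN1r mulrC.
Qed.

Lemma within_continuousM (R : realType) (A : set R) (f g : R -> R) :
  {within A, continuous f} -> {within A, continuous g} ->
  {within A, continuous (fun x => f x * g x)}.
Proof. by move=> cf cg x; exact: cvgM (cf x) (cg x). Qed.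

Lemma is_derive_reflect (R : realType) (f : R -> R) (x s df : R) :
  is_derive (x - s) 1 f df -> is_derive s 1 (fun s => f (x - s)) (- df).
Proof.
move=> f'; have f'' : is_derive (-1 * s + x) 1 f df by rewrite mulN1r addrC.
have := is_derive_affine f''; apply: eq_is_derive => [y|].
  by rewrite mulN1r addrC.
by rewrite mulN1r.
Qed.

Lemma gprimE (R : realType) (k : nat) (mu t : R) : mu != 0 ->
  gprim k mu t = t ^+ k / k`!%:R + mu * gprim k.+2 mu t.
Proof. by move=> mu0 /=; rewrite mulrCA divff// mulr1 addrC subrK. Qed.

Lemma gprim0 (R : realType) (k : nat) (mu : R) : gprim k.+1 mu 0 = 0.
Proof.
suff [] : gprim k.+1 mu 0 = 0 /\ gprim k.+2 mu 0 = 0 by [].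
elim: k => [|k [IH1 IH2]].
  by rewrite /= gsin0 gcos0 expr0 fact0 divr1 subrr mul0r.
by split => //; move: IH1 => /= ->; rewrite expr0n/= mul0r subr0 mul0r.
Qed.

Lemma primitive_chain_bound (R : realType) (b c K : R) (g : nat -> R -> R) :
  `|c| <= 1 ->
  (forall k (x : R), is_derive x 1 (g k.+1) (c * g k x)) ->
  (forall k, g k.+1 0 = 0) ->
  (forall x, 0 <= x <= b -> `|g 0%N x| <= K) ->
  forall k x, 0 <= x <= b -> `|g k x| <= K * b ^+ k.
Proof.
move=> c1 g' g0 gK; elim=> [x xb|k IH x /[dup] xb /andP[x0 xb']].
  by rewrite expr0 mulr1 gK.
have b0 : 0 <= b := le_trans x0 xb'.
have K0 : 0 <= K by rewrite (le_trans (normr_ge0 _) (gK 0 _))// lexx.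
have /= := @ler_norm_increment R (g k.+1) _ 0 x (K * b ^+ k) x0 (g' k).
rewrite g0 !subr0 => H; apply: le_trans (H _) _; last first.
  by rewrite exprSr mulrA; apply: ler_wpM2l => //; rewrite mulr_ge0// exprn_ge0.
move=> y /andP[y0 yx]; rewrite normrM (le_trans _ (IH y _))//; last first.
  by rewrite y0 (le_trans yx).
by rewrite -[leRHS]mul1r; apply: ler_wpM2r.
Qed.

Lemma gcos_bound (R : realType) (mu t : R) : `|mu| <= 1 -> 0 <= t <= 2 ->
  `|gcos mu t| <= expR 2.
Proof.
move=> mu1 /andP[t0 t2]; rewrite /gcos; case: ifPn => [m0|_]; last first.
  rewrite (@le_trans _ _ 1)//; first by rewrite ler_norml cos_geN1 cos_le1.
  by rewrite -expR0 ler_expR.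
have m1 : mu <= 1 by move: mu1; rewrite ger0_norm.
have k1 : Num.sqrt mu <= 1 by rewrite -sqrtr1 ler_wsqrtr.
have k0 := sqrtr_ge0 mu; have kt0 : 0 <= Num.sqrt mu * t by rewrite mulr_ge0.
have kt2 : Num.sqrt mu * t <= 2.
  by rewrite (le_trans _ t2)// -[leRHS]mul1r ler_wpM2r.
rewrite ger0_norm; last by rewrite divr_ge0// addr_ge0// expR_ge0.
have : expR (Num.sqrt mu * t) <= expR 2 by rewrite ler_expR.
have : expR (- (Num.sqrt mu * t)) <= expR 2 :> R.
  by rewrite ler_expR (@le_trans _ _ 0)// oppr_le0.
by lra.
Qed.

Lemma gprim_bound (R : realType) (k : nat) (mu t : R) : mu != 0 ->
  `|mu| <= 1 -> 0 <= t <= 2 -> `|gprim k mu t| <= expR 2 * 2 ^+ k.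
Proof.
move=> mu0 mu1 t2.
have c1 : `|1 : R| <= 1 by rewrite normr1.
have g' j (x : R) : is_derive x 1 (gprim j.+1 mu) (1 * gprim j mu x).
  by rewrite mul1r; exact: is_derive_gprim.
exact: (primitive_chain_bound c1 g' (fun j => gprim0 j mu)
  (fun x => gcos_bound mu1) k t2).
Qed.

Lemma gcosB (R : realType) (mu x y : R) : mu != 0 ->
  gcos mu (x - y) = gcos mu x * gcos mu y - mu * (gsin mu x * gsin mu y).
Proof. by move=> mu0; rewrite gcosD// gcosN gsinN mulrN mulrN. Qed.

Lemma gsinB (R : realType) (mu x y : R) : mu != 0 ->
  gsin mu (x - y) = gsin mu x * gcos mu y - gcos mu x * gsin mu y.
Proof. by move=> mu0; rewrite gsinD// gcosN gsinN mulrN. Qed.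

Lemma gprim2N (R : realType) (mu x : R) : gprim 2 mu (- x) = gprim 2 mu x.
Proof. by rewrite /= gcosN !expr0. Qed.

Lemma gprim3N (R : realType) (mu x : R) : gprim 3 mu (- x) = - gprim 3 mu x.
Proof. by rewrite /= gsinN !expr1 mulNr -opprD mulNr. Qed.

(** Product-to-sum formula. At x = y it turns the product of two solutions for q = 0 into half of
    [gprim 2] at 2 x, whence the doubled argument in what follows. *)
Lemma gsinM (R : realType) (mu x y : R) : mu != 0 ->
  gsin mu x * gsin mu y = (gprim 2 mu (x + y) - gprim 2 mu (x - y)) / 2.
Proof. by move=> mu0; rewrite /= gcosD// gcosB// !expr0 fact0; field. Qed.

Lemma gsin_gcosM (R : realType) (mu x y : R) : mu != 0 ->
  gsin mu x * gcos mu y = (gsin mu (y + x) - gsin mu (y - x)) / 2.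
Proof. by move=> mu0; rewrite gsinD// gsinB//; field. Qed.

(** Mixed products reduce to third primitives, so that a single bound on the combination of the
    [gprim 3] controls all the sums met in the comparison of products. *)
Lemma gsin_gprim2M (R : realType) (mu y z : R) : mu != 0 ->
  gsin mu y * gprim 2 mu z =
  (gprim 3 mu (y + z) + gprim 3 mu (y - z)) / 2 - gprim 3 mu y.
Proof.
move=> mu0; rewrite /= gsinD// gsinB// expr0 !expr1 fact0 factS fact0 muln1.
by field.
Qed.

Arguments gprim : simpl never.

Lemma L1_on_sum (R : realType) (D : set R) (I : Type) (r : seq I) (f : I -> R -> R) :
  measurable D -> (forall i, L1_on D (f i)) -> L1_on D (fun x => \sum_(i <- r) f i x).
Proof.
move=> mD fi; elim: r => [|i r IH].
  apply: (@eq_L1_on _ _ (fun=> 0)) => //; first by move=> x _; rewrite big_nil.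
  exact: (@integrable0 _ _ _ (leb R) D).
apply: (@eq_L1_on _ _ (fun x => f i x + \sum_(j <- r) f j x)) => //.
  by move=> x _; rewrite big_cons.
exact: L1_onD.
Qed.

Lemma Rintegral_sum (R : realType) (D : set R) (I : Type) (r : seq I) (f : I -> R -> R) :
  measurable D -> (forall i, L1_on D (f i)) ->
  \int[leb R]_(x in D) (\sum_(i <- r) f i x) =
  \sum_(i <- r) \int[leb R]_(x in D) f i x.
Proof.
move=> mD fi; elim: r => [|i r IH].
  rewrite big_nil (@eq_Rintegral _ _ _ _ _ (fun=> 0)) ?Rintegral_cst ?mul0r//.
  by move=> x _; rewrite big_nil.
rewrite big_cons -IH -RintegralD//; [|exact: fi|exact: L1_on_sum].
by apply: eq_Rintegral => x _; rewrite big_cons.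
Qed.

Lemma ler_norm_Rintegral_cst (R : realType) (q f : R -> R) (x K : R) :
  0 <= x <= 1 -> L1_on `[0, 1] q -> L1_on `[0, x] f -> 0 <= K ->
  (forall s, 0 <= s <= x -> `|f s| <= `|q s| * K) ->
  `|\int[leb R]_(s in `[0, x]) f s| <= (\int[leb R]_(s in `[0, 1]) `|q s|) * K.
Proof.
move=> /andP[x0 x1] qi fi K0 fq.
have qx := L1_on_norm (measurable_itv _) (L1_on_le x1 qi).
have q1 := L1_on_norm (measurable_itv _) qi.
apply: (@le_trans _ _ (\int[leb R]_(s in `[0, x]) (`|q s| * K))).
  apply: ler_norm_Rintegral => //.
    apply: (@eq_L1_on _ _ (fun s => K * `|q s|)) => //; last exact: L1_onZ.
    by move=> s _; rewrite mulrC.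
rewrite RintegralZr//; apply: ler_wpM2r => //.
rewrite -subr_ge0 (@Rintegral_itvB R (fun s => `|q s|) (BLeft 0) (BRight 1) x)//.
exact: Rintegral_ge0.
Qed.

(** * Comparison of the solutions with the case q = 0 *)

(* d x t = \sum_j b_j (phi_j - gsin_j) x gcos_j t solves a wave equation; Gronwall
   is run over the triangle |t| <= x0 - x. *)
Lemma transmutation_bound (R : realType) (q : R -> R) : L1_on `[0, 1] q ->
  exists2 C : R, 0 <= C & forall n (mu b : 'I_n -> R) (phi : 'I_n -> R -> R) (x0 G : R),
    (forall j, mu j != 0) ->
    (forall j, {within `[0, 1], continuous (phi j)}) ->
    (forall j (x : R), 0 <= x <= 1 -> phi j x = gsin (mu j) x +
      \int[leb R]_(s in `[0, x]) (q s * (phi j s * gsin (mu j) (x - s)))) ->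
    0 <= x0 <= 1 ->
    (forall z : R, 0 <= z <= x0 -> `|\sum_(j < n) b j * gprim 2 (mu j) z| <= G) ->
    `|\sum_(j < n) b j * phi j x0 - \sum_(j < n) b j * gsin (mu j) x0| <= C * G.
Proof.
move=> qi; pose N := \int[leb R]_(s in `[0, 1]) `|q s|.
have N0 : 0 <= N by exact: Rintegral_ge0.
(* With the weight exp (L x), one integration gains the factor N / L <= 1/2; the summand 1 keeps L
   positive when q vanishes. *)
pose L := 2 * N + 1; have L0 : 0 < L by rewrite /L; lra.
exists (2 * N * expR L); first by rewrite !mulr_ge0// expR_ge0.
move=> n mu b phi x0 G mu0 cphi phiE /andP[x00 x01] TG.
have G0 : 0 <= G by rewrite (le_trans (normr_ge0 _) (TG 0 _))// lexx.
pose TT (z : R) := \sum_(j < n) b j * gprim 2 (mu j) z.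
have TTG z : - x0 <= z <= x0 -> `|TT z| <= G.
  move=> /andP[z1 z2]; have [z0|z0] := leP 0 z; first by apply: TG; rewrite z0.
  rewrite /TT; under eq_bigr => j _ do rewrite -gprim2N.
  by apply: TG; apply/andP; split; lra.
pose del j (x : R) := phi j x - gsin (mu j) x.
pose d (x t : R) := \sum_(j < n) b j * del j x * gcos (mu j) t.
pose tri (x t : R) := 0 <= x <= x0 /\ `|t| <= x0 - x.
have qL j (x : R) : 0 <= x -> x <= x0 ->
    L1_on `[0, x] (fun s => q s * (phi j s * gsin (mu j) (x - s))).
  move=> x0' xx0; apply: L1_onM_continuous; first exact: L1_on_le (le_trans xx0 x01) qi.
  have cS : continuous (fun s : R => gsin (mu j) (x - s)).
    apply: (@is_derive_continuous _ _ (fun s => - gcos (mu j) (x - s))) => s.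
    exact/is_derive_reflect/is_derive_gsin.
  apply: within_continuousM; last exact: continuous_subspaceT.
  apply: continuous_subspaceW (cphi j).
  by move=> y /=; rewrite !in_itv/= => /andP[-> yx]; rewrite (le_trans yx)// (le_trans xx0).
have dE (x t : R) : tri x t -> d x t = \int[leb R]_(s in `[0, x])
    (q s * \sum_(j < n) (b j * phi j s * (gsin (mu j) (x - s) * gcos (mu j) t))).
  move=> [/andP[x0' xx0] _]; rewrite /d.
  transitivity (\sum_(j < n) \int[leb R]_(s in `[0, x]) (b j * gcos (mu j) t *
      (q s * (phi j s * gsin (mu j) (x - s))))).
    apply: eq_bigr => j _; rewrite RintegralZl//; last exact: qL.
    rewrite /del phiE ?x0' ?(le_trans xx0)//; by ring.
  rewrite -Rintegral_sum//; last by move=> j; apply: L1_onZ => //; exact: qL.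
  apply: eq_Rintegral => s _; rewrite mulr_sumr; apply: eq_bigr => j _.
  by ring.
have dL (x t : R) : tri x t -> L1_on `[0, x] (fun s => q s *
   \sum_(j < n) (b j * phi j s * (gsin (mu j) (x - s) * gcos (mu j) t))).
  move=> [/andP[x0' xx0] _].
  apply: (@eq_L1_on _ _ (fun s => \sum_(j < n) (b j * gcos (mu j) t *
      (q s * (phi j s * gsin (mu j) (x - s)))))) => //.
    by move=> s _; rewrite mulr_sumr; apply: eq_bigr => j _; ring.
  by apply: L1_on_sum => // j; apply: L1_onZ => //; exact: qL.
(* Contraction: a weighted bound B on d over the triangle improves to N G + B / 2. *)
have step B : 0 <= B -> (forall x t, tri x t -> `|d x t| <= B * expR (L * x)) ->
    forall x t, tri x t -> `|d x t| <= (N * G + B / 2) * expR (L * x).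
  move=> B0 dB x t /[dup] xt [/andP[x0' xx0] tx]; rewrite dE//.
  have e0 : 0 <= expR (L * x) :> R by exact: expR_ge0.
  apply: (@le_trans _ _ (N * (G + B * expR (L * x) / L))); last first.
    have e1 : 1 <= expR (L * x) by rewrite -expR0 ler_expR mulr_ge0// ltW.
    have : N * G <= N * G * expR (L * x) by rewrite ler_peMr// mulr_ge0.
    have : N * (B * expR (L * x) / L) <= B * expR (L * x) / 2.
      rewrite mulrCA; apply: ler_wpM2l; first exact: mulr_ge0.
      by rewrite ler_pdivrMr// /L; lra.
    by rewrite mulrDr; lra.
  have K0 : 0 <= G + B * expR (L * x) / L.
    by rewrite addr_ge0// divr_ge0 ?mulr_ge0// ltW.
  apply: ler_norm_Rintegral_cst => //; first by rewrite x0' (le_trans xx0).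
    exact: dL.
  move=> s /andP[s0 sx]; rewrite normrM; apply: ler_wpM2l => //.
  (* Write phi = gsin + del. The gsin part becomes a sum of second primitives at four points of
     modulus at most |t| + x <= x0. The del part is half the integral of d(s, .) over the slice at s
     of the characteristic triangle with apex (x, t). *)
  have -> : \sum_(j < n) b j * phi j s * (gsin (mu j) (x - s) * gcos (mu j) t) =
     (TT (t + x) - TT (t + x - 2 * s) - TT (t - x + 2 * s) + TT (t - x)) / 4 +
     (\sum_(j < n) (b j * del j s * gsin (mu j) (t + (x - s))) -
      \sum_(j < n) (b j * del j s * gsin (mu j) (t - (x - s)))) / 2.
    rewrite /TT -!sumrB -big_split/= !mulr_suml -big_split/=.
    apply: eq_bigr => j _.
    have -> : phi j s = gsin (mu j) s + del j s by rewrite /del; ring.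
    rewrite gsin_gcosM//.
    have := gsinM s (t + (x - s)) (mu0 j); have := gsinM s (t - (x - s)) (mu0 j).
    have -> : s + (t - (x - s)) = t - x + 2 * s by ring.
    have -> : s - (t - (x - s)) = - (t - x) by ring.
    have -> : s + (t + (x - s)) = t + x by ring.
    have -> : s - (t + (x - s)) = - (t + x - 2 * s) by ring.
    rewrite !gprim2N => e2 e3.
    transitivity (b j * ((gsin (mu j) s * gsin (mu j) (t + (x - s))) - (gsin (mu j) s * gsin (mu j) (t - (x - s)))) / 2 +
      b j * del j s * ((gsin (mu j) (t + (x - s)) - gsin (mu j) (t - (x - s))) / 2)).
      by field.
    by rewrite e2 e3; field.
  have [t1 t2] : - (x0 - x) <= t /\ t <= x0 - x by apply/andP; rewrite -ler_norml.
  apply: (le_trans (ler_normD _ _)); apply: lerD.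
    have T1 := TTG (t + x); have T2 := TTG (t + x - 2 * s).
    have T3 := TTG (t - x + 2 * s); have T4 := TTG (t - x).
    rewrite normrM [ `|4^-1|]ger0_norm ?invr_ge0// ler_pdivrMr//.
    apply: le_trans (ler_normD _ _) _; apply: le_trans (lerD (ler_normB _ _) (lexx _)) _.
    apply: le_trans (lerD (lerD (ler_normB _ _) (lexx _)) (lexx _)) _.
    have {}T1 : `|TT (t + x)| <= G by apply: T1; lra.
    have {}T2 : `|TT (t + x - 2 * s)| <= G by apply: T2; lra.
    have {}T3 : `|TT (t - x + 2 * s)| <= G by apply: T3; lra.
    have {}T4 : `|TT (t - x)| <= G by apply: T4; lra.
    by lra.
  (* [Om] is an antiderivative of d(s, .). The points between its two arguments stay in the triangle
     because |t| + (x - s) <= x0 - s. *)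
  pose Om (tau : R) := \sum_(j < n) (b j * del j s * gsin (mu j) tau).
  have Om' (tau : R) : is_derive tau 1 Om (d s tau).
    apply: is_derive_sumf => j; apply: is_derive_scale; exact: is_derive_gsin.
  have inc := @ler_norm_increment R Om (d s) (t - (x - s)) (t + (x - s)) (B * expR (L * s)) _ Om' _.
  have {}inc : `|Om (t + (x - s)) - Om (t - (x - s))| <= B * expR (L * s) * (t + (x - s) - (t - (x - s))).
    apply: inc; first by lra.
    move=> tau tau12; apply: dB; split; first by apply/andP; split; lra.
    by rewrite ler_norml; lra.
  rewrite normrM [ `|2^-1|]ger0_norm ?invr_ge0// ler_pdivrMr//.
  apply: (le_trans inc).
  have : (x - s) * expR (L * s) <= expR (L * x) / L.
    have -> : expR (L * x) = expR (L * (x - s)) * expR (L * s).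
      by rewrite -expRD; congr expR; ring.
    rewrite mulrAC; apply: ler_wpM2r; first exact: expR_ge0.
    rewrite ler_pdivlMr// mulrC.
    by apply: le_trans (expR_ge1Dx _); lra.
  by move=> /(ler_wpM2l B0); rewrite mulrA; lra.
(* This crude bound may depend on the coefficients and on mu; it only serves to make the supremum
   below finite. *)
have [B0 B00 dB0] : exists2 B0, 0 <= B0 & forall x t, tri x t -> `|d x t| <= B0.
  have bd j : exists2 K, 0 <= K & forall x t, tri x t -> `|b j * del j x * gcos (mu j) t| <= K.
    have [K1 K10 h1] := continuous_itv_bounded (cphi j).
    have [K2 K20 h2] : exists2 K, 0 <= K & forall x, 0 <= x <= 1 -> `|gsin (mu j) x| <= K.
      apply: continuous_itv_bounded; apply: continuous_subspaceT.
      by apply: (@is_derive_continuous _ _ (gcos (mu j))) => x; exact: is_derive_gsin.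
    have [K3 K30 h3] : exists2 K, 0 <= K & forall x, -1 <= x <= 1 -> `|gcos (mu j) x| <= K.
      apply: continuous_itv_bounded; apply: continuous_subspaceT.
      by apply: (@is_derive_continuous _ _ (fun x => mu j * gsin (mu j) x)) => x; exact: is_derive_gcos.
    exists (`|b j| * (K1 + K2) * K3); first by rewrite !mulr_ge0// addr_ge0.
    move=> x t [/andP[x1 x2] tx].
    have [t1 t2] : - (x0 - x) <= t /\ t <= x0 - x by apply/andP; rewrite -ler_norml.
    rewrite !normrM; apply: ler_pM; rewrite ?mulr_ge0//; last by apply: h3; lra.
    apply: ler_wpM2l => //; apply: le_trans (ler_normB _ _) _.
    by apply: lerD; [apply: h1|apply: h2]; lra.
  have /choice[K HK] : forall j, exists K, 0 <= K /\ forall x t, tri x t -> `|b j * del j x * gcos (mu j) t| <= K.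
    by move=> j; have [K] := bd j; exists K.
  exists (\sum_(j < n) K j); first by apply: sumr_ge0 => j _; have [] := HK j.
  move=> x t xt; apply: le_trans (ler_norm_sum _ _ _) _.
  by apply: ler_sum => j _; have [_] := HK j; exact.
pose A := [set y | exists x t, tri x t /\ y = `|d x t| * expR (- (L * x))].
have tri0 : tri x0 0 by split; rewrite ?x00 ?lexx// normr0 subrr.
have Asup : has_sup A.
  split; first by exists (`|d x0 0| * expR (- (L * x0))), x0, 0.
  exists B0 => y [x [t [/[dup] xt [/andP[x0' _] _] ->]]].
  apply: le_trans (dB0 _ _ xt); rewrite -[leRHS]mulr1.
  by apply: ler_wpM2l => //; rewrite -expR0 ler_expR oppr_le0 mulr_ge0// ltW.
have expLK x : expR (- (L * x)) * expR (L * x) = 1 :> R.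
  by rewrite -expRD addNr expR0.
have Ad x t : tri x t -> `|d x t| <= sup A * expR (L * x).
  move=> xt; have : `|d x t| * expR (- (L * x)) <= sup A.
    by apply: sup_upper_bound => //; exists x, t.
  move=> /(ler_wpM2r (expR_ge0 (L * x))); rewrite -mulrA expLK mulr1.
  exact.
have supA0 : 0 <= sup A.
  apply: (@le_trans _ _ (`|d x0 0| * expR (- (L * x0)))).
    by rewrite mulr_ge0// expR_ge0.
  by apply: sup_upper_bound => //; exists x0, 0.
(* The contraction applied to the supremum itself yields sup A <= 2 N G, free of n, b and mu. *)
have supA : sup A <= N * G + sup A / 2.
  apply: sup_le_ub; first by case: Asup.
  move=> y [x [t [xt ->]]]; have := step _ supA0 Ad x t xt.
  move=> /(ler_wpM2r (expR_ge0 (- (L * x)))).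
  by rewrite -[in leRHS]mulrA [expR (L * x) * _]mulrC expLK mulr1.
have -> : \sum_(j < n) b j * phi j x0 - \sum_(j < n) b j * gsin (mu j) x0 = d x0 0.
  rewrite /d -sumrB; apply: eq_bigr => j _; rewrite gcos0 mulr1 /del.
  by ring.
apply: le_trans (Ad _ _ tri0) _; rewrite mulrAC.
apply: ler_pM => //; rewrite ?expR_ge0//.
- by lra.
- by rewrite ler_expR -[leRHS]mulr1; apply: ler_wpM2l => //; exact: ltW.
Qed.

Lemma Rintegral_split (R : realType) (f : R -> R) (y : R) : 0 <= y <= 1 ->
  L1_on `[0, 1] f ->
  \int[leb R]_(x in `[0, 1]) f x =
  \int[leb R]_(x in `[0, y]) f x + \int[leb R]_(x in `[y, 1]) f x.
Proof.
move=> /andP[y0 y1] fi.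
have := @Rintegral_itvB R f (BLeft 0) (BRight 1) y fi.
rewrite !bnd_simp => /(_ y0 y1); rewrite Rintegral_itv_obnd_cbnd; last first.
  by apply: L1_onS fi => // z /=; rewrite !in_itv/= => /andP[/ltW/(le_trans y0) -> ->].
by move=> <-; rewrite addrC subrK.
Qed.

Lemma ler_norm_subD (R : realType) (a b e f : R) :
  `|a - b| <= e -> `|b| <= f -> `|a| <= e + f.
Proof. by move=> ab bf; rewrite -[a](subrK b); apply: le_trans (ler_normD _ _) _; lra. Qed.

(** [psi] stands for phi'. The definition is applied to q + lambda0 in place of q, so that [mu] is
    the offset from the limit point. *)
Definition sl_solution (R : realType) (q : R -> R) (mu : R) (phi psi : R -> R) : Prop :=
  [/\ ac_on 1 phi psi, ac_on 1 psi (fun x => (q x + mu) * phi x),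
      phi 0 = 0 & psi 0 = 1].

Lemma sl_solution_continuous (R : realType) (q phi psi : R -> R) (mu : R) :
  sl_solution q mu phi psi -> {within `[0, 1], continuous phi}.
Proof. by move=> [A _ _ _]; exact: ac_on_continuous A. Qed.

(** As a function of s, gsin (x - s) psi s + gcos (x - s) phi s has derivative q phi gsin (x - s),
    the terms in mu cancelling. Integrating from 0 to x gives the formula without any
    differentiation under the integral. *)
Lemma variation_of_constants (R : realType) (q phi psi : R -> R) (mu x : R) :
  mu != 0 -> sl_solution q mu phi psi -> 0 <= x <= 1 ->
  phi x = gsin mu x +
    \int[leb R]_(s in `[0, x]) (q s * (phi s * gsin mu (x - s))).
Proof.
move=> mu0 [A1 A2 phi0 psi0] /andP[x0 x1].
have {}A1 := ac_on_le x1 A1; have {}A2 := ac_on_le x1 A2.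
have dS (s : R) : is_derive s 1 (fun s => gsin mu (x - s)) (- gcos mu (x - s)).
  exact/is_derive_reflect/is_derive_gsin.
have dC (s : R) : is_derive s 1 (fun s => gcos mu (x - s)) (- (mu * gsin mu (x - s))).
  exact/is_derive_reflect/is_derive_gcos.
have cS := is_derive_continuous dS; have cC := is_derive_continuous dC.
have AS : ac_on x (fun s => gsin mu (x - s)) (fun s => - gcos mu (x - s)).
  by apply: is_derive_ac_on => // s; apply: cvgN; exact: cC.
have AC : ac_on x (fun s => gcos mu (x - s)) (fun s => - (mu * gsin mu (x - s))).
  apply: is_derive_ac_on => // s; apply: cvgN; apply: cvgM; first exact: cvg_cst.
  exact: cS.
have [_ /(_ x)] : ac_on x (fun s => gsin mu (x - s) * psi s + gcos mu (x - s) * phi s)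
    (fun s => q s * (phi s * gsin mu (x - s))).
  apply: (eq_ac_on x0 _ _ (ac_onD (ac_onM x0 AS A2) (ac_onM x0 AC A1))) => //.
  by move=> s _; ring.
rewrite x0 lexx subrr gsin0 gcos0 mul0r add0r mul1r subr0 psi0 phi0 mulr1 mulr0 addr0.
exact.
Qed.

(** The comparison for one factor is used on each factor in turn, the value of the other at the
    fixed x being absorbed into the coefficients. The intermediate sum is that of b phi1 gsin:
    replacing phi1 by gsin costs 2 C1 m, replacing phi2 costs C2 (2 C1 + 2) m. *)
Lemma product_transmutation_bound (R : realType) (q1 q2 : R -> R) :
  L1_on `[0, 1] q1 -> L1_on `[0, 1] q2 ->
  exists2 C : R, 0 <= C & forall n (mu b : 'I_n -> R)
      (phi1 phi2 psi1 psi2 : 'I_n -> R -> R) (x m : R),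
    (forall j, mu j != 0) ->
    (forall j, sl_solution q1 (mu j) (phi1 j) (psi1 j)) ->
    (forall j, sl_solution q2 (mu j) (phi2 j) (psi2 j)) ->
    0 <= x <= 1 ->
    (forall z : R, 0 <= z <= 2 * x -> `|\sum_(j < n) b j * gprim 3 (mu j) z| <= m) ->
    `|\sum_(j < n) b j * (phi1 j x * phi2 j x) -
      (\sum_(j < n) b j * gprim 2 (mu j) (2 * x)) / 2| <= C * m.
Proof.
move=> /transmutation_bound[C1 C10 T1] /transmutation_bound[C2 C20 T2].
exists (2 * C1 + C2 * (2 * C1 + 2)); first by rewrite addr_ge0// ?mulr_ge0// addr_ge0// mulr_ge0.
move=> n mu b phi1 phi2 psi1 psi2 x m mu0 sol1 sol2 x01 Vm.
have [x0 x1] := andP x01.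
have m0 : 0 <= m by rewrite (le_trans (normr_ge0 _) (Vm 0 _))// lexx mulr_ge0.
have Vm' z : - (2 * x) <= z <= 2 * x -> `|\sum_(j < n) b j * gprim 3 (mu j) z| <= m.
  move=> /andP[z1 z2]; have [z0|z0] := leP 0 z; first by apply: Vm; rewrite z0.
  have -> : \sum_(j < n) b j * gprim 3 (mu j) z =
      - \sum_(j < n) b j * gprim 3 (mu j) (- z).
    by rewrite -sumrN; apply: eq_bigr => j _; rewrite gprim3N mulrN opprK.
  by rewrite normrN; apply: Vm; lra.
(* Three sums of third primitives appear, with weights 1/2, 1/2 and 1, whence 2 m. Their arguments
   have modulus at most 2 x. *)
have ST y z : 0 <= y <= x -> 0 <= z <= x ->
    `|\sum_(j < n) b j * gsin (mu j) y * gprim 2 (mu j) z| <= 2 * m.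
  move=> /andP[y0 yx] /andP[z0 zx].
  have -> : \sum_(j < n) b j * gsin (mu j) y * gprim 2 (mu j) z =
    (\sum_(j < n) b j * gprim 3 (mu j) (y + z) +
     \sum_(j < n) b j * gprim 3 (mu j) (y - z)) / 2 -
     \sum_(j < n) b j * gprim 3 (mu j) y.
    rewrite -big_split mulr_suml -sumrB; apply: eq_bigr => j _ /=.
    by rewrite -mulrA gsin_gprim2M//; field.
  have h1 : `|\sum_(j < n) b j * gprim 3 (mu j) (y + z)| <= m by apply: Vm'; lra.
  have h2 : `|\sum_(j < n) b j * gprim 3 (mu j) (y - z)| <= m by apply: Vm'; lra.
  have h3 : `|\sum_(j < n) b j * gprim 3 (mu j) y| <= m by apply: Vm'; lra.
  apply: le_trans (ler_normB _ _) _; rewrite normrM [ `|2^-1|]ger0_norm ?invr_ge0//.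
  have := ler_normD (\sum_(j < n) b j * gprim 3 (mu j) (y + z))
    (\sum_(j < n) b j * gprim 3 (mu j) (y - z)).
  by lra.
(* Integrating the previous bound in the argument of gsin, over a length at most 1, turns gsin into
   [gprim 2]. *)
have TTm z w : 0 <= z <= x -> 0 <= w <= x ->
    `|\sum_(j < n) b j * gprim 2 (mu j) z * gprim 2 (mu j) w| <= 2 * m.
  move=> /andP[z0 zx] wx.
  pose f (z : R) := \sum_(j < n) (b j * gprim 2 (mu j) w) * gprim 2 (mu j) z.
  have f' (y : R) : is_derive y 1 f (\sum_(j < n) (b j * gprim 2 (mu j) w) * gsin (mu j) y).
    apply: is_derive_sumf => j; apply: is_derive_scale.
    exact: (@is_derive_gprim _ 1).
  have := @ler_norm_increment R f _ 0 z (2 * m) z0 f' _.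
  have -> : f 0 = 0 by rewrite /f big1// => j _; rewrite gprim0 mulr0.
  rewrite !subr0.
  have -> : \sum_(j < n) b j * gprim 2 (mu j) z * gprim 2 (mu j) w = f z.
    by apply: eq_bigr => j _; rewrite mulrAC.
  move=> H; apply: le_trans (H _) _; last first.
    by rewrite ler_piMr// ?mulr_ge0//; lra.
  move=> y /andP[y0 yz].
  under eq_bigr => j _ do rewrite mulrAC.
  by apply: ST => //; lra.
pose b1 j := b j * gsin (mu j) x.
have c1 j := sl_solution_continuous (sol1 j).
have c2 j := sl_solution_continuous (sol2 j).
have v1 j := variation_of_constants (mu0 j) (sol1 j).
have v2 j := variation_of_constants (mu0 j) (sol2 j).
have x1' y : 0 <= y <= x -> 0 <= y <= 1 by lra.
have E1 : `|\sum_(j < n) b1 j * phi1 j x - \sum_(j < n) b1 j * gsin (mu j) x| <= C1 * (2 * m).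
  apply: (T1 n mu b1 phi1 x (2 * m) mu0 c1 _ x01) => [j y|z zx]; first exact: v1.
  by apply: ST => //; rewrite x0 lexx.
(* This is the hypothesis needed to compare phi2 with gsin under the coefficients [b j * phi1 j x].
   It comes from comparing phi1 with gsin under the coefficients [b j * gprim 2 (mu j) z]. *)
have E2 z : 0 <= z <= x -> `|\sum_(j < n) (b j * phi1 j x) * gprim 2 (mu j) z| <= (2 * C1 + 2) * m.
  move=> zx.
  have := T1 n mu (fun j => b j * gprim 2 (mu j) z) phi1 x (2 * m) mu0 c1 (fun j y => v1 y j) x01 _.
  have xx : 0 <= x <= x by rewrite x0 lexx.
  move=> /(_ (fun w wx => TTm z w zx wx)).
  have := ST x z xx zx.
  have -> : \sum_(j < n) b j * gsin (mu j) x * gprim 2 (mu j) z =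
      \sum_(j < n) b j * gprim 2 (mu j) z * gsin (mu j) x.
    by apply: eq_bigr => j _; rewrite mulrAC.
  have -> : \sum_(j < n) b j * phi1 j x * gprim 2 (mu j) z =
      \sum_(j < n) b j * gprim 2 (mu j) z * phi1 j x.
    by apply: eq_bigr => j _; rewrite mulrAC.
  by move=> hA hB; apply: le_trans (ler_norm_subD hB hA) _; lra.
have := T2 n mu (fun j => b j * phi1 j x) phi2 x ((2 * C1 + 2) * m) mu0 c2 (fun j y => v2 y j) x01 E2.
have -> : (\sum_(j < n) b j * gprim 2 (mu j) (2 * x)) / 2 = \sum_(j < n) b1 j * gsin (mu j) x.
  rewrite mulr_suml; apply: eq_bigr => j _; rewrite /b1 -[RHS]mulrA gsinM// subrr gprim0 subr0.
  have -> : x + x = 2 * x by ring.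
  by rewrite mulrA.
move: E1.
have -> : \sum_(j < n) b1 j * phi1 j x = \sum_(j < n) b j * phi1 j x * gsin (mu j) x.
  by apply: eq_bigr => j _; rewrite /b1 mulrAC.
have -> : \sum_(j < n) b j * phi1 j x * phi2 j x = \sum_(j < n) b j * (phi1 j x * phi2 j x).
  by apply: eq_bigr => j _; rewrite mulrA.
move=> hA hB.
apply: le_trans (ler_distD (\sum_(j < n) b j * phi1 j x * gsin (mu j) x) _ _) _.
by lra.
Qed.

(** * Completeness of products of solutions *)

Definition unif_closure (R : realType) (b : R) (V : (R -> R) -> Prop)
    (f : R -> R) : Prop :=
  forall e, 0 < e -> exists2 g, V g & forall x, 0 <= x <= b -> `|f x - g x| <= e.

Definition lin_closed (R : realType) (V : (R -> R) -> Prop) : Prop :=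
  forall (c : R) f g, V f -> V g -> V (fun x => f x + c * g x).

Lemma unif_closure_lin (R : realType) (b : R) (V : (R -> R) -> Prop) :
  lin_closed V -> lin_closed (unif_closure b V).
Proof.
move=> linV c f g Vf Vg e e0.
have c0 : 0 < `|c| + 1 by rewrite ltr_pwDr.
have [f' Vf' ff'] := Vf (e / 2) (divr_gt0 e0 (ltr0Sn _ _)).
have [g' Vg' gg'] := Vg (e / 2 / (`|c| + 1)) (divr_gt0 (divr_gt0 e0 (ltr0Sn _ _)) c0).
exists (fun x => f' x + c * g' x); first exact: linV.
move=> x xb; have -> : f x + c * g x - (f' x + c * g' x) =
  (f x - f' x) + c * (g x - g' x) by ring.
apply: le_trans (ler_normD _ _) _; rewrite normrM.
have h1 := ff' x xb; have := gg' x xb.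
rewrite ler_pdivlMr// => h2.
have : `|c| * `|g x - g' x| <= `|g x - g' x| * (`|c| + 1).
  by rewrite mulrC; apply: ler_wpM2l => //; rewrite lerDl.
lra.
Qed.

Lemma unif_closure_idem (R : realType) (b : R) (V : (R -> R) -> Prop) (f : R -> R) :
  unif_closure b (unif_closure b V) f -> unif_closure b V f.
Proof.
move=> Vf e e0; have e20 : 0 < e / 2 by rewrite divr_gt0.
have [g Vg fg] := Vf _ e20; have [h Vh gh] := Vg _ e20.
exists h => // x xb; apply: le_trans (ler_distD (g x) _ _) _.
by have := fg x xb; have := gh x xb; lra.
Qed.

Lemma sub_unif_closure (R : realType) (b : R) (V : (R -> R) -> Prop) (f : R -> R) :
  V f -> unif_closure b V f.
Proof. by move=> Vf e e0; exists f => // x _; rewrite subrr normr0 ltW. Qed.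

(* Divided differences at the accumulation point: the Taylor coefficients in mu
   at mu = 0 are uniform limits of linear combinations of the E 0 mu. *)
Lemma taylor_coefficients_closure (R : realType) (b : R) (V : (R -> R) -> Prop)
    (M : set R) (E : nat -> R -> R -> R) (e : nat -> R -> R) :
  lin_closed V ->
  (forall eps, 0 < eps -> exists mu, [/\ M mu, mu != 0 & `|mu| <= eps]) ->
  (forall n mu x, M mu -> mu != 0 -> E n mu x = e n x + mu * E n.+1 mu x) ->
  (forall n, exists K, forall mu x, M mu -> mu != 0 -> `|mu| <= 1 -> 0 <= x <= b ->
     `|E n mu x| <= K) ->
  (forall mu, M mu -> mu != 0 -> V (E 0%N mu)) ->
  forall n, unif_closure b V (e n).
Proof.
move=> linV M0 Ee EK VE.
have linC := unif_closure_lin (b := b) linV.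
have H n : (forall mu, M mu -> mu != 0 -> unif_closure b V (E n mu)) ->
    unif_closure b V (e n).
  move=> VEn; apply: unif_closure_idem => eps eps0.
  have [K EnK] := EK n.+1.
  have K0 : 0 < `|K| + 1 by rewrite ltr_pwDr.
  (* [E n mu] differs from [e n] by mu times [E n.+1 mu], hence little for small mu; the minimum
     with 1 keeps mu in the range of the uniform bound. *)
  have [|mu [Mmu mu0 mue]] := M0 (Num.min 1 (eps / (`|K| + 1))).
    by rewrite lt_min ltr01 divr_gt0.
  exists (E n mu); first exact: VEn.
  move=> x xb; rewrite Ee// opprD addrA subrr sub0r normrN normrM.
  move: mue; rewrite le_min => /andP[mu1]; rewrite ler_pdivlMr// => mue.
  apply: le_trans mue; apply: ler_wpM2l => //.
  by apply: le_trans (EnK mu x Mmu mu0 mu1 xb) _; have := ler_norm K; lra.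
suff VE' n : forall mu, M mu -> mu != 0 -> unif_closure b V (E n mu).
  by move=> n; exact/H/VE'.
elim: n => [mu Mmu mu0|n IH mu Mmu mu0]; first exact/sub_unif_closure/VE.
have -> : E n.+1 mu = (fun x => 0 * E n mu x + mu^-1 * (E n mu x + (-1) * e n x)).
  by apply/funext => x; rewrite (Ee n)//; field.
have h1 := linC (-1) _ _ (IH _ Mmu mu0) (H _ IH).
have h0 : unif_closure b V (fun x => 0 * E n mu x).
  have := linC (-1) _ _ (IH _ Mmu mu0) (IH _ Mmu mu0).
  by congr unif_closure; apply/funext => x; ring.
exact: linC.
Qed.

(** Up to the factor 2, the combinations of the squares of the solutions for q = 0. Parameters and
    coefficients are paired in one list, so that addition is concatenation. *)
Definition gprim2_span (R : realType) (M : set R) (f : R -> R) : Prop :=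
  exists2 s : seq (R * R), (forall i, i \in s -> M i.1 /\ i.1 != 0) &
    forall x, f x = \sum_(i <- s) i.2 * gprim 2 i.1 (2 * x).

Lemma gprim2_span_lin (R : realType) (M : set R) : lin_closed (gprim2_span M).
Proof.
move=> c f g [s Ms fs] [t Mt gt]; exists (s ++ [seq (i.1, c * i.2) | i <- t]).
  move=> i; rewrite mem_cat => /orP[/Ms//|/mapP[j jt ->]]; exact: (Mt _ jt).
move=> x; rewrite big_cat/= big_map fs gt mulr_sumr; congr (_ + _).
by apply: eq_bigr => i _ /=; rewrite mulrA.
Qed.

(** The coefficients of gprim 2 mu (2 x) in powers of mu are (2 x)^(2n+2) / (2n+2)!. The exponents
    start at 2, and the constants are not reached. *)
Lemma gprim2_closure_even_pow (R : realType) (M : set R) :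
  (forall eps, 0 < eps -> exists mu, [/\ M mu, mu != 0 & `|mu| <= eps]) ->
  forall n, unif_closure 1 (gprim2_span M) (fun x => x ^+ n.*2.+2).
Proof.
move=> M0 n; pose e (n : nat) (x : R) := (2 * x) ^+ n.*2.+2 / n.*2.+2`!%:R.
have : unif_closure 1 (gprim2_span M) (e n).
  apply: (@taylor_coefficients_closure R 1 (gprim2_span M) M
    (fun n mu x => gprim n.*2.+2 mu (2 * x)) e _ M0) => //.
  - exact: gprim2_span_lin.
  - by move=> k mu x _ mu0; rewrite gprimE// doubleS.
  - move=> k; exists (expR 2 * 2 ^+ k.*2.+2) => mu x _ mu0 mu1 x01.
    by apply: gprim_bound => //; lra.
  - move=> mu Mmu mu0; exists [:: (mu, 1)].
      by move=> i; rewrite inE => /eqP ->.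
    by move=> x; rewrite big_seq1 mul1r.
have linC := unif_closure_lin (b := 1) (@gprim2_span_lin R M).
move=> Ve; have h0 : unif_closure 1 (gprim2_span M) (fun x => 0).
  have := linC (-1) _ _ Ve Ve.
  by congr unif_closure; apply/funext => x; ring.
have := linC (n.*2.+2`!%:R / 2 ^+ n.*2.+2) _ _ h0 Ve.
congr unif_closure; apply/funext => x; rewrite /e add0r exprMn.
have ? : n.*2.+2`!%:R != 0 :> R by rewrite pnatr_eq0 -lt0n fact_gt0.
have ? : 2 ^+ n.*2.+2 != 0 :> R by rewrite expf_neq0.
by field; apply/andP; split.
Qed.

Lemma is_derive_double (R : realType) (f : R -> R) (x df : R) :
  is_derive (2 * x) 1 f df -> is_derive x 1 (fun y => f (2 * y)) (2 * df).
Proof.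
move=> f'; have f'' : is_derive (2 * x + 0) 1 f df by rewrite addr0.
by apply: eq_is_derive (is_derive_affine f'') => // y; rewrite addr0.
Qed.

(** Approximate P by a combination Q in the span and let D be the same combination of the true
    products minus Q / 2. Orthogonality gives int p D = - (int p Q) / 2, while D x is controlled by
    the primitives of Q up to x alone. This causality permits a separate bound m0 before y and
    charges m1 only to the mass of p on [y, 1]. The factor 4 is 2 from the half in Q / 2 times 2
    from the doubled argument. *)
Lemma orthogonality_bound (R : realType) (q1 q2 p : R -> R) (M : set R)
    (phi1 psi1 phi2 psi2 : R -> R -> R) :
  L1_on `[0, 1] q1 -> L1_on `[0, 1] q2 -> L1_on `[0, 1] p ->
  (forall mu, M mu -> sl_solution q1 mu (phi1 mu) (psi1 mu)) ->
  (forall mu, M mu -> sl_solution q2 mu (phi2 mu) (psi2 mu)) ->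
  (forall mu, M mu -> \int[leb R]_(x in `[0, 1]) (p x * (phi1 mu x * phi2 mu x)) = 0) ->
  exists2 C : R, 0 <= C & forall (P : R -> R) (y m0 m1 : R),
    unif_closure 1 (gprim2_span M) P -> continuous P -> 0 <= y <= 1 ->
    (forall x, 0 <= x <= y -> `|\int[leb R]_(s in `[0, x]) P s| <= m0) ->
    (forall x, 0 <= x <= 1 -> `|\int[leb R]_(s in `[0, x]) P s| <= m1) ->
    `|\int[leb R]_(x in `[0, 1]) (p x * P x)| <=
      C * (m0 * \int[leb R]_(x in `[0, 1]) `|p x| +
           m1 * \int[leb R]_(x in `[y, 1]) `|p x|).
Proof.
move=> q1i q2i pi sol1 sol2 orth.
have [C C0 PB] := product_transmutation_bound q1i q2i.
exists (4 * C); first by rewrite mulr_ge0.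
move=> P y m0 m1 VP cP /[dup] y01 /andP[y0 y1] Pm0 Pm1.
set N := \int[leb R]_(x in `[0, 1]) `|p x|.
set T := \int[leb R]_(x in `[y, 1]) `|p x|.
have N0 : 0 <= N by exact: Rintegral_ge0.
have T0 : 0 <= T by exact: Rintegral_ge0.
have m00 : 0 <= m0 by rewrite (le_trans (normr_ge0 _) (Pm0 0 _))// lexx.
have m10 : 0 <= m1 by rewrite (le_trans (normr_ge0 _) (Pm1 0 _))// lexx ler01.
suff H e : 0 < e -> `|\int[leb R]_(x in `[0, 1]) (p x * P x)| <=
    4 * C * (m0 * N + m1 * T) + (4 * C * (N + T) + N) * e.
  apply/ler_addgt0Pr => e e0.
  have K0 : 0 < 4 * C * (N + T) + N + 1.
    by rewrite ltr_pwDr// !addr_ge0// !mulr_ge0// addr_ge0.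
  have := H _ (divr_gt0 e0 K0); move=> /le_trans; apply; rewrite lerD2l.
  by rewrite mulrCA ger_pMr// ler_pdivrMr// mul1r lerDl.
move=> e0; have [Q [s Ms Qs] PQ] := VP e e0.
pose n := size s; pose mu (j : 'I_n) := (nth (0, 0) s j).1.
pose b (j : 'I_n) := (nth (0, 0) s j).2.
have Mmu j : M (mu j) /\ mu j != 0 by apply: Ms; exact: mem_nth.
have QE x : Q x = \sum_(j < n) b j * gprim 2 (mu j) (2 * x).
  by rewrite Qs (big_nth (0, 0)) big_mkord.
have mu0 j : mu j != 0 by have [] := Mmu j.
have dF (x : R) : is_derive x 1 (fun x => \sum_(j < n) b j * gprim 3 (mu j) (2 * x)) (2 * Q x).
  have -> : 2 * Q x = \sum_(j < n) b j * (2 * gprim 2 (mu j) (2 * x)).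
    by rewrite QE mulr_sumr; apply: eq_bigr => j _; ring.
  apply: is_derive_sumf => j; apply: is_derive_scale.
  apply: is_derive_double; exact: is_derive_gprim.
have cQ : continuous Q.
  have -> : Q = (fun x => \sum_(j < n) b j * gprim 2 (mu j) (2 * x)).
    by apply/funext => x; rewrite QE.
  apply: (@is_derive_continuous _ _ (fun x => \sum_(j < n) b j * (2 * gprim 1 (mu j) (2 * x)))) => x.
  apply: is_derive_sumf => j; apply: is_derive_scale.
  apply: is_derive_double; exact: is_derive_gprim.
have iP x : L1_on `[0, x] P by apply: L1_on_continuous; exact: continuous_subspaceT.
have iQ x : L1_on `[0, x] Q by apply: L1_on_continuous; exact: continuous_subspaceT.
have c2Q : continuous (fun x => 2 * Q x).
  by move=> x; apply: cvgM; [exact: cvg_cst|exact: cQ].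
(* The derivative of gprim 3 mu (2 x) is 2 gprim 2 mu (2 x), so the hypothesis of the product
   comparison becomes a bound on the primitive of Q. *)
have FE x : 0 <= x <= 1 -> \sum_(j < n) b j * gprim 3 (mu j) (2 * x) =
    2 * \int[leb R]_(s in `[0, x]) Q s.
  move=> x01; have [_ /(_ x x01) ->] := is_derive_ac_on 1 dF c2Q.
  rewrite big1 ?add0r ?RintegralZl//; first exact: iQ.
  by move=> j _; rewrite mulr0 gprim0 mulr0.
have QPe x : 0 <= x <= 1 -> `|\int[leb R]_(s in `[0, x]) Q s - \int[leb R]_(s in `[0, x]) P s| <= e.
  move=> /andP[x0 x1]; rewrite -RintegralB//; [|exact: iQ|exact: iP].
  have h : L1_on `[0, x] (fun s => Q s - P s).
    by apply: L1_on_continuous; apply: continuous_subspaceT => z; apply: cvgB; [exact: cQ|exact: cP].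
  apply: (@le_trans _ _ (\int[leb R]_(s in `[0, x]) e)).
    apply: ler_norm_Rintegral => //.
      by apply: L1_on_continuous; apply: continuous_subspaceT => z; exact: cvg_cst.
    move=> z /=; rewrite in_itv/= => /andP[z0 zx]; rewrite distrC PQ// z0.
    exact: le_trans x1.
  rewrite Rintegral_cst//= lebesgue_measure_itv/= lte_fin.
  have [_|_] := ltP 0 x; last by rewrite mulr0 ltW.
  by rewrite -EFinB/= subr0 ler_piMr// ltW.
have Qm x m : 0 <= x <= 1 -> `|\int[leb R]_(s in `[0, x]) P s| <= m ->
    `|\int[leb R]_(s in `[0, x]) Q s| <= m + e.
  by move=> x01 h; rewrite addrC; exact: ler_norm_subD (QPe x x01) h.
pose ph1 j := phi1 (mu j); pose ph2 j := phi2 (mu j).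
have s1 j : sl_solution q1 (mu j) (ph1 j) (psi1 (mu j)) by apply: sol1; have [] := Mmu j.
have s2 j : sl_solution q2 (mu j) (ph2 j) (psi2 (mu j)) by apply: sol2; have [] := Mmu j.
pose D x := \sum_(j < n) b j * (ph1 j x * ph2 j x) - Q x / 2.
have Dm x m : 0 <= x <= 1 -> (forall z, 0 <= z <= x -> `|\int[leb R]_(s in `[0, z]) P s| <= m) ->
    `|D x| <= C * (2 * (m + e)).
  move=> x01 Pm; rewrite /D QE.
  apply: (PB n mu b ph1 ph2 (fun j => psi1 (mu j)) (fun j => psi2 (mu j)) x) => //.
  move=> z zx; have -> : z = 2 * (z / 2) by field.
  rewrite FE; last by lra.
  by rewrite normrM (ger0_norm (ler0n R 2)); apply: ler_wpM2l => //; apply: Qm; [lra|apply: Pm; lra].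
have cph j : {within `[0, 1], continuous (fun x => ph1 j x * ph2 j x)}.
  by apply: within_continuousM; [exact: sl_solution_continuous (s1 j)|exact: sl_solution_continuous (s2 j)].
have iph j : L1_on `[0, 1] (fun x => b j * (p x * (ph1 j x * ph2 j x))).
  by apply: L1_onZ => //; exact: L1_onM_continuous.
have ipQ : L1_on `[0, 1] (fun x => p x * Q x).
  by apply: L1_onM_continuous => //; exact: continuous_subspaceT.
have ipD : L1_on `[0, 1] (fun x => p x * D x).
  apply: (@eq_L1_on _ _ (fun x => \sum_(j < n) b j * (p x * (ph1 j x * ph2 j x)) + (- 2^-1) * (p x * Q x))) => //.
    move=> x _; rewrite /D mulrDr mulr_sumr; congr (_ + _); last by field.
    by apply: eq_bigr => j _; ring.
  by apply: L1_onD => //; [exact: L1_on_sum|exact: L1_onZ].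
have pD : \int[leb R]_(x in `[0, 1]) (p x * D x) = - (\int[leb R]_(x in `[0, 1]) (p x * Q x)) / 2.
  transitivity (\int[leb R]_(x in `[0, 1])
      (\sum_(j < n) b j * (p x * (ph1 j x * ph2 j x)) + (- 2^-1) * (p x * Q x))).
    apply: eq_Rintegral => x _; rewrite /D mulrDr mulr_sumr; congr (_ + _); last by field.
    by apply: eq_bigr => j _; ring.
  rewrite RintegralD//; [|exact: L1_on_sum|exact: L1_onZ].
  rewrite Rintegral_sum// RintegralZl// big1 ?add0r; first by field.
  move=> j _; rewrite RintegralZl//; last exact: L1_onM_continuous.
  by rewrite orth ?mulr0//; have [] := Mmu j.
have ipn : L1_on `[0, 1] (fun x => `|p x|) by exact: L1_on_norm.
have y1S : `[y, 1] `<=` `[0, 1].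
  by move=> z /=; rewrite !in_itv/= => /andP[/(le_trans y0) -> ->].
have Dy (a c K : R) : `[a, c] `<=` `[0, 1] -> 0 <= K -> (forall x, a <= x <= c -> `|D x| <= K) ->
    `|\int[leb R]_(x in `[a, c]) (p x * D x)| <= K * \int[leb R]_(x in `[a, c]) `|p x|.
  move=> ac K0 DK.
  have ipn' : L1_on `[a, c] (fun x => `|p x|) by exact: L1_onS ipn.
  have ipD' : L1_on `[a, c] (fun x => p x * D x) by exact: L1_onS ipD.
  rewrite -RintegralZl//; apply: ler_norm_Rintegral => //; first exact: L1_onZ.
  move=> x /=; rewrite in_itv/= => xac; rewrite normrM mulrC.
  by apply: ler_wpM2r => //; exact: DK.
have pQ : `|\int[leb R]_(x in `[0, 1]) (p x * Q x)| <= 4 * C * ((m0 + e) * N + (m1 + e) * T).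
  have -> : \int[leb R]_(x in `[0, 1]) (p x * Q x) = - 2 * \int[leb R]_(x in `[0, 1]) (p x * D x).
    by rewrite pD; field.
  rewrite normrM normrN (ger0_norm (ler0n R 2)) (Rintegral_split y01 ipD).
  have h1 : `|\int[leb R]_(x in `[0, y]) (p x * D x)| <= C * (2 * (m0 + e)) * N.
    apply: (@le_trans _ _ (C * (2 * (m0 + e)) * \int[leb R]_(x in `[0, y]) `|p x|)).
      apply: Dy; first by move=> z /=; rewrite !in_itv/= => /andP[-> /le_trans]; apply.
        by rewrite !mulr_ge0// addr_ge0// ltW.
      move=> x /andP[x0 xy]; apply: Dm; first by rewrite x0 (le_trans xy).
      by move=> z /andP[z0 zx]; apply: Pm0; rewrite z0 (le_trans zx).
    apply: ler_wpM2l; first by rewrite !mulr_ge0// addr_ge0// ltW.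
    by rewrite /N (Rintegral_split y01 ipn) lerDl.
  have h2 : `|\int[leb R]_(x in `[y, 1]) (p x * D x)| <= C * (2 * (m1 + e)) * T.
    apply: Dy => //; first by rewrite !mulr_ge0// addr_ge0// ltW.
    move=> x /andP[yx x1]; apply: Dm; first by rewrite x1 (le_trans y0).
    by move=> z /andP[z0 zx]; apply: Pm1; rewrite z0 (le_trans zx).
  have := ler_normD (\int[leb R]_(x in `[0, y]) (p x * D x)) (\int[leb R]_(x in `[y, 1]) (p x * D x)).
  by lra.
have ipP : L1_on `[0, 1] (fun x => p x * P x).
  by apply: L1_onM_continuous => //; exact: continuous_subspaceT.
have pPQ : `|\int[leb R]_(x in `[0, 1]) (p x * P x) - \int[leb R]_(x in `[0, 1]) (p x * Q x)| <= e * N.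
  rewrite -RintegralB// -RintegralZl//; apply: ler_norm_Rintegral => //; last 2 first.
  - exact: L1_onZ.
  - move=> x /=; rewrite in_itv/= => x01; rewrite -mulrBr normrM mulrC.
    by apply: ler_wpM2r => //; exact: PQ.
  apply: (@eq_L1_on _ _ (fun x => p x * P x + (-1) * (p x * Q x))) => //.
    by move=> x _; rewrite mulN1r.
  by apply: L1_onD => //; exact: L1_onZ.
by have := ler_norm_subD pPQ pQ; lra.
Qed.

(** * Polynomial approximation of indicators of intervals *)

Lemma bounded_cvg_Rintegral (R : realType) (D : set R) (f : R -> R)
    (g_ : nat -> R -> R) (g : R -> R) (K : R) :
  measurable D -> L1_on D f -> (forall m, measurable_fun D (g_ m)) ->
  measurable_fun D g ->
  {ae leb R, forall x, D x -> g_ m x @[m --> \oo] --> g x} ->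
  (forall m x, D x -> `|g_ m x| <= K) ->
  \int[leb R]_(x in D) (f x * g_ m x) @[m --> \oo] --> \int[leb R]_(x in D) (f x * g x).
Proof.
move=> mD fi mg_ mg gcv gK; have mf := L1_on_measurable fi.
have fK : L1_on D (fun x => K * `|f x|) by apply: L1_onZ => //; exact: L1_on_norm.
have [||||| fgi _ cv] := @dominated_convergence _ _ _ (leb R) D mD
  (fun m x => (f x * g_ m x)%:E) (fun x => (f x * g x)%:E)
  (fun x => (K * `|f x|)%:E).
- by move=> m; apply/measurable_EFinP; apply: measurable_funM; [exact: mf|exact: mg_].
- by apply/measurable_EFinP; apply: measurable_funM.
- move: gcv; apply: filterS; first exact: (ae_filter_ringOfSetsType (leb R)).
  move=> x gx Dx; apply: cvg_EFin; first exact: nearW.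
  by apply: cvgM; [exact: cvg_cst|exact: gx].
- exact: fK.
- apply: aeW => x m Dx; rewrite lee_fin normrM mulrC.
  by apply: ler_wpM2r => //; exact: gK.
have fin : (\int[leb R]_(x in D) (f x * g x)%:E)%E \is a fin_num.
  exact: integrable_fin_num.
apply: fine_cvg; rewrite /Rintegral fineK//; exact: cv.
Qed.

Lemma ae_neq (R : realType) (a : R) : {ae leb R, forall x, x != a}.
Proof.
exists [set a]; split => //; first exact: lebesgue_measure_set1.
by move=> x /= /negP; rewrite negbK => /eqP.
Qed.

(* (1 - s)^k is close to 1 when k s is small and close to 0 when k s is large;
   with s = (x/b)^(2m) and k ~ (b/y)^(2m) the transition happens at x = y. *)
Definition step_poly (R : realType) (b y : R) (m : nat) (x : R) : R :=
  (1 - (x / b) ^+ m.+1.*2) ^+ (Num.truncn ((b / y) ^+ m.+1.*2)).+1.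

Lemma bernoulli_le (R : realType) (s : R) k : 0 <= s <= 1 ->
  1 - k%:R * s <= (1 - s) ^+ k.
Proof.
move=> /andP[s0 s1]; elim: k => [|k IH]; first by rewrite mul0r subr0 expr0.
rewrite exprSr; apply: (@le_trans _ _ ((1 - k%:R * s) * (1 - s))); last first.
  by apply: ler_wpM2r => //; rewrite subr_ge0.
have : 0 <= k%:R * s * s by rewrite !mulr_ge0.
by rewrite -natr1; lra.
Qed.

(** The upper companion (1 - s)^k <= 1 / (1 + k s) of Bernoulli's inequality, cleared of its
    quotient and proved by the same induction. *)
Lemma pow_onem_le (R : realType) (s : R) k : 0 <= s <= 1 ->
  (1 - s) ^+ k * (1 + k%:R * s) <= 1.
Proof.
move=> /andP[s0 s1]; elim: k => [|k IH]; first by rewrite mul0r addr0 expr0 mul1r.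
apply: le_trans IH; rewrite exprSr -mulrA; apply: ler_wpM2l.
  by rewrite exprn_ge0// subr_ge0.
have : 0 <= k%:R * s * s by rewrite !mulr_ge0.
have : 0 <= s * s by rewrite mulr_ge0.
by rewrite -natr1; lra.
Qed.

Lemma step_poly_bound (R : realType) (b y : R) m x : 0 < b -> 0 <= x <= b ->
  0 <= step_poly b y m x <= 1.
Proof.
move=> b0 /andP[x0 xb]; have h : 0 <= (x / b) ^+ m.+1.*2 <= 1.
  by rewrite exprn_ge0 ?divr_ge0 ?(ltW b0)//= exprn_ile1 ?divr_ge0 ?(ltW b0)// ler_pdivrMr// mul1r.
rewrite exprn_ge0/=; last by rewrite subr_ge0; case/andP: h.
by rewrite exprn_ile1; lra.
Qed.

Lemma ler_expn_double (R : realType) (z : R) m : 0 <= z <= 1 -> z ^+ m.+1.*2 <= z ^+ m.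
Proof.
move=> z01; apply: ler_wiXn2l; [by case/andP: z01|by case/andP: z01|].
by rewrite -addnn addSnnS leq_addr.
Qed.

Lemma step_poly_cvg1 (R : realType) (b y x : R) : 0 < y -> y < b -> 0 <= x -> x < y ->
  step_poly b y m x @[m --> \oo] --> (1 : R).
Proof.
move=> y0 yb x0 xy; have b0 : 0 < b := lt_trans y0 yb.
have z0 : 0 <= x / y by rewrite divr_ge0// ltW.
have z1 : x / y < 1 by rewrite ltr_pdivrMr// mul1r.
(* The exponent k is at most (b/y)^(2m+2) + 1, so k s <= (x/y)^(2m+2) + (x/b)^(2m+2), and y < b
   bounds this by 2 (x/y)^(2m+2). *)
apply: (@squeeze_cvgr _ _ _ _ (fun m => 1 - 2 * (x / y) ^+ m) (fun=> 1)).
- apply: nearW => m; have xb01 : 0 <= x <= b by rewrite x0/= ltW// (lt_trans xy).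
  have /andP[_ ->] := step_poly_bound y m b0 xb01; rewrite andbT.
  set s := (x / b) ^+ m.+1.*2.
  have s01 : 0 <= s <= 1.
    by rewrite exprn_ge0 ?divr_ge0 ?(ltW b0)//= exprn_ile1 ?divr_ge0 ?(ltW b0)// ler_pdivrMr// mul1r; case/andP: xb01.
  apply: le_trans (bernoulli_le _ s01); rewrite -/s lerD2l lerN2.
  have r0 : 0 <= (b / y) ^+ m.+1.*2 by rewrite exprn_ge0// divr_ge0// ltW.
  have /andP[k1 _] := truncn_itv r0; have [s0 s1] := andP s01.
  have e1 : (b / y) ^+ m.+1.*2 * s = (x / y) ^+ m.+1.*2.
    rewrite -exprMn; congr (_ ^+ _); have ? : y != 0 by rewrite gt_eqF.
    have ? : b != 0 by rewrite gt_eqF.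
    by field; apply/andP; split.
  have e2 : s <= (x / y) ^+ m.+1.*2.
    apply: lerXn2r; rewrite ?nnegrE ?divr_ge0// ?(ltW b0) ?(ltW y0)//.
    by rewrite ler_wpM2l// lef_pV2 ?posrE// ltW.
  have e3 : (x / y) ^+ m.+1.*2 <= (x / y) ^+ m by apply: ler_expn_double; rewrite z0 ltW.
  move/(ler_wpM2r s0) : k1; rewrite e1 -natr1 mulrDl mul1r => k1; lra.
- rewrite -[X in _ --> X]subr0 -[X in _ --> _ - X](mulr0 2).
  apply: cvgB; first exact: cvg_cst.
  by apply: cvgM; [exact: cvg_cst|apply: cvg_expr; rewrite ger0_norm].
- exact: cvg_cst.
Qed.

Lemma step_poly_cvg0 (R : realType) (b y x : R) : 0 < y -> y < b -> y < x -> x <= b ->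
  step_poly b y m x @[m --> \oo] --> (0 : R).
Proof.
move=> y0 yb yx xb; have b0 : 0 < b := lt_trans y0 yb.
have x0 : 0 < x := lt_trans y0 yx.
have z0 : 0 <= y / x by rewrite divr_ge0// ltW.
have z1 : y / x < 1 by rewrite ltr_pdivrMr// mul1r.
(* Here k exceeds (b/y)^(2m+2), so k s is at least (x/y)^(2m+2) and (1 - s)^k is at most
   (y/x)^(2m+2). *)
apply: (@squeeze_cvgr _ _ _ _ (fun=> 0) (fun m => (y / x) ^+ m)).
- apply: nearW => m; have xb01 : 0 <= x <= b by rewrite (ltW x0).
  have /andP[-> _] /= := step_poly_bound y m b0 xb01.
  rewrite /step_poly; set s := (x / b) ^+ m.+1.*2.
  have s01 : 0 <= s <= 1.
    by rewrite exprn_ge0 ?divr_ge0 ?(ltW b0) ?(ltW x0)//= exprn_ile1 ?divr_ge0 ?(ltW b0) ?(ltW x0)// ler_pdivrMr// mul1r.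
  have r0 : 0 <= (b / y) ^+ m.+1.*2 by rewrite exprn_ge0// divr_ge0// ltW.
  have /andP[_ k1] := truncn_itv r0; have [s0 s1] := andP s01.
  set k := (Num.truncn _).+1 in k1 *.
  have e1 : (b / y) ^+ m.+1.*2 * s = ((y / x) ^+ m.+1.*2)^-1.
    rewrite -exprMn -exprVn; congr (_ ^+ _); have ? : y != 0 by rewrite gt_eqF.
    have ? : x != 0 by rewrite gt_eqF.
    have ? : b != 0 by rewrite gt_eqF.
    by field; repeat (apply/andP; split).
  have w0 : 0 < (y / x) ^+ m.+1.*2 by rewrite exprn_gt0// divr_gt0.
  have e3 : (y / x) ^+ m.+1.*2 <= (y / x) ^+ m by apply: ler_expn_double; rewrite z0 ltW.
  apply: le_trans e3; rewrite -[leRHS]mul1r -ler_pdivrMr// -e1.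
  apply: le_trans (pow_onem_le k s01).
  apply: ler_wpM2l; first by rewrite exprn_ge0// subr_ge0.
  by have := ler_wpM2r s0 (ltW k1); lra.
- exact: cvg_cst.
- by apply: cvg_expr; rewrite ger0_norm.
Qed.

Lemma even_poly_closed (R : realType) (V : (R -> R) -> Prop) : lin_closed V ->
  (forall n, V (fun x => x ^+ n.*2.+2)) ->
  forall q : {poly R}, V (fun x => x ^+ 2 * q.[x ^+ 2]).
Proof.
move=> linV Vx; suff H (q : {poly R}) : forall n, V (fun x => x ^+ n.*2.+2 * q.[x ^+ 2]).
  by move=> q; exact: (H q 0%N).
elim/poly_ind: q => [|q c IH] n.
  have := linV (-1) _ _ (Vx 0%N) (Vx 0%N).
  by congr V; apply/funext => x; rewrite horner0; ring.
have := linV c _ _ (IH n.+1) (Vx n); congr V; apply/funext => x.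
by rewrite hornerMXaddC doubleS !exprS; ring.
Qed.

(** By the geometric sum each step polynomial is 1 plus a combination of even powers from x^2 on;
    the difference removes the 1. *)
Lemma step_poly_closed (R : realType) (V : (R -> R) -> Prop) (b y z : R) m : lin_closed V ->
  (forall n, V (fun x => x ^+ n.*2.+2)) ->
  V (fun x => step_poly b y m x - step_poly b z m x).
Proof.
move=> linV Vx; pose c : R := b^-1 ^+ m.+1.*2.
pose q y : {poly R} := - (c%:P * 'X^m *
  \sum_(i < (Num.truncn ((b / y) ^+ m.+1.*2)).+1) (1 - c%:P * 'X^(m.+1)) ^+ i).
have qE w x : step_poly b w m x = 1 + x ^+ 2 * (q w).[x ^+ 2].
  rewrite /step_poly; set k := (Num.truncn _).+1.
  have -> : (x / b) ^+ m.+1.*2 = c * (x ^+ 2) ^+ m.+1.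
    by rewrite exprMn mulrC -exprM mul2n.
  rewrite -[LHS](subrK 1) addrC; congr (_ + _); rewrite subrX1 /q.
  have -> : \sum_(i < k) (1 - c * (x ^+ 2) ^+ m.+1) ^+ i =
      (\sum_(i < k) (1 - c%:P * 'X^(m.+1)) ^+ i).[x ^+ 2].
    by rewrite horner_sum; apply: eq_bigr => i _; rewrite !hornerE.
  rewrite hornerN !hornerM hornerC hornerXn.
  by rewrite exprS; ring.
have := linV (-1) _ _ (even_poly_closed linV Vx (q y)) (even_poly_closed linV Vx (q z)).
by congr V; apply/funext => x; rewrite !qE; ring.
Qed.

Lemma continuous_pow_comp (R : realType) (f : R -> R) n :
  continuous f -> continuous (fun x => f x ^+ n).
Proof.
by move=> cf x; exact: (continuous_comp (cf x) (@exprn_continuous R n (f x))).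
Qed.

Lemma continuous_step_poly (R : realType) (b y : R) m : continuous (step_poly b y m).
Proof.
apply: continuous_pow_comp => x; apply: cvgB; first exact: cvg_cst.
apply: (@continuous_pow_comp _ (fun x => x / b)) => z.
by apply: cvgM; [exact: cvg_id|exact: cvg_cst].
Qed.

Lemma Rintegral_mul_indic (R : realType) (b x1 x2 : R) (f : R -> R) :
  0 <= x1 -> x2 <= b ->
  \int[leb R]_(x in `[0, b]) (f x * \1_(`[x1, x2] : set R) x) =
  \int[leb R]_(x in `[x1, x2]) f x.
Proof.
move=> x10 x2b.
have -> : `[x1, x2]%classic = `[0, b] `&` `[x1, x2] :> set R.
  apply/seteqP; split => [x /=|x [_]//]; rewrite !in_itv/= => /andP[xx1 xx2].
  by rewrite (le_trans x10) ?xx1 ?xx2 ?(le_trans xx2).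
rewrite Rintegral_mkcondr; apply: eq_Rintegral => x; rewrite inE => xb.
rewrite patchE indicE in_setI mem_set//=.
by case: ifP => _; rewrite ?mulr1 ?mulr0.
Qed.

Section step_difference.
Context (R : realType) (b x1 x2 : R).
Context (x10 : 0 < x1) (x12 : x1 < x2) (x2b : x2 < b).

Definition step_diff m x := step_poly b x2 m x - step_poly b x1 m x.

Lemma continuous_step_diff m : continuous (step_diff m).
Proof. by move=> x; apply: cvgB; exact: continuous_step_poly. Qed.

Lemma step_diff_bound m x : 0 <= x <= b -> `|step_diff m x| <= 1.
Proof.
move=> xb; have b0 : 0 < b by rewrite (lt_trans x10)// (lt_trans x12).
have := step_poly_bound x1 m b0 xb; have := step_poly_bound x2 m b0 xb.
by rewrite /step_diff ler_norml; lra.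
Qed.

Lemma step_diff_cvg x : 0 <= x <= b -> x != x1 -> x != x2 ->
  step_diff m x @[m --> \oo] --> (\1_(`[x1, x2] : set R) x : R).
Proof.
move=> /andP[x0 xb] xx1 xx2; have x20 : 0 < x2 := lt_trans x10 x12.
have x1b : x1 < b := lt_trans x12 x2b.
rewrite indicE mem_setE in_itv/=.
have [xl|xg|xe] := ltgtP x x1; last by rewrite xe eqxx in xx1.
  rewrite [X in _ --> X](_ : _ = 1 - 1)/=; last by rewrite subrr.
  by apply: cvgB; apply: step_poly_cvg1 => //; rewrite (lt_trans xl).
have [xl|xg2|xe] := ltgtP x x2; last by rewrite xe eqxx in xx2.
  rewrite [X in _ --> X](_ : _ = 1 - 0)/=; last by rewrite subr0.
  by apply: cvgB; [exact: step_poly_cvg1|exact: step_poly_cvg0].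
rewrite [X in _ --> X](_ : _ = 0 - 0)/=; last by rewrite subr0.
by apply: cvgB; exact: step_poly_cvg0.
Qed.

Lemma ae_step_diff_cvg : {ae leb R, forall x, `[0, b]%classic x ->
  step_diff m x @[m --> \oo] --> (\1_(`[x1, x2] : set R) x : R)}.
Proof.
have := ae_neq x2; apply: filterS2 (ae_neq x1).
  exact: (ae_filter_ringOfSetsType (leb R)).
by move=> x xx1 xx2 /=; rewrite in_itv/= => xb; exact: step_diff_cvg.
Qed.

Lemma measurable_step_diff m (D : set R) : measurable_fun D (step_diff m).
Proof.
apply: (@measurable_funS _ _ _ _ setT) => //.
by apply: continuous_measurable_fun; exact: continuous_step_diff.
Qed.

Lemma step_diff_integral_cvg (f : R -> R) : L1_on `[0, b] f ->
  \int[leb R]_(x in `[0, b]) (f x * step_diff m x) @[m --> \oo] -->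
  \int[leb R]_(x in `[x1, x2]) f x.
Proof.
move=> fi; rewrite -(@Rintegral_mul_indic _ b) ?(ltW x10) ?(ltW x2b)//.
apply: (@bounded_cvg_Rintegral _ _ _ _ _ 1) => //.
- by move=> m; exact: measurable_step_diff.
- exact: ae_step_diff_cvg.
- by move=> m x /=; rewrite in_itv/=; exact: step_diff_bound.
Qed.

(** Convergence in L^1 controls the primitives of [step_diff] uniformly in their endpoint, and it is
    through these primitives that the orthogonality bound measures its argument. *)
Lemma step_diff_L1_cvg :
  \int[leb R]_(x in `[0, b]) `|step_diff m x - \1_(`[x1, x2] : set R) x|
    @[m --> \oo] --> (0 : R).
Proof.
have i1 : L1_on `[0, b] (fun=> 1 : R).
  by apply: L1_on_continuous; apply: continuous_subspaceT => z; exact: cvg_cst.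
have := @bounded_cvg_Rintegral R `[0, b] (fun=> 1)
  (fun m x => `|step_diff m x - \1_(`[x1, x2] : set R) x|) (fun=> 0) 2
  (measurable_itv _) i1.
have -> : \int[leb R]_(x in `[0, b]) (1 * 0) = 0 :> R.
  by rewrite mulr0 Rintegral_cst// mul0r.
have -> : (fun m => \int[leb R]_(x in `[0, b]) (1 * `|step_diff m x - \1_(`[x1, x2] : set R) x|)) =
   (fun m => \int[leb R]_(x in `[0, b]) `|step_diff m x - \1_(`[x1, x2] : set R) x|).
  by apply/funext => m; apply: eq_Rintegral => x _; rewrite mul1r.
apply => //.
- move=> m; apply: measurableT_comp => //; apply: measurable_funB.
    exact: measurable_step_diff.
  exact: measurable_indic.
- have := ae_step_diff_cvg; apply: filterS.
    exact: (ae_filter_ringOfSetsType (leb R)).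
  move=> x h /h{}h; rewrite -(normr0 R); apply: cvg_norm.
  rewrite -(subrr (\1_(`[x1, x2] : set R) x : R)).
  by apply: cvgB => //; exact: cvg_cst.
- move=> m x /=; rewrite in_itv/= => xb; rewrite normr_id.
  apply: le_trans (ler_normB _ _) _; have := step_diff_bound m xb.
  by rewrite indicE; case: (_ \in _); rewrite ?normr1 ?normr0; lra.
Qed.

End step_difference.

(** * From bounds on intervals to vanishing almost everywhere *)

Lemma ae_le_of_interval_bound (R : realType) (b C : R) (p : R -> R) :
  0 < b -> 0 <= C -> L1_on `[0, b] p ->
  (forall x1 x2, 0 < x1 -> x1 < x2 -> x2 < b ->
    `|\int[leb R]_(x in `[x1, x2]) p x| <=
      C * (x2 - x1) * \int[leb R]_(x in `[x1, b]) `|p x|) ->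
  {ae leb R, forall x, 0 < x < b ->
    `|p x| <= C * \int[leb R]_(s in `[x, b]) `|p s|}.
Proof.
move=> b0 C0 pi pint; pose p0 : R -> R := p \_ `[0, b].
have lp : locally_integrable [set: R] p0 by exact: (integrable_locally _ pi).
have p0i : L1_on setT p0.
  rewrite /L1_on /p0 -restrict_EFin.
  by apply/(@integrable_mkcond _ _ _ (leb R) _ (EFin \o p)) => //; exact: pi.
have p0y y : (leb R).-integrable `[0, y] (EFin \o p0).
  by apply: (@L1_onS _ _ setT).
have := FTC1 p0y lp; apply: filterS.
  exact: (ae_filter_ringOfSetsType (leb R)).
move=> x /[swap] /andP[x0 xb]; rewrite /= lte_fin => /(_ x0).
set F := fun x => _; move=> [dF F'].
have cv : h^-1 *: (F (h + x) - F x) @[h --> 0^'] --> p x.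
  have <- : derive1 F x = p x.
    by rewrite F' /p0 patchE mem_setE in_itv/= !ltW.
  rewrite derive1E; move: dF; rewrite /derivable /derive.
  rewrite (_ : (fun h : R => h^-1 *: ((F \o shift x) (h *: 1) - F x)) =
    (fun h : R => h^-1 *: (F (h + x) - F x))) //.
  by apply/funext => h; rewrite /= /GRing.scale/= mulr1.
(* Right increments are taken: with x1 = x and x2 = x + h the tail integral in the hypothesis does
   not depend on h. *)
have {}cv : `|h^-1 *: (F (h + x) - F x)| @[h --> 0^'+] --> `|p x|.
  by apply: cvg_norm; exact: cvg_dnbhs_at_right cv.
apply: (cvgr_to_le cv); near=> h.
have h0 : 0 < h by near: h; exact: nbhs_right_gt.
have hb : h < b - x by near: h; apply: nbhs_right_lt; rewrite subr_gt0.
have -> : F (h + x) - F x = \int[leb R]_(s in `[x, h + x]) p s.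
  have x0h : x <= h + x by rewrite lerDr ltW.
  have hxb : h + x <= b by lra.
  rewrite /F (@Rintegral_itvB R p0 (BLeft 0) (BRight (h + x)) x) ?bnd_simp//; last exact: ltW.
  rewrite Rintegral_itv_obnd_cbnd; last exact: (@L1_onS _ _ setT).
  apply: eq_Rintegral => z; rewrite inE/= in_itv/= => /andP[z1 z2].
  by rewrite /p0 patchE mem_setE in_itv/= (le_trans (ltW x0) z1) (le_trans z2 hxb).
rewrite normrZ normfV gtr0_norm// mulrC ler_pdivrMr//.
have := pint x (h + x) x0 _ _; rewrite addrK.
by rewrite mulrAC; apply; lra.
Unshelve. all: by end_near. Qed.

(** Gronwall in finitely many steps. If the tail mass [TT] vanishes at c, then |p| <= C TT a almost
    everywhere on [a, c] gives TT a <= C (c - a) TT a, so TT a = 0 once C (c - a) < 1. *)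
Lemma ae_zero_of_interval_bound (R : realType) (b C : R) (p : R -> R) :
  0 < b -> 0 <= C -> L1_on `[0, b] p ->
  (forall x1 x2, 0 < x1 -> x1 < x2 -> x2 < b ->
    `|\int[leb R]_(x in `[x1, x2]) p x| <=
      C * (x2 - x1) * \int[leb R]_(x in `[x1, b]) `|p x|) ->
  {ae leb R, forall x, 0 <= x <= b -> p x = 0}.
Proof.
move=> b0 C0 pi pint; have := ae_le_of_interval_bound b0 C0 pi pint.
set T := fun x => _; set TT := fun x => \int[leb R]_(s in `[x, b]) `|p s|.
move=> pT.
have pni : L1_on `[0, b] (fun x => `|p x|) by exact: L1_on_norm.
have subi a c : 0 <= a -> c <= b -> L1_on `[a, c] (fun x => `|p x|).
  move=> a0 cb; apply: L1_onS pni => // z /=; rewrite !in_itv/= => /andP[az zc].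
  by rewrite (le_trans a0)//= (le_trans zc).
have Tge0 a : 0 <= TT a by exact: Rintegral_ge0.
have Tsplit a c : 0 <= a -> a <= c -> c <= b ->
    TT a = \int[leb R]_(s in `[a, c]) `|p s| + TT c.
  move=> a0 ac cb; have := @Rintegral_itvB R (fun s => `|p s|) (BLeft a) (BRight b) c (subi a b a0 (lexx _)).
  rewrite !bnd_simp => /(_ ac cb); rewrite Rintegral_itv_obnd_cbnd; last first.
    apply: L1_onS (subi c b (le_trans a0 ac) (lexx _)) => //.
    by move=> z /=; rewrite !in_itv/= => /andP[/ltW -> ->].
  by rewrite /TT => <-; rewrite addrC subrK.
have step a c : 0 < a -> a <= c -> c <= b -> C * (c - a) < 1 -> TT c = 0 -> TT a = 0.
  move=> a0 ac cb Cac Tc; have Ta := Tsplit a c (ltW a0) ac cb.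
  rewrite Tc addr0 in Ta.
  have : TT a <= C * TT a * (c - a).
    have -> : C * TT a * (c - a) = \int[leb R]_(s in `[a, c]) (C * TT a).
      rewrite Rintegral_cst//= lebesgue_measure_itv/= lte_fin; case: ltP => //.
      by move=> ca; rewrite (_ : c - a = 0) ?mulr0//; lra.
    rewrite {1}Ta /Rintegral; apply: fine_le.
    - by apply: integrable_fin_num => //; exact: subi (ltW a0) cb.
    - by rewrite integral_cst//= fin_numM//= lebesgue_measure_itv/=; case: ifP.
    apply: ae_ge0_le_integral => //.
    - apply/measurable_EFinP; exact: L1_on_measurable (subi a c (ltW a0) cb).
    - by move=> x _; rewrite lee_fin mulr_ge0.
    - move: (ae_neq b) pT; apply: filterS2; first exact: (ae_filter_ringOfSetsType (leb R)).
      move=> x xb px /=; rewrite in_itv/= lee_fin => /andP[ax xc].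
      have x0 : 0 < x := lt_le_trans a0 ax.
      have xb' : x < b by rewrite lt_neqAle xb (le_trans xc).
      apply: le_trans (px _) _; first by rewrite x0.
      apply: ler_wpM2l => //; rewrite -/(TT x) (Tsplit a x) ?(ltW a0) ?(ltW xb')//.
      by rewrite lerDr; exact: Rintegral_ge0.
  have := Tge0 a; rewrite le_eqVlt => /predU1P[<-//|Ta0].
  have : C * TT a * (c - a) = TT a * (C * (c - a)) by ring.
  by move=> ->; rewrite ler_pMr// leNgt Cac.
(* As C b < N, the length b / N is short enough for one step, and N steps down from b exhaust (0,
   b]. *)
pose N := (Num.truncn (C * b)).+1.
have N0 : 0 < N%:R :> R by rewrite ltr0n.
have NC : C * (b / N%:R) < 1.
  by rewrite mulrA ltr_pdivrMr// mul1r; have /andP[_] := truncn_itv (mulr_ge0 C0 (ltW b0)).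
have Tb : TT b = 0 by rewrite /TT set_itv1 Rintegral_set1.
have all_zero k a : 0 < a -> a <= b -> b - k%:R * (b / N%:R) <= a -> TT a = 0.
  elim: k a => [|k IH] a a0 ab.
    by rewrite mul0r subr0 => ba; have -> : a = b by apply/eqP; rewrite eq_le ab.
  move=> ka; have [h|h] := leP (a + b / N%:R) b; last first.
    apply: (step a b) => //; apply: le_lt_trans NC.
    by apply: ler_wpM2l => //; lra.
  have bN : 0 < b / N%:R by rewrite divr_gt0.
  apply: (step a (a + b / N%:R)) => //; first by rewrite lerDl ltW.
    by rewrite addrAC subrr add0r.
  apply: IH => //; first by rewrite addr_gt0.
  by move: ka; rewrite -natr1; lra.
have {}all_zero a : 0 < a -> a <= b -> TT a = 0.
  move=> a0 ab; apply: (all_zero N) => //.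
  by rewrite mulrC divfK ?gt_eqF// subrr ltW.
move: (@ae_neq R 0) (ae_neq b) pT; apply: filterS3; first exact: (ae_filter_ringOfSetsType (leb R)).
move=> x x0 xb px /andP[x0' xb']; apply/eqP; rewrite -normr_le0.
have xx : 0 < x < b by rewrite lt_def x0 x0' lt_neqAle xb xb'.
apply: le_trans (px xx) _; rewrite -/(TT x) all_zero ?mulr0//.
by case/andP: xx.
Qed.

(** The step differences are combinations of the given powers, so in the limit f integrates to 0
    over every subinterval: the interval bound holds with C = 0. *)
Lemma even_moments_ae_zero (R : realType) (b : R) (f : R -> R) : 0 < b ->
  L1_on `[0, b] f ->
  (forall n, \int[leb R]_(x in `[0, b]) (f x * x ^+ n.*2.+2) = 0) ->
  {ae leb R, forall x, 0 <= x <= b -> f x = 0}.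
Proof.
move=> b0 fi f0; apply: (@ae_zero_of_interval_bound _ _ 0) => // x1 x2 x10 x12 x2b.
rewrite !mul0r normr_le0; apply/eqP.
pose V (P : R -> R) := continuous P /\ \int[leb R]_(x in `[0, b]) (f x * P x) = 0.
have fP P : continuous P -> L1_on `[0, b] (fun x => f x * P x).
  by move=> cP; apply: L1_onM_continuous => //; exact: continuous_subspaceT.
have linV : lin_closed V.
  move=> c P Q [cP P0] [cQ Q0]; split.
    move=> x; apply: cvgD; first exact: cP.
    by apply: cvgM; [exact: cvg_cst|exact: cQ].
  transitivity (\int[leb R]_(x in `[0, b]) (f x * P x + c * (f x * Q x))).
    by apply: eq_Rintegral => x _; ring.
  rewrite RintegralD//; [|exact: fP|by apply: L1_onZ => //; exact: fP].
  by rewrite RintegralZl//; [rewrite P0 Q0 mulr0 addr0|exact: fP].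
have Vx n : V (fun x => x ^+ n.*2.+2) by split; [exact: exprn_continuous|exact: f0].
have := step_diff_integral_cvg x10 x12 x2b fi.
rewrite (_ : (fun m => _) = (fun=> 0)); last first.
  by apply/funext => m; have [] := step_poly_closed b x2 x1 m linV Vx.
move=> h; apply/esym; exact: (cvg_unique _ (cvg_cst 0) h).
Qed.

(** The orthogonality bound is applied with y = x1 to step differences tending to the indicator of
    [x1, x2]. With [eta] the L^1 distance to the indicator, m0 = eta and m1 = eta + (x2 - x1), and
    eta -> 0 leaves the interval bound with the tail from x1. *)
Lemma product_completeness (R : realType) (q1 q2 p : R -> R) (M : set R)
    (phi1 psi1 phi2 psi2 : R -> R -> R) :
  L1_on `[0, 1] q1 -> L1_on `[0, 1] q2 -> L1_on `[0, 1] p ->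
  (forall eps, 0 < eps -> exists mu, [/\ M mu, mu != 0 & `|mu| <= eps]) ->
  (forall mu, M mu -> sl_solution q1 mu (phi1 mu) (psi1 mu)) ->
  (forall mu, M mu -> sl_solution q2 mu (phi2 mu) (psi2 mu)) ->
  (forall mu, M mu -> \int[leb R]_(x in `[0, 1]) (p x * (phi1 mu x * phi2 mu x)) = 0) ->
  {ae leb R, forall x, 0 <= x <= 1 -> p x = 0}.
Proof.
move=> q1i q2i pi M0 sol1 sol2 orth.
have [C C0 bound] := orthogonality_bound q1i q2i pi sol1 sol2 orth.
apply: (@ae_zero_of_interval_bound _ _ C) => // x1 x2 x10 x12 x21.
set N := \int[leb R]_(x in `[0, 1]) `|p x| in bound.
set T := \int[leb R]_(x in `[x1, 1]) `|p x|.
have linV := unif_closure_lin (b := 1) (@gprim2_span_lin R M).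
have Vx := gprim2_closure_even_pow M0.
pose D m := step_diff 1 x1 x2 m.
pose ind : R -> R := \1_(`[x1, x2] : set R).
pose eta m := \int[leb R]_(x in `[0, 1]) `|D m x - ind x|.
have x01 : 0 <= x1 <= 1 by lra.
have iD x m : L1_on `[0, x] (D m).
  by apply: L1_on_continuous; apply: continuous_subspaceT; exact: continuous_step_diff.
have iind (a c : R) : L1_on `[a, c] ind.
  apply: (@L1_onS _ _ setT) => //; exact: (@integrable_indic_itv R x1 x2 true false).
have ieta x m : L1_on `[0, x] (fun z => D m z - ind z).
  apply: (@eq_L1_on _ _ (fun z => D m z + (-1) * ind z)) => //.
    by move=> z _; rewrite mulN1r.
  by apply: L1_onD => //; exact: L1_onZ.
have Dind m x : 0 <= x <= 1 ->
    `|\int[leb R]_(s in `[0, x]) D m s - \int[leb R]_(s in `[0, x]) ind s| <= eta m.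
  move=> /andP[x0 x1']; rewrite -RintegralB//; [|exact: iD|exact: iind].
  apply: le_trans (le_normr_Rintegral _ (ieta x m)) _ => //.
  have hh : L1_on `[0, 1] (fun z => `|D m z - ind z|) by exact: L1_on_norm.
  rewrite -subr_ge0 (@Rintegral_itvB R (fun z => `|D m z - ind z|) (BLeft 0) (BRight 1) x)//.
  exact: Rintegral_ge0.
have ind0 x : 0 <= x <= x1 -> \int[leb R]_(s in `[0, x]) ind s = 0.
  move=> /andP[x0 xx1]; rewrite -Rintegral_itv_bndo_bndc; last first.
    by apply: (L1_onS _ _ _ (iind 0 x)) => // z /=; rewrite !in_itv/= => /andP[-> /ltW].
  rewrite (@eq_Rintegral _ _ _ _ _ (fun=> 0)) ?Rintegral_cst ?mul0r// => z.
  rewrite inE/= in_itv/= => /andP[z0 zx].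
  by rewrite /ind indicE mem_setE in_itv/= leNgt (lt_le_trans zx xx1).
have ind1 x : 0 <= x <= 1 -> `|\int[leb R]_(s in `[0, x]) ind s| <= x2 - x1.
  move=> /andP[x0 x1'].
  have -> : x2 - x1 = \int[leb R]_(s in `[0, 1]) ind s.
    transitivity (\int[leb R]_(s in `[0, 1]) (1 * ind s)); last first.
      by apply: eq_Rintegral => z _; rewrite mul1r.
    rewrite Rintegral_mul_indic; [|exact: ltW|exact: ltW].
    by rewrite Rintegral_cst//= lebesgue_measure_itv/= lte_fin x12 mul1r.
  rewrite ger0_norm; last by apply: Rintegral_ge0 => z _; rewrite /ind indicE.
  have i01 := iind 0 1.
  rewrite -subr_ge0 (@Rintegral_itvB R ind (BLeft 0) (BRight 1) x)//.
  by apply: Rintegral_ge0 => z _; rewrite /ind indicE.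
have key m : `|\int[leb R]_(x in `[0, 1]) (p x * D m x)| <=
    C * (eta m * N + (eta m + (x2 - x1)) * T).
  apply: bound => //.
  - exact: step_poly_closed.
  - exact: continuous_step_diff.
  - move=> x /[dup] xx /andP[x0 xx1]; have xx01 : 0 <= x <= 1 by lra.
    by have := Dind m x xx01; rewrite ind0// subr0.
  - by move=> x xx; exact: ler_norm_subD (Dind m x xx) (ind1 x xx).
have cvL := cvg_norm (step_diff_integral_cvg x10 x12 x21 pi).
have cveta : eta m @[m --> \oo] --> (0 : R) by exact: step_diff_L1_cvg.
apply: (@ler_cvg_to _ _ _ _ _ _ _ _ (cvL _) _ (nearW _ key)).
rewrite (_ : C * (x2 - x1) * T = C * (0 * N + (0 + (x2 - x1)) * T)); last by ring.
apply: cvgM; first exact: cvg_cst.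
apply: cvgD; first by apply: cvgM => //; exact: cvg_cst.
apply: cvgM; last exact: cvg_cst.
by apply: cvgD => //; exact: cvg_cst.
Qed.

(** * Zeros of the transformed boundary datum *)

(** The Taylor remainder of exp (- mu t) after n terms, divided by mu^n: the counterpart of [gprim]
    for the Laplace kernel. *)
Fixpoint exp_remainder (R : realType) (n : nat) (mu t : R) : R :=
  match n with
  | 0%N => expR (- (mu * t))
  | n'.+1 => (exp_remainder n' mu t - (-1) ^+ n' * (t ^+ n' / n'`!%:R)) / mu
  end.

Lemma is_derive_exp_remainder (R : realType) (n : nat) (mu x : R) : mu != 0 ->
  is_derive x 1 (exp_remainder n.+1 mu) (-1 * exp_remainder n mu x).
Proof.
move=> mu0.
have dexp : is_derive x 1 (exp_remainder 0 mu) (- mu * expR (- mu * x)).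
  have := @is_derive_affine _ (- mu) 0 expR x _ (is_derive_expR _).
  by apply: eq_is_derive => [y|]; rewrite addr0// /= mulNr.
elim: n => [|n IH].
  have := is_derive_scale mu^-1 (is_derive_add dexp (is_derive_cst (- 1 : R) x 1)).
  apply: eq_is_derive => [y|] /=.
    by rewrite !expr0 fact0 divr1 mulr1 mulrC.
  by rewrite !mulNr; field.
have := is_derive_scale mu^-1 (is_derive_add IH
  (is_derive_scale (- (-1) ^+ n.+1) (is_derive_exp_coeff n x))).
apply: eq_is_derive => [y|]; first by rewrite [RHS]/= mulNr mulrC.
by rewrite [in RHS]/= exprS; ring.
Qed.

Lemma exp_remainder0 (R : realType) (n : nat) (mu : R) : exp_remainder n.+1 mu 0 = 0.
Proof.
elim: n => [|n IH]; first by rewrite /= mulr0 oppr0 expR0 !expr0 fact0 divr1 mulr1 subrr mul0r.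
have -> : exp_remainder n.+2 mu 0 =
  (exp_remainder n.+1 mu 0 - (-1) ^+ n.+1 * (0 ^+ n.+1 / n.+1`!%:R)) / mu by [].
by rewrite IH expr0n/= mul0r mulr0 subr0 mul0r.
Qed.

Lemma unif_closure_orthogonal (R : realType) (b : R) (g P : R -> R) :
  L1_on `[0, b] g -> continuous P ->
  unif_closure b (fun Q => continuous Q /\ \int[leb R]_(x in `[0, b]) (g x * Q x) = 0) P ->
  \int[leb R]_(x in `[0, b]) (g x * P x) = 0.
Proof.
move=> gi cP VP.
have gQ Q : continuous Q -> L1_on `[0, b] (fun x => g x * Q x).
  by move=> cQ; apply: L1_onM_continuous => //; exact: continuous_subspaceT.
have gn : L1_on `[0, b] (fun x => `|g x|) by exact: L1_on_norm.
pose N := \int[leb R]_(x in `[0, b]) `|g x|.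
have N0 : 0 <= N by exact: Rintegral_ge0.
apply/eqP; rewrite -normr_le0; apply/ler_addgt0Pr => e e0; rewrite add0r.
have N1 : 0 < N + 1 by rewrite ltr_pwDr.
have [Q [cQ Q0] PQ] := VP _ (divr_gt0 e0 N1).
have <- : \int[leb R]_(x in `[0, b]) (g x * P x) - \int[leb R]_(x in `[0, b]) (g x * Q x) =
    \int[leb R]_(x in `[0, b]) (g x * P x) by rewrite Q0 subr0.
rewrite -RintegralB//; [|exact: gQ|exact: gQ].
apply: (@le_trans _ _ (e / (N + 1) * N)); last first.
  rewrite -mulrA ger_pMr// mulrC ler_pdivrMr// mul1r lerDl//.
rewrite -RintegralZl//; apply: ler_norm_Rintegral => //; last 2 first.
- exact: L1_onZ.
- move=> x /=; rewrite in_itv/= => xb; rewrite -mulrBr normrM mulrC.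
  by apply: ler_wpM2r => //; exact: PQ.
apply: (@eq_L1_on _ _ (fun x => g x * P x + (-1) * (g x * Q x))) => //.
  by move=> x _; rewrite mulN1r.
by apply: L1_onD => //; [exact: gQ|apply: L1_onZ => //; exact: gQ].
Qed.

(** The exponentials orthogonal to g have parameters accumulating at 0, so each Taylor coefficient
    t^k / k! is a uniform limit of functions orthogonal to g and is orthogonal to it as well. *)
Lemma laplace_zeros_ae_zero (R : realType) (b : R) (g : R -> R) : 0 < b ->
  L1_on `[0, b] g ->
  (forall eps, 0 < eps -> exists mu, [/\
     \int[leb R]_(t in `[0, b]) (g t * expR (- (mu * t))) = 0,
     mu != 0 & `|mu| <= eps]) ->
  {ae leb R, forall t, 0 <= t <= b -> g t = 0}.
Proof.
move=> b0 gi M0; apply: even_moments_ae_zero => // n.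
pose M : set R := [set mu | \int[leb R]_(t in `[0, b]) (g t * expR (- (mu * t))) = 0].
pose V (Q : R -> R) := continuous Q /\ \int[leb R]_(x in `[0, b]) (g x * Q x) = 0.
have gQ Q : continuous Q -> L1_on `[0, b] (fun x => g x * Q x).
  by move=> cQ; apply: L1_onM_continuous => //; exact: continuous_subspaceT.
have linV : lin_closed V.
  move=> c P Q [cP P0] [cQ Q0]; split.
    move=> x; apply: cvgD; first exact: cP.
    by apply: cvgM; [exact: cvg_cst|exact: cQ].
  transitivity (\int[leb R]_(x in `[0, b]) (g x * P x + c * (g x * Q x))).
    by apply: eq_Rintegral => x _; ring.
  rewrite RintegralD//; [|exact: gQ|by apply: L1_onZ => //; exact: gQ].
  by rewrite RintegralZl//; [rewrite P0 Q0 mulr0 addr0|exact: gQ].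
pose e k (t : R) := (-1) ^+ k * (t ^+ k / k`!%:R).
have ce k : continuous (e k).
  move=> t; apply: cvgM; first exact: cvg_cst.
  by apply: cvgM; [exact: exprn_continuous|exact: cvg_cst].
have cE (mu : R) : continuous (fun t => expR (- (mu * t))).
  have -> : (fun t => expR (- (mu * t))) = (fun t => expR (- mu * t + 0)).
    by apply/funext => t; rewrite addr0 mulNr.
  apply: (@is_derive_continuous _ _ (fun t => - mu * expR (- mu * t + 0))) => t.
  exact: is_derive_affine.
have Ve k : unif_closure b V (e k).
  apply: (@taylor_coefficients_closure R b V M (@exp_remainder R) e linV M0).
  - by move=> j mu x _ mu0; rewrite /= mulrCA divff// mulr1 addrC subrK.
  - move=> j; exists (expR b * b ^+ j) => mu x _ mu0 mu1 xb.
    have c1 : `|-1 : R| <= 1 by rewrite normrN1.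
    apply: (primitive_chain_bound c1 (fun k y => is_derive_exp_remainder k y mu0)
      (fun k => exp_remainder0 k mu) _ j xb).
    move=> t /andP[t0 tb]; rewrite /= ger0_norm ?expR_ge0// ler_expR.
    apply: le_trans (ler_norm _) _; rewrite normrN normrM (ger0_norm t0).
    by apply: le_trans tb; rewrite -[leRHS]mul1r; apply: ler_wpM2r.
  - by move=> mu Mmu _; split; [exact: cE|exact: Mmu].
have := unif_closure_orthogonal gi (ce n.*2.+2) (Ve _).
rewrite /e (_ : (-1) ^+ n.*2.+2 = 1 :> R); last first.
  by rewrite -doubleS -signr_odd odd_double expr0.
set c := n.*2.+2; have f0 : c`!%:R != 0 :> R by rewrite pnatr_eq0 -lt0n fact_gt0.
move=> h; transitivity (\int[leb R]_(x in `[0, b]) (c`!%:R * (g x * (1 * (x ^+ c / c`!%:R))))).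
  by apply: eq_Rintegral => x _; field.
rewrite RintegralZl//; first by rewrite h mulr0.
apply: gQ => t; apply: cvgM; first exact: cvg_cst.
by apply: cvgM; [exact: exprn_continuous|exact: cvg_cst].
Qed.

(** If no eps worked, zeros of the transform would accumulate at [lambda0]. Absorbing exp (- lambda0
    t) into [g] moves this point to 0, and the vanishing of a beyond T reduces to a bounded
    interval, where the exponential expands uniformly. *)
Lemma boundary_datum_laplace_neq0 (R : realType) (a : R -> R) (lambda0 : R) :
  boundary_datum a ->
  exists2 eps : R, 0 < eps & forall mu, mu != 0 -> `|mu| <= eps ->
    \int[leb R]_(t in `[0, +oo[) (a t * expR (- ((lambda0 + mu) * t))) != 0.
Proof.
move=> [ai an0 [T T0 aT]]; apply: contrapT => H; apply: an0.
pose g t := a t * expR (- (lambda0 * t)).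
have sub : `[0, T] `<=` (`[0, +oo[ : set R).
  by move=> t /=; rewrite !in_itv/= => /andP[->].
have cE (mu : R) : continuous (fun t => expR (- (mu * t))).
  have -> : (fun t => expR (- (mu * t))) = (fun t => expR (- mu * t + 0)).
    by apply/funext => t; rewrite addr0 mulNr.
  apply: (@is_derive_continuous _ _ (fun t => - mu * expR (- mu * t + 0))) => t.
  exact: is_derive_affine.
have aiT : L1_on `[0, T] a by exact: L1_onS ai.
have gi : L1_on `[0, T] g.
  by apply: L1_onM_continuous => //; exact: continuous_subspaceT.
have gE mu : \int[leb R]_(t in `[0, +oo[) (a t * expR (- ((lambda0 + mu) * t))) =
    \int[leb R]_(t in `[0, T]) (g t * expR (- (mu * t))).
  transitivity (\int[leb R]_(t in `[0, T]) (a t * expR (- ((lambda0 + mu) * t)))); last first.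
    by apply: eq_Rintegral => t _; rewrite /g -mulrA -expRD; congr (_ * expR _); ring.
  have -> : `[0, T]%classic = `[0, +oo[ `&` `[0, T] :> set R.
    by apply/seteqP; split => [t h|t []//]; split => //; exact: sub.
  rewrite Rintegral_mkcondr /Rintegral; congr fine.
  apply: ae_eq_integral => //.
  - apply/measurable_EFinP; apply: measurable_funM; first exact: L1_on_measurable.
    apply: (@measurable_funS _ _ _ _ setT) => //.
    exact: continuous_measurable_fun.
  - apply/measurable_EFinP; apply/measurable_restrict => //.
    apply: measurable_funM.
      by apply: (measurable_funS _ _ (L1_on_measurable ai)) => //; exact: subIsetl.
    apply: (@measurable_funS _ _ _ _ setT) => //.
    exact: continuous_measurable_fun.
  - move: aT; apply: filterS; first exact: (ae_filter_ringOfSetsType (leb R)).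
    move=> t tT /=; rewrite in_itv/= andbT => t0; rewrite patchE mem_setE in_itv/= t0/=.
    by case: leP => // /tT ->; rewrite mul0r.
have : {ae leb R, forall t, 0 <= t <= T -> g t = 0}.
  apply: laplace_zeros_ae_zero => // eps eps0; apply: contrapT => nex; apply: H.
  exists eps => // mu mu0 mue; apply/negP => /eqP; rewrite gE => Z.
  by apply: nex; exists mu.
apply: filterS2 aT; first exact: (ae_filter_ringOfSetsType (leb R)).
move=> t aT gT t0; have [tT|/aT//] := leP t T.
move: gT; rewrite t0 tT => /(_ isT)/eqP.
by rewrite /g mulf_eq0 [expR _ == 0]gt_eqF ?expR_gt0// orbF => /eqP.
Qed.

(** * The transformed equation *)

Lemma has_laplace_continuous (R : realType) (u : R -> R -> R) (lambda : R) :
  has_laplace u lambda -> {within `[0, 1], continuous (fun x => laplace_v u x lambda)}.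
Proof.
move=> [hi hc]; apply/subspace_continuousP => x0 /=; rewrite in_itv/= => x01.
apply/cvgrPdist_le => e e0.
have /fine_cvgP[fin] := hc x0 x01.
move=> /cvgrPdist_le/(_ e e0) h.
near=> x.
have xI : 0 <= x <= 1.
  have : `[0, 1]%classic x by near: x; exact: withinT.
  by rewrite /= in_itv.
have ix := hi x xI; have ix0 := hi x0 x01.
rewrite /laplace_v distrC -RintegralB//.
have id : L1_on `[0, +oo[ (fun t => u x t * expR (- (lambda * t)) - u x0 t * expR (- (lambda * t))).
  apply: (@eq_L1_on _ _ (fun t => u x t * expR (- (lambda * t)) + (-1) * (u x0 t * expR (- (lambda * t))))) => //.
    by move=> t _; rewrite mulN1r.
  by apply: L1_onD => //; exact: L1_onZ.
apply: le_trans (le_normr_Rintegral _ id) _ => //.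
have : `|0 - \int[leb R]_(t in `[0, +oo[) `|u x t * expR (- (lambda * t)) - u x0 t * expR (- (lambda * t))| | <= e.
  by near: x.
by rewrite sub0r normrN; apply: le_trans; exact: ler_norm.
Unshelve. all: by end_near. Qed.

(** By the reverse triangle inequality the weighted L^1 norm is continuous in x, hence bounded on
    [0, 1]. This uniform bound is the input to Tonelli in [laplace_fubini]. *)
Lemma has_laplace_bounded (R : realType) (u : R -> R -> R) (lambda : R) :
  has_laplace u lambda -> exists2 M, 0 <= M & forall x, 0 <= x <= 1 ->
    \int[leb R]_(t in `[0, +oo[) `|u x t * expR (- (lambda * t))| <= M.
Proof.
move=> [hi hc].
suff c : {within `[0, 1], continuous (fun x => \int[leb R]_(t in `[0, +oo[) `|u x t * expR (- (lambda * t))|)}.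
  have [M M0 hM] := continuous_itv_bounded c; exists M => // x x01.
  by apply: le_trans (hM x x01); exact: ler_norm.
apply/subspace_continuousP => x0 /=; rewrite in_itv/= => x01.
apply/cvgrPdist_le => e e0.
have /fine_cvgP[fin] := hc x0 x01.
move=> /cvgrPdist_le/(_ e e0) h.
near=> x.
have xI : 0 <= x <= 1.
  have : `[0, 1]%classic x by near: x; exact: withinT.
  by rewrite /= in_itv.
have ix := L1_on_norm (measurable_itv _) (hi x xI).
have ix0 := L1_on_norm (measurable_itv _) (hi x0 x01).
rewrite distrC -RintegralB//.
have id : L1_on `[0, +oo[ (fun t => u x t * expR (- (lambda * t)) - u x0 t * expR (- (lambda * t))).
  apply: (@eq_L1_on _ _ (fun t => u x t * expR (- (lambda * t)) + (-1) * (u x0 t * expR (- (lambda * t))))) => //.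
    by move=> t _; rewrite mulN1r.
  by apply: L1_onD => //; [exact: hi|apply: L1_onZ => //; exact: hi].
have id' : L1_on `[0, +oo[ (fun t => `|u x t * expR (- (lambda * t))| - `|u x0 t * expR (- (lambda * t))|).
  apply: (@eq_L1_on _ _ (fun t => `|u x t * expR (- (lambda * t))| + (-1) * `|u x0 t * expR (- (lambda * t))|)) => //.
    by move=> t _; rewrite mulN1r.
  by apply: L1_onD => //; apply: L1_onZ.
apply: (@le_trans _ _ (\int[leb R]_(t in `[0, +oo[) `|u x t * expR (- (lambda * t)) - u x0 t * expR (- (lambda * t))|)).
  apply: ler_norm_Rintegral => //; first exact: L1_on_norm.
  by move=> t _; exact: ler_dist_dist.
have : `|0 - \int[leb R]_(t in `[0, +oo[) `|u x t * expR (- (lambda * t)) - u x0 t * expR (- (lambda * t))| | <= e.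
  by near: x.
by rewrite sub0r normrN; apply: le_trans; exact: ler_norm.
Unshelve. all: by end_near. Qed.

(** At each x the inner integral of the modulus is at most M |k x|, so the double integral
    converges. The integrability part also supplies the dominating function in the passage to the
    limit over time cutoffs. *)
Lemma laplace_fubini (R : realType) (u : R -> R -> R) (lambda : R) (k : R -> R) :
  measurable_fun (`[0, 1] `*` `[0, +oo[ : set (R * R)) (fun p : R * R => u p.1 p.2) ->
  has_laplace u lambda -> L1_on `[0, 1] k ->
  (leb R \x leb R)%E.-integrable (`[0, 1] `*` `[0, +oo[ : set (R * R))
    (fun p => (k p.1 * (u p.1 p.2 * expR (- (lambda * p.2))))%:E) /\
  (\int[(leb R \x leb R)%E]_(p in `[0, 1] `*` `[0, +oo[)
    (k p.1 * (u p.1 p.2 * expR (- (lambda * p.2)))) =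
  \int[leb R]_(x in `[0, 1]) (k x * laplace_v u x lambda))%R.
Proof.
move=> mu_ hl ki; have [M M0 hM] := has_laplace_bounded hl; have [hi _] := hl.
set D := (`[0, 1] `*` `[0, +oo[ : set (R * R)).
have mD : measurable D by exact: measurableX.
pose h (p : R * R) := k p.1 * (u p.1 p.2 * expR (- (lambda * p.2))).
pose K : R * R -> R := h \_ D.
have mexp : measurable_fun setT (fun p : R * R => expR (- (lambda * p.2))).
  apply: (measurableT_comp (@measurable_expR R)); apply: measurable_funN.
  by apply: measurable_funM => //; exact: measurable_snd.
have mh : measurable_fun D h.
  apply: measurable_funM.
    apply: (@eq_measurable_fun _ _ _ _ _ (fun p : R * R => (k \_ `[0, 1]) p.1)).
      move=> [x y]; rewrite inE => -[/= xI _].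
      by rewrite patchE mem_set.
    apply: (@measurable_funS _ _ _ _ setT) => //.
    apply: (measurableT_comp _ measurable_fst).
    have mI : measurable (`[0, 1]%classic : set R) by exact: measurable_itv.
    by apply/(measurable_restrictT _ mI); exact: (L1_on_measurable ki).
  apply: measurable_funM => //.
  exact: measurable_funS mexp.
have mK : measurable_fun setT K by apply/(measurable_restrictT _ mD).
have KxE x y : K (x, y) = if (0 <= x <= 1) && (0 <= y) then h (x, y) else 0.
  rewrite /K patchE; congr (if _ then _ else _).
  apply/idP/idP => [|/andP[xI yI]].
    by rewrite inE => -[/=]; rewrite !in_itv/= andbT => -> ->.
  by rewrite inE; split => /=; rewrite in_itv/= ?xI ?yI.
have ihx x : 0 <= x <= 1 -> L1_on `[0, +oo[ (fun y => h (x, y)).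
  by move=> xI; exact: (L1_onZ (k x) (measurable_itv _) (hi x xI)).
have KE x : (\int[leb R]_y (K (x, y))%:E = (((fun x => k x * laplace_v u x lambda)%R \_ `[0, 1]) x)%:E)%E.
  rewrite patchE mem_setE in_itv/=; case: ifPn => xI; last first.
    by apply: integral0_eq => y _; rewrite KxE (negbTE xI).
  rewrite /laplace_v -RintegralZl//; last exact: hi.
  rewrite /Rintegral fineK; last by apply: integrable_fin_num => //; exact: (ihx x xI).
  rewrite [RHS]integral_mkcond; apply: eq_integral => y _.
  by rewrite KxE xI/= patchE mem_setE in_itv/= andbT; case: ifP.
have KN x : (\int[leb R]_y `|(K (x, y))%:E| <= ((M * `|(k \_ `[0, 1]) x|)%R)%:E)%E.
  rewrite patchE mem_setE in_itv/=; case: ifPn => xI; last first.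
    rewrite integral0_eq ?lee_fin ?mulr_ge0// => y _.
    by rewrite KxE (negbTE xI)/= normr0.
  apply: (@le_trans _ _ (`|k x| * \int[leb R]_(y in `[0, +oo[) `|u x y * expR (- (lambda * y))|)%:E); last first.
    by rewrite lee_fin mulrC; apply: ler_wpM2r => //; exact: hM.
  rewrite -RintegralZl//; last by apply: L1_on_norm => //; exact: hi.
  rewrite /Rintegral fineK; last first.
    apply: integrable_fin_num => //; apply: L1_onZ => //.
    by apply: L1_on_norm => //; exact: hi.
  rewrite le_eqVlt; apply/orP; left; apply/eqP.
  rewrite [RHS]integral_mkcond; apply: eq_integral => y _.
  rewrite KxE xI/= patchE mem_setE in_itv/= andbT; case: ifP => _; last by rewrite normr0.
  by rewrite /h/= normrM.
have Ki : (leb R \x leb R)%E.-integrable setT (EFin \o K).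
  apply/(@integrable12ltyP _ _ _ _ _ (leb R) (leb R)).
    exact/measurable_EFinP.
  have kn : L1_on setT (fun x => M * `|(k \_ `[0, 1]) x|).
    apply: L1_onZ => //; apply: L1_on_norm => //.
    rewrite /L1_on -restrict_EFin.
    by apply/(@integrable_mkcond _ _ _ (leb R) _ (EFin \o k)) => //; exact: ki.
  apply: le_lt_trans (@integrable_lty _ _ _ (leb R) _ measurableT _ kn).
  apply: ge0_le_integral => //.
  - by move=> x _; exact: integral_ge0.
  - apply: (@measurable_fun_fubini_tonelli_F _ _ _ _ _ (leb R) (fun p => `|(K p)%:E|%E)) => //.
    by apply: measurableT_comp => //; exact/measurable_EFinP.
  - by apply/measurable_EFinP; exact: L1_on_measurable kn.
  - by move=> x _; exact: KN.
split.
  apply/(@integrable_mkcond _ _ _ (leb R \x leb R)%E _ (fun p => (h p)%:E)) => //.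
  by move: Ki; rewrite /K -restrict_EFin.
rewrite Rintegral_mkcond [RHS]Rintegral_mkcond /Rintegral; congr fine.
rewrite -[LHS](@integral12_prod_meas1 _ _ _ _ _ (leb R) (leb R) _ Ki).
by apply: eq_integral => x _; exact: KE.
Qed.

(** * Time cutoffs and the weak equation for the transform *)

Lemma is_derive_quadratic (R : realType) (f : R -> R) (x d K : R) :
  (forall h, `|f (h + x) - f x - d * h| <= K * h ^+ 2) -> is_derive x 1 f d.
Proof.
move=> fK.
have cv : h^-1 *: ((f \o shift x) (h *: 1) - f x) @[h --> 0^'] --> d.
  apply/cvgrPdist_le => e e0; near=> h.
  have h0 : h != 0 by near: h; exact: nbhs_dnbhs_neq.
  have K0 : 0 < `|K| + 1 by rewrite ltr_pwDr.
  have he : `|h| <= e / (`|K| + 1) by near: h; apply: dnbhs0_le; exact: divr_gt0.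
  rewrite /= /GRing.scale/= mulr1.
  have -> : d - h^-1 * (f (h + x) - f x) = - (h^-1 * (f (h + x) - f x - d * h)).
    by field.
  rewrite normrN normrM normfV mulrC ler_pdivrMr ?normr_gt0//.
  apply: le_trans (fK h) _; move: he; rewrite ler_pdivlMr// => he.
  rewrite -real_normK ?num_real// expr2 mulrA; apply: ler_wpM2r => //.
  have := ler_norm K; have := normr_ge0 h => h1 h2.
  by apply: le_trans he; rewrite mulrC; apply: ler_wpM2l => //; lra.
split; first by apply/cvg_ex; exists d.
exact/cvg_lim.
Unshelve. all: by end_near. Qed.

(** A quadratic bound on the remainder treats the junction at 0 like any other point, leaving
    polynomial inequalities in the sign cases. *)
Lemma is_derive_pos_sqr (R : realType) (x : R) :
  is_derive x 1 (fun y : R => Num.max 0 y ^+ 2) (2 * Num.max 0 x).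
Proof.
apply: (@is_derive_quadratic _ _ _ _ 1) => h; rewrite mul1r ler_norml.
by case: (leP 0 x) => x0; case: (leP 0 (h + x)) => hx; apply/andP; split; nra.
Qed.

Lemma pos_mul (R : realType) (x : R) : x * Num.max 0 x = Num.max 0 x ^+ 2.
Proof. by case: (leP 0 x) => x0; rewrite ?mulr0 ?expr0n. Qed.

Lemma is_derive_pos_cube (R : realType) (x : R) :
  is_derive x 1 (fun y : R => Num.max 0 y ^+ 3) (3 * Num.max 0 x ^+ 2).
Proof.
have := is_derive_mul (is_derive_id x (1 : R)) (is_derive_pos_sqr x).
apply: eq_is_derive => [y|]; first by rewrite /= expr2 mulrA pos_mul -exprSr.
by rewrite /= [x * _]mulrCA pos_mul; ring.
Qed.

Lemma continuous_pos (R : realType) : continuous (fun y : R => Num.max 0 y).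
Proof. by move=> x; apply: continuous_max; [exact: cst_continuous|exact: cvg_id]. Qed.

Lemma is_C1 (R : realType) (f f' : R -> R) :
  (forall x : R, is_derive x 1 f (f' x)) -> continuous f' ->
  is_Cn 1 f /\ derive1 f = f'.
Proof.
move=> df cf; have e : derive1 f = f'.
  by apply/funext => x; rewrite derive1E; have [_ ->] := df x.
split => //; split; last by rewrite /= e.
by case=> // _ x /=; have [] := df x.
Qed.

Lemma is_C2 (R : realType) (f f' f'' : R -> R) :
  (forall x : R, is_derive x 1 f (f' x)) -> (forall x : R, is_derive x 1 f' (f'' x)) ->
  continuous f'' -> is_Cn 2 f /\ derive1n 2 f = f''.
Proof.
move=> df df' cf; have e : derive1 f = f'.
  by apply/funext => x; rewrite derive1E; have [_ ->] := df x.
have e' : derive1n 2 f = f''.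
  by apply/funext => x; rewrite /= e derive1E; have [_ ->] := df' x.
split => //; split; last by rewrite e'.
case=> [|[|//]] _ x; first by have [] := df x.
by rewrite /= e; have [] := df' x.
Qed.

(* Equal to (1 - t / (n + 1))^2 up to t = n + 1: a C^1 time cutoff with derivative O(1/n). *)
Definition cutoff (R : realType) (n : nat) (t : R) : R :=
  Num.max 0 (- n.+1%:R^-1 * t + 1) ^+ 2.

Definition cutoff' (R : realType) (n : nat) (t : R) : R :=
  - n.+1%:R^-1 * (2 * Num.max 0 (- n.+1%:R^-1 * t + 1)).

Lemma is_derive_cutoff (R : realType) n (t : R) : is_derive t 1 (cutoff n) (cutoff' n t).
Proof. exact: (is_derive_affine (is_derive_pos_sqr _)). Qed.

Lemma continuous_cutoff (R : realType) n : continuous (@cutoff R n).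
Proof. exact: is_derive_continuous (is_derive_cutoff n). Qed.

Lemma continuous_cutoff' (R : realType) n : continuous (@cutoff' R n).
Proof.
move=> t; apply: cvgM; first exact: cvg_cst.
apply: cvgM; first exact: cvg_cst.
have c1 : {for t, continuous (fun t : R => - n.+1%:R^-1 * t + 1)}.
  apply: cvgD; last exact: cvg_cst.
  by apply: cvgM; [exact: cvg_cst|exact: cvg_id].
exact: (continuous_comp c1 (@continuous_pos R _)).
Qed.

Lemma cutoff_base (R : realType) n (t : R) : 0 <= t ->
  0 <= Num.max 0 (- n.+1%:R^-1 * t + 1) <= 1.
Proof.
move=> t0; rewrite le_max lexx/= ge_max ler01/=.
by rewrite gerDr mulNr oppr_le0 mulr_ge0.
Qed.

Lemma cutoff_bound (R : realType) n (t : R) : 0 <= t -> 0 <= cutoff n t <= 1.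
Proof.
move=> /(cutoff_base n)/andP[c0 c1]; rewrite /cutoff exprn_ge0//=.
exact: exprn_ile1.
Qed.

Lemma cutoff'_bound (R : realType) n (t : R) : 0 <= t ->
  `|cutoff' n t| <= 2 / n.+1%:R.
Proof.
move=> /(cutoff_base n)/andP[c0 c1]; rewrite /cutoff' mulNr normrN normrM mulrC.
rewrite (ger0_norm (_ : 0 <= n.+1%:R^-1)) ?invr_ge0//.
apply: ler_wpM2r; first by rewrite invr_ge0.
by rewrite ger0_norm ?mulr_ge0//; lra.
Qed.

Lemma cutoff_cvg (R : realType) (t : R) : 0 <= t ->
  cutoff n t @[n --> \oo] --> (1 : R).
Proof.
move=> t0.
have cv : - (n.+1%:R^-1 : R) * t + 1 @[n --> \oo] --> (1 : R).
  rewrite -[X in _ --> X]add0r; apply: cvgD; last exact: cvg_cst.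
  rewrite -[X in _ --> X](mul0r t); apply: cvgM; last exact: cvg_cst.
  by rewrite -oppr0; apply: cvgN; exact: cvg_harmonic.
have := cvg_comp _ _ cv (@is_derive_continuous _ _ _ (@is_derive_pos_sqr R) (1 : R)).
by rewrite (_ : Num.max 0 1 ^+ 2 = 1 :> R)// (max_idPr _) ?expr1n.
Qed.

Lemma cutoff'_cvg (R : realType) (t : R) : 0 <= t ->
  cutoff' n t @[n --> \oo] --> (0 : R).
Proof.
move=> t0; apply/norm_cvg0P.
apply: (@squeeze_cvgr _ _ _ _ (fun=> 0) (fun n => 2 * (n.+1%:R)^-1)).
- by apply: nearW => n; rewrite normr_ge0/= cutoff'_bound.
- exact: cvg_cst.
- rewrite -[X in _ --> X](mulr0 2); apply: cvgM; first exact: cvg_cst.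
  exact: cvg_harmonic.
Qed.

(** The bare exponential is no test function; the cutoff makes it vanish from t = n + 1 on while
    keeping the value 1 at t = 0. *)
Lemma exp_cutoff_time_test (R : realType) (lambda : R) n :
  time_test (fun t => expR (- (lambda * t)) * cutoff n t) /\
  derive1 (fun t => expR (- (lambda * t)) * cutoff n t) =
    (fun t => expR (- (lambda * t)) * (- (lambda * cutoff n t) + cutoff' n t)).
Proof.
have dE (t : R) : is_derive t 1 (fun t => expR (- (lambda * t))) (- lambda * expR (- (lambda * t))).
  have := @is_derive_affine _ (- lambda) 0 expR t _ (is_derive_expR _).
  by apply: eq_is_derive => [y|]; rewrite addr0 ?[- lambda * t]mulNr// mulNr.
have cE := is_derive_continuous dE.
have [] := @is_C1 R (fun t => expR (- (lambda * t)) * cutoff n t)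
  (fun t => expR (- (lambda * t)) * (- (lambda * cutoff n t) + cutoff' n t)).
- move=> t; have := is_derive_mul (dE t) (is_derive_cutoff n t).
  by apply: eq_is_derive => //; ring.
- move=> t; apply: cvgM; first exact: cE.
  apply: cvgD; last exact: continuous_cutoff'.
  by apply: cvgN; apply: cvgM; [exact: cvg_cst|exact: continuous_cutoff].
move=> C1 ->; split => //; split => //; exists n.+1%:R => t tn.
rewrite /cutoff (max_idPl _) ?expr0n ?mulr0//.
have n0 : 0 < n.+1%:R :> R by rewrite ltr0n.
by rewrite mulNr addrC subr_le0 mulrC ler_pdivlMr// mul1r.
Qed.

(** Test with phi(x) exp (- lambda t) cutoff n t and let n -> oo. The time factor is 1 at t = 0, so
    the zero initial condition is used here: it is why no boundary term survives. The derivative of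
    the cutoff tends to 0 boundedly. *)
Lemma laplace_weak_equation (R : realType) (q a phi : R -> R) (u : R -> R -> R) (lambda : R) :
  L1_on `[0, 1] q -> solves_ibvp q a u -> has_laplace u lambda -> space_test phi ->
  \int[leb R]_(x in `[0, 1])
    (((lambda + q x) * phi x - derive1n 2 phi x) * laplace_v u x lambda) = 0.
Proof.
move=> qi [mu_ _ _ _ weak] hl st; have [[dphi cphi2] _] := st.
have cphi : continuous phi.
  move=> x; apply: differentiable_continuous; apply/derivable1_diffP.
  exact: (dphi 0%N isT x).
set phi2 := derive1n 2 phi in cphi2 *.
have phii : L1_on `[0, 1] phi by apply: L1_on_continuous; exact: continuous_subspaceT.
have phi2i : L1_on `[0, 1] phi2 by apply: L1_on_continuous; exact: continuous_subspaceT.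
pose w x := q x * phi x - phi2 x.
have wi : L1_on `[0, 1] w.
  apply: (@eq_L1_on _ _ (fun x => q x * phi x + (-1) * phi2 x)) => //.
    by move=> x _; rewrite mulN1r.
  apply: L1_onD => //; last exact: L1_onZ.
  by apply: L1_onM_continuous => //; exact: continuous_subspaceT.
pose k x := lambda * phi x + w x.
have ki : L1_on `[0, 1] k by apply: L1_onD => //; exact: L1_onZ.
(* Weight of the dominating function: for t >= 0 the cutoff is at most 1 and its derivative at most
   2 in modulus, for every n. *)
pose kk x := (`|lambda| + 2) * `|phi x| + `|w x|.
have kki : L1_on `[0, 1] kk.
  apply: L1_onD => //; last exact: L1_on_norm.
  by apply: L1_onZ => //; exact: L1_on_norm.
have [i1 e1] := laplace_fubini mu_ hl ki.
have [i2 _] := laplace_fubini mu_ hl kki.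
have [i3 _] := laplace_fubini mu_ hl phii.
have [i4 _] := laplace_fubini mu_ hl wi.
transitivity (\int[leb R]_(x in `[0, 1]) (k x * laplace_v u x lambda)).
  by apply: eq_Rintegral => x _; rewrite /k /w; ring.
rewrite -e1.
set D := (`[0, 1] `*` `[0, +oo[ : set (R * R)) in i1 i2 i3 i4 weak *.
have mD : measurable D by exact: measurableX.
pose h (p : R * R) := u p.1 p.2 * expR (- (lambda * p.2)).
pose f n (p : R * R) := phi p.1 * h p * (lambda * cutoff n p.2 - cutoff' n p.2) +
  w p.1 * h p * cutoff n p.2.
have f0 n : (\int[(leb R \x leb R)%E]_(p in D) f n p = 0)%R.
  have [tt dt] := exp_cutoff_time_test lambda n.
  rewrite -[RHS](weak phi _ st tt); apply: eq_Rintegral => p _.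
  rewrite dt /f /h /w -/phi2.
  move: (phi p.1) (q p.1) (phi2 p.1) (u p.1 p.2) (expR _) (cutoff n _) (cutoff' n _).
  by move=> *; ring.
have mcut (c : R -> R) : continuous c -> measurable_fun D (fun p : R * R => c p.2).
  move=> cc; apply: (@measurable_funS _ _ _ _ setT) => //.
  by apply: (measurableT_comp _ measurable_snd); exact: continuous_measurable_fun.
have mphi : measurable_fun D (fun p => phi p.1 * h p).
  by move/(measurable_int (leb R \x leb R)%E)/measurable_EFinP : i3.
have mw : measurable_fun D (fun p => w p.1 * h p).
  by move/(measurable_int (leb R \x leb R)%E)/measurable_EFinP : i4.
have mf n : measurable_fun D (f n).
  apply: measurable_funD.
    apply: measurable_funM => //.
    apply: (mcut (fun t => lambda * cutoff n t - cutoff' n t)) => t.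
    apply: cvgB; last exact: continuous_cutoff'.
    by apply: cvgM; [exact: cvg_cst|exact: continuous_cutoff].
  apply: measurable_funM => //.
  by apply: mcut; exact: continuous_cutoff.
have mk : measurable_fun D (fun p => k p.1 * h p).
  by move/(measurable_int (leb R \x leb R)%E)/measurable_EFinP : i1.
have fb n p : D p -> `|f n p| <= `|kk p.1 * h p|.
  move=> [_ /=]; rewrite in_itv/= andbT => t0.
  have /andP[c0 c1] := cutoff_bound n t0; have c2 := cutoff'_bound n t0.
  have c3 : `|cutoff' n p.2| <= 2.
    apply: le_trans c2 _; rewrite ler_pdivrMr ?ltr0n//.
    by rewrite ler_peMr// ler1n.
  have c4 : `|lambda * cutoff n p.2 - cutoff' n p.2| <= `|lambda| + 2.
    apply: le_trans (ler_normB _ _) _; apply: lerD => //.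
    by rewrite normrM (ger0_norm c0) -[leRHS]mulr1; apply: ler_wpM2l.
  apply: le_trans (ler_normD _ _) _.
  rewrite (normrM (phi p.1 * h p)) (normrM (w p.1 * h p)) (ger0_norm c0).
  rewrite (normrM (phi p.1)) (normrM (w p.1)) (normrM (kk p.1)).
  rewrite (ger0_norm (_ : 0 <= kk p.1)); last by rewrite addr_ge0// mulr_ge0// addr_ge0.
  rewrite mulrDl; apply: lerD.
    by rewrite mulrC mulrA; apply: ler_wpM2r => //; apply: ler_wpM2r.
  by rewrite -[leRHS]mulr1; apply: ler_wpM2l => //; rewrite mulr_ge0.
have f0E n : (\int[(leb R \x leb R)%E]_(p in D) (f n p)%:E = 0)%E.
  rewrite -[LHS]fineK; first by rewrite -/(Rintegral _ _ _) f0.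
  apply: integrable_fin_num => //.
  apply: (@le_integrable _ _ _ (leb R \x leb R)%E D mD _ (fun p => (kk p.1 * h p)%:E) _ _ i2).
    by move/measurable_EFinP: (mf n); exact.
  by move=> p Dp; rewrite lee_fin; exact: fb.
have [||||| _ _ cv] := @dominated_convergence _ _ _ (leb R \x leb R)%E D mD
  (fun n p => (f n p)%:E) (fun p => (k p.1 * h p)%:E)
  (fun p => `|(kk p.1 * h p)%:E|%E).
- by move=> n; move/measurable_EFinP: (mf n); exact.
- by move/measurable_EFinP: mk; exact.
- apply: aeW => p [_ /=]; rewrite in_itv/= andbT => t0.
  apply: cvg_EFin; first exact: nearW.
  rewrite (_ : k p.1 * h p = phi p.1 * h p * (lambda * 1 - 0) + w p.1 * h p * 1); last first.
    by rewrite /k; ring.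
  have c1 := cutoff_cvg t0; have c2 := cutoff'_cvg t0.
  apply: cvgD; apply: cvgM; [exact: cvg_cst| |exact: cvg_cst|exact: c1].
  by apply: cvgB; [apply: cvgM; [exact: cvg_cst|exact: c1]|exact: c2].
- exact: integrable_abse.
- by apply: aeW => p n Dp; rewrite lee_fin; exact: fb.
rewrite /Rintegral (_ : (\int[(leb R \x leb R)%E]_(p in D) _)%E = 0%E)//.
have {}cv : ((fun _ : nat => 0%E) : nat -> \bar R) n @[n --> \oo] -->
    (\int[leb R \x leb R]_(p in D) (k p.1 * h p)%:E)%E.
  by apply: cvg_trans cv; apply: near_eq_cvg; apply: nearW => n; exact: f0E.
have c0 : ((fun _ : nat => 0%E) : nat -> \bar R) n @[n --> \oo] --> 0%E by exact: cvg_cst.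
have := cvg_lim (@ereal_hausdorff R) cv; have := cvg_lim (@ereal_hausdorff R) c0.
by move=> -> /(_ _)/esym.
Qed.

(** * Space test functions and regularity of the transform in x *)

Definition ramp (R : realType) (e y : R) : R :=
  (6 * e ^+ 2)^-1 * (Num.max 0 (y + e) ^+ 3 - 2 * Num.max 0 y ^+ 3 + Num.max 0 (y - e) ^+ 3).

Definition smooth_step (R : realType) (e y : R) : R :=
  (2 * e ^+ 2)^-1 * (Num.max 0 (y + e) ^+ 2 - 2 * Num.max 0 y ^+ 2 + Num.max 0 (y - e) ^+ 2).

(** For e > 0, the triangle of unit mass on [- e, e], as a second difference of the positive part
    y_+. [smooth_step] and [ramp] are the same second difference of y_+^2 / 2 and y_+^3 / 6, so
    [ramp] is C^2 and agrees with y_+ exactly outside [- e, e]. *)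
Definition hat (R : realType) (e y : R) : R :=
  (e ^+ 2)^-1 * (Num.max 0 (y + e) - 2 * Num.max 0 y + Num.max 0 (y - e)).

Lemma is_derive_second_difference (R : realType) (f f' : R -> R) (e y : R) :
  (forall x : R, is_derive x 1 f (f' x)) ->
  is_derive y 1 (fun y => f (y + e) - 2 * f y + f (y - e)) (f' (y + e) - 2 * f' y + f' (y - e)).
Proof.
move=> df.
have d1 c : is_derive y 1 (fun y => f (y + c)) (f' (y + c)).
  have := @is_derive_affine _ 1 c f y _ (df _).
  by apply: eq_is_derive => [x|]; rewrite !mul1r.
have := is_derive_add (is_derive_add (d1 e) (is_derive_scale (-2) (df y))) (d1 (- e)).
by apply: eq_is_derive => [x|]; rewrite mulNr.
Qed.

Lemma is_derive_ramp (R : realType) (e y : R) : is_derive y 1 (ramp e) (smooth_step e y).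
Proof.
have := is_derive_scale (6 * e ^+ 2)^-1 (is_derive_second_difference e y (@is_derive_pos_cube R)).
apply: eq_is_derive => //; rewrite /smooth_step.
rewrite !invfM; have -> : (2 : R)^-1 = 6^-1 * 3 by field.
by ring.
Qed.

Lemma is_derive_smooth_step (R : realType) (e y : R) : is_derive y 1 (smooth_step e) (hat e y).
Proof.
have := is_derive_scale (2 * e ^+ 2)^-1 (is_derive_second_difference e y (@is_derive_pos_sqr R)).
apply: eq_is_derive => //; rewrite /hat invfM.
by move: (e ^- 2) (Num.max _ _) (Num.max _ _) (Num.max _ _) => E a b c; field.
Qed.

Lemma continuous_hat (R : realType) (e : R) : continuous (hat e).
Proof.
have cs c : continuous (fun y : R => Num.max 0 (y + c)).
  move=> y; apply: (@continuous_comp _ _ _ (fun y : R => y + c) (fun y => Num.max 0 y)).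
    by apply: cvgD; [exact: cvg_id|exact: cvg_cst].
  exact: continuous_pos.
move=> y; apply: cvgM; first exact: cvg_cst.
apply: cvgD; last exact: cs.
apply: cvgB; first exact: cs.
by apply: cvgM; [exact: cvg_cst|exact: continuous_pos].
Qed.

Lemma hat_ge0 (R : realType) (e y : R) : 0 <= hat e y.
Proof.
rewrite /hat mulr_ge0 ?invr_ge0 ?sqr_ge0//.
by case: (leP 0 (y + e)); case: (leP 0 y); case: (leP 0 (y - e)); lra.
Qed.

Lemma hat_eq0 (R : realType) (e y : R) : 0 <= e -> e <= `|y| -> hat e y = 0.
Proof.
move=> e0; rewrite /hat ler_normr => /orP[ye|ye];
  by case: (leP 0 (y + e)); case: (leP 0 y); case: (leP 0 (y - e)) => h1 h2 h3; first
    [ring | exfalso; lra | (have -> : y = - e by lra); ring | (have -> : y = e by lra); ring].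
Qed.

Lemma smooth_step_left (R : realType) (e y : R) : 0 <= e -> y <= - e -> smooth_step e y = 0.
Proof.
by move=> e0 ye; rewrite /smooth_step !(max_idPl _) ?expr0n/= ?mulr0 ?subr0 ?addr0 ?mulr0//; lra.
Qed.

Lemma smooth_step_right (R : realType) (e y : R) : 0 < e -> e <= y -> smooth_step e y = 1.
Proof.
move=> e0 ye; rewrite /smooth_step !(max_idPr _); try lra.
by field; rewrite gt_eqF.
Qed.

Lemma ramp_left (R : realType) (e y : R) : 0 <= e -> y <= - e -> ramp e y = 0.
Proof.
by move=> e0 ye; rewrite /ramp !(max_idPl _) ?expr0n/= ?mulr0 ?subr0 ?addr0 ?mulr0//; lra.
Qed.

Lemma ramp_right (R : realType) (e y : R) : 0 < e -> e <= y -> ramp e y = y.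
Proof.
move=> e0 ye; rewrite /ramp !(max_idPr _); try lra.
by field; rewrite gt_eqF.
Qed.

(** The reference value [z0] is not tied to z c: near the ends of [0, 1] the hat must be centred
    inside, while its mean is compared with z 0 or z 1. *)
Lemma hat_mean (R : realType) (z : R -> R) (c e z0 d : R) : 0 < e -> e <= c <= 1 - e ->
  {within `[0, 1], continuous z} ->
  (forall y, 0 <= y <= 1 -> `|y - c| <= e -> `|z y - z0| <= d) ->
  `|\int[leb R]_(y in `[0, 1]) (z y * hat e (y - c)) - z0| <= d.
Proof.
move=> e0 cE cz zd.
have dS (y : R) : is_derive y 1 (fun y => smooth_step e (y - c)) (hat e (y - c)).
  have := @is_derive_affine _ 1 (- c) _ y _ (is_derive_smooth_step e _).
  by apply: eq_is_derive => [x|]; rewrite !mul1r.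
have ch : continuous (fun y => hat e (y - c)).
  move=> y; apply: (@continuous_comp _ _ _ (fun y : R => y - c) (hat e)).
    by apply: cvgB; [exact: cvg_id|exact: cvg_cst].
  exact: continuous_hat.
have [hi h1] := is_derive_ac_on 1 dS ch.
have {}h1 : \int[leb R]_(y in `[0, 1]) hat e (y - c) = 1.
  move: (h1 1); rewrite ler01 lexx => /(_ isT).
  rewrite smooth_step_right//; last lra.
  rewrite smooth_step_left ?add0r//; lra.
have zi : L1_on `[0, 1] (fun y => z y * hat e (y - c)).
  apply: (@eq_L1_on _ _ (fun y => hat e (y - c) * z y)) => //.
    by move=> y _; rewrite mulrC.
  exact: L1_onM_continuous.
have -> : \int[leb R]_(y in `[0, 1]) (z y * hat e (y - c)) - z0 =
    \int[leb R]_(y in `[0, 1]) ((z y - z0) * hat e (y - c)).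
  transitivity (\int[leb R]_(y in `[0, 1]) (z y * hat e (y - c) + - z0 * hat e (y - c))).
    rewrite RintegralD//; last exact: L1_onZ.
    by rewrite RintegralZl// h1 mulr1.
  by apply: eq_Rintegral => y _; ring.
have -> : d = \int[leb R]_(y in `[0, 1]) (d * hat e (y - c)).
  by rewrite RintegralZl// h1 mulr1.
apply: ler_norm_Rintegral => //.
- apply: (@eq_L1_on _ _ (fun y => z y * hat e (y - c) + - z0 * hat e (y - c))) => //.
    by move=> y _; ring.
  by apply: L1_onD => //; exact: L1_onZ.
- exact: L1_onZ.
- move=> y; rewrite /= in_itv/= => y01; rewrite normrM (ger0_norm (hat_ge0 _ _)).
  have [ye|ye] := leP `|y - c| e; first by apply: ler_wpM2r; [exact: hat_ge0|exact: zd].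
  by rewrite hat_eq0 ?mulr0// ltW.
Qed.

Lemma within_continuous_dist (R : realType) (z : R -> R) (x d : R) :
  {within `[0, 1], continuous z} -> 0 <= x <= 1 -> 0 < d ->
  exists2 r, 0 < r & forall y, 0 <= y <= 1 -> `|y - x| <= r -> `|z y - z x| <= d.
Proof.
move=> /subspace_continuousP cz x01 d0.
have /cvgrPdist_le/(_ _ d0) : z y @[y --> within `[0, 1] (nbhs x)] --> z x.
  by apply: cz; rewrite /= in_itv/=.
move=> -[r /= r0 H]; exists (r / 2); first exact: divr_gt0.
move=> y y01 yx; rewrite distrC; apply: H; last by rewrite /= in_itv/=.
rewrite /= distrC; apply: le_lt_trans yx _.
by rewrite ltr_pdivrMr// mulr_natr mulr2n ltrDl.
Qed.

(* The second derivative of the test function is a combination of three hats,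
   near 0, at x and near 1, whose weights are those of the affine interpolation. *)
Lemma weakly_affine (R : realType) (z : R -> R) (x : R) :
  {within `[0, 1], continuous z} ->
  (forall phi, space_test phi -> \int[leb R]_(y in `[0, 1]) (z y * derive1n 2 phi y) = 0) ->
  0 <= x <= 1 -> z x = (1 - x) * z 0 + x * z 1.
Proof.
move=> cz weak x01.
have [->|x0] := eqVneq x 0; first by ring.
have [->|x1] := eqVneq x 1; first by ring.
have {x0 x1 x01}[x0 x1] : 0 < x /\ x < 1 by move: x01 => /andP[]; rewrite !le_eqVlt
  [0 == x]eq_sym (negbTE x0) (negbTE x1)/=.
apply/eqP; rewrite -subr_eq0 -normr_le0; apply/ler_addgt0Pr => d d0; rewrite add0r.
(* The final error is a convex combination of the two errors at the ends plus the error at x, each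
   at most d / 2. *)
have d20 : 0 < d / 2 by apply: divr_gt0.
have [r0 r00 zr0] := @within_continuous_dist _ _ 0 _ cz ltac:(lra) d20.
have [r1 r10 zr1] := @within_continuous_dist _ _ 1 _ cz ltac:(lra) d20.
have [rx rx0 zrx] := @within_continuous_dist _ _ x _ cz ltac:(lra) d20.
pose r := Num.min 1 (Num.min r0 (Num.min r1 rx)).
have r_gt0 : 0 < r by rewrite !lt_min ltr01 r00 r10 rx0.
have [rle1 rle2 rle3 rle4] : [/\ r <= 1, r <= r0, r <= r1 & r <= rx].
  by split; rewrite !ge_min lexx ?orbT.
(* The centres a = eta x and b = 1 - eta (1 - x) satisfy (1 - x) a + x b = x, so the three ramps
   cancel beyond b + e. With 2 e <= a and 2 e <= 1 - b the support of [ph] stays inside (0, 1). *)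
pose eta := r / 2; pose e := eta * (x * (1 - x)) / 2.
pose a := eta * x; pose b := 1 - eta * (1 - x).
have eta0 : 0 < eta by apply: divr_gt0.
have etar : eta = r / 2 by [].
have x1x : 0 < x * (1 - x) by rewrite mulr_gt0// subr_gt0.
have e0 : 0 < e by rewrite divr_gt0// mulr_gt0.
have e2 : 2 * e = a * (1 - x) by rewrite /e /a; field.
have e3 : 2 * e = (1 - b) * x by rewrite /e /b; field.
have a0 : 0 < a by rewrite mulr_gt0.
have b1 : 0 < 1 - b by rewrite /b opprB addrC subrK mulr_gt0// subr_gt0.
have ea : 2 * e <= a by rewrite e2; nra.
have eb : 2 * e <= 1 - b by rewrite e3; nra.
have ax : a <= x by rewrite /a; nra.
have aeta : a <= eta by rewrite /a; nra.
have bx : x <= b by rewrite /b; nra.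
have beta : 1 - b <= eta by rewrite /b; nra.
pose ph : R -> R := fun y : R => (1 - x) * ramp e (y - a) + x * ramp e (y - b) - ramp e (y - x).
pose ph' : R -> R := fun y : R => (1 - x) * smooth_step e (y - a) + x * smooth_step e (y - b) - smooth_step e (y - x).
pose ph'' : R -> R := fun y : R => (1 - x) * hat e (y - a) + x * hat e (y - b) - hat e (y - x).
have dC (f f' : R -> R) (y : R) : (forall w : R, is_derive w 1 f (f' w)) ->
    is_derive y 1 (fun y => (1 - x) * f (y - a) + x * f (y - b) - f (y - x))
      ((1 - x) * f' (y - a) + x * f' (y - b) - f' (y - x)).
  move=> df.
  have d1 c : is_derive y 1 (fun y => f (y - c)) (f' (y - c)).
    have := @is_derive_affine _ 1 (- c) f y _ (df _).
    by apply: eq_is_derive => [w|]; rewrite !mul1r.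
  have := is_derive_add (is_derive_add (is_derive_scale (1 - x) (d1 a))
    (is_derive_scale x (d1 b))) (is_derive_scale (-1) (d1 x)).
  by apply: eq_is_derive => [w|]; rewrite mulN1r.
have ch c : continuous (fun y => hat e (y - c)).
  move=> y; apply: (@continuous_comp _ _ _ (fun y : R => y - c) (hat e)).
    by apply: cvgB; [exact: cvg_id|exact: cvg_cst].
  exact: continuous_hat.
have [C2 D2] : is_Cn 2 ph /\ derive1n 2 ph = ph''.
  apply: (@is_C2 R ph ph' ph'').
  - by move=> y; apply: dC; exact: is_derive_ramp.
  - by move=> y; apply: dC; exact: is_derive_smooth_step.
  - move=> y; apply: cvgB; last exact: ch.
    by apply: cvgD; apply: cvgM; try exact: cvg_cst; exact: ch.
have st : space_test ph.
  split=> //; exists (a - e), (b + e).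
  split; [by clear -ea e0; lra|by clear -eb e0; lra|move=> y].
  rewrite negb_and -!ltNge => /orP[ya|yb]; rewrite /ph.
    have [ya1 ya2 ya3] : [/\ y - a <= - e, y - b <= - e & y - x <= - e].
      by clear -ya ax bx; split; lra.
    by rewrite !ramp_left ?(ltW e0)//; ring.
  have [yb1 yb2 yb3] : [/\ e <= y - a, e <= y - b & e <= y - x].
    by clear -yb ax bx; split; lra.
  by rewrite !ramp_right// /a /b; ring.
have := weak _ st; rewrite D2 => w0.
have hi c : L1_on `[0, 1] (fun y => z y * hat e (y - c)).
  apply: L1_on_continuous; apply: within_continuousM => //.
  by apply: continuous_subspaceT; exact: ch.
set I := fun c => \int[leb R]_(y in `[0, 1]) (z y * hat e (y - c)).
have {}w0 : (1 - x) * I a + x * I b - I x = 0.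
  transitivity (\int[leb R]_(y in `[0, 1]) ((1 - x) * (z y * hat e (y - a)) +
      x * (z y * hat e (y - b)) + -1 * (z y * hat e (y - x)))).
    rewrite RintegralD//=; [|by apply: L1_onD => //; exact: L1_onZ|exact: L1_onZ].
    rewrite RintegralD//=; [|exact: L1_onZ|exact: L1_onZ].
    rewrite !RintegralZl//; [|exact: hi|exact: hi|exact: hi].
    by rewrite mulN1r.
  rewrite -[RHS]w0; apply: eq_Rintegral => y _.
  by rewrite /ph''; ring.
have Ia : `|I a - z 0| <= d / 2.
  apply: hat_mean => //; first by clear -ea eb e0 ax bx x0 x1; lra.
  move=> y y01; rewrite ler_norml => ye; apply: zr0 => //; rewrite ler_norml.
  by clear -ye ea eb e0 etar aeta beta rle2 rle3 rle4 a0 b1; lra.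
have Ib : `|I b - z 1| <= d / 2.
  apply: hat_mean => //; first by clear -ea eb e0 ax bx x0 x1; lra.
  move=> y y01; rewrite ler_norml => ye; apply: zr1 => //; rewrite ler_norml.
  by clear -ye ea eb e0 etar aeta beta rle2 rle3 rle4 a0 b1; lra.
have Ix : `|I x - z x| <= d / 2.
  apply: hat_mean => //; first by clear -ea eb e0 ax bx x0 x1; lra.
  move=> y y01; rewrite ler_norml => ye; apply: zrx => //; rewrite ler_norml.
  by clear -ye ea eb e0 etar aeta beta rle2 rle3 rle4 a0 b1; lra.
clear -Ia Ib Ix w0 x0 x1.
move: Ia Ib Ix; rewrite !ler_norml => /andP[? ?] /andP[? ?] /andP[? ?].
by apply/andP; split; nra.
Qed.

Lemma ac_on_primitive (R : realType) (b : R) (f : R -> R) : L1_on `[0, b] f ->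
  ac_on b (fun x => \int[leb R]_(s in `[0, x]) f s) f.
Proof. by move=> fi; split=> // x _; rewrite set_itv1 Rintegral_set1 add0r. Qed.

Lemma laplace_v_ae (R : realType) (u : R -> R -> R) (a : R -> R) (x lambda : R) :
  L1_on `[0, +oo[ (fun t => u x t * expR (- (lambda * t))) ->
  L1_on `[0, +oo[ a -> {ae leb R, forall t, 0 <= t -> u x t = a t} ->
  laplace_v u x lambda = \int[leb R]_(t in `[0, +oo[) (a t * expR (- (lambda * t))).
Proof.
move=> ui ai ua; rewrite /laplace_v /Rintegral; congr fine.
apply: ae_eq_integral => //.
- exact: (measurable_int (leb R)) ui.
- apply/measurable_EFinP; apply: measurable_funM; first exact: L1_on_measurable.
  apply: (@measurable_funS _ _ _ _ setT) => //; apply: continuous_measurable_fun.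
  apply: (@is_derive_continuous _ _ (fun t => - lambda * expR (- (lambda * t)))) => t.
  have := @is_derive_affine _ (- lambda) 0 expR t _ (is_derive_expR _).
  by apply: eq_is_derive => [y|]; rewrite addr0 ?[- lambda * t]mulNr// mulNr.
- move: ua; apply: filterS; first exact: (ae_filter_ringOfSetsType (leb R)).
  by move=> t ut /=; rewrite in_itv/= andbT => t0; rewrite ut.
Qed.

Lemma is_derive_derive1n (R : realType) (n k : nat) (f : R -> R) (x : R) :
  is_Cn n f -> (k < n)%N -> is_derive x 1 (derive1n k f) (derive1n k.+1 f x).
Proof.
move=> [df _] kn; rewrite derive1nS derive1E.
by split => //; exact: df.
Qed.

(** Let H2 be the double primitive of (q + lambda) v. The weak equation says that z = v - H2 has
    zero second derivative as a distribution, so z is affine; as z 0 = 0, v equals H2 plus z 1 times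
    x and inherits the regularity of H2. *)
Lemma laplace_sturm_liouville (R : realType) (q a : R -> R) (u : R -> R -> R) (lambda : R) :
  L1_on `[0, 1] q -> solves_ibvp q a u -> has_laplace u lambda ->
  exists psi : R -> R, [/\ ac_on 1 (fun x => laplace_v u x lambda) psi,
    ac_on 1 psi (fun x => (q x + lambda) * laplace_v u x lambda) &
    laplace_v u 0 lambda = 0].
Proof.
move=> qi sol hl; have [_ _ u0 _ _] := sol.
pose v x := laplace_v u x lambda; rewrite -/v.
have v0 : v 0 = 0.
  rewrite /v (@laplace_v_ae _ _ (fun=> 0)).
  - rewrite /Rintegral integral0_eq// => t _; by rewrite mul0r.
  - by apply: hl.1; rewrite lexx ler01.
  - exact: (@integrable0 _ _ _ (leb R)).
  - exact: u0.
have cv : {within `[0, 1], continuous v} by exact: has_laplace_continuous.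
pose hh x := (q x + lambda) * v x.
have hhi : L1_on `[0, 1] hh.
  apply: L1_onM_continuous => //; apply: L1_onD => //; apply: L1_on_continuous.
  by apply: continuous_subspaceT; exact: cst_continuous.
pose H1 x := \int[leb R]_(s in `[0, x]) hh s.
have ac1 : ac_on 1 H1 hh by exact: ac_on_primitive.
have cH1 : {within `[0, 1], continuous H1} by exact: ac_on_continuous ac1.
pose H2 x := \int[leb R]_(s in `[0, x]) H1 s.
have ac2 : ac_on 1 H2 H1 by apply: ac_on_primitive; exact: L1_on_continuous.
have cH2 : {within `[0, 1], continuous H2} by exact: ac_on_continuous ac2.
have H10 : H1 0 = 0 by rewrite /H1 set_itv1 Rintegral_set1.
have H20 : H2 0 = 0 by rewrite /H2 set_itv1 Rintegral_set1.
pose z x := v x + -1 * H2 x.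
have cz : {within `[0, 1], continuous z}.
  by move=> x; apply: cvgD; [exact: cv|apply: cvgM; [exact: cvg_cst|exact: cH2]].
have affine x : 0 <= x <= 1 -> z x = (1 - x) * z 0 + x * z 1.
  apply: weakly_affine => // phi st.
  have [C2 [c [d [c0 d1 supp]]]] := st.
  pose ph' := derive1n 1 phi; pose ph'' := derive1n 2 phi.
  have D1 (y : R) : is_derive y 1 phi (ph' y) by exact: (@is_derive_derive1n _ 2 0).
  have D2 (y : R) : is_derive y 1 ph' (ph'' y) by exact: (@is_derive_derive1n _ 2 1).
  have c1 := is_derive_continuous D1; have c2 := is_derive_continuous D2.
  have c3 : continuous ph'' by case: C2.
  have A1 := is_derive_ac_on 1 D1 c2; have A2 := is_derive_ac_on 1 D2 c3.
  have phi1 : phi 1 = 0 by apply: supp; rewrite negb_and -!ltNge d1 orbT.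
  have ph'1 : ph' 1 = 0.
    have : is_derive (1 : R) 1 phi 0.
      have := is_derive_cst (0 : R) (1 : R) (1 : R); apply: near_eq_is_derive.
      near=> y; rewrite supp// negb_and -!ltNge; apply/orP; right.
      by near: y; exact: lt_nbhsr.
    by move=> [_ e]; have [_ <-] := D1 1.
  (* The two integrations by parts leave no boundary term: H1 and H2 vanish at 0, phi and its
     derivative at 1. *)
  have [I1i /(_ 1)] := ac_onD (ac_onM ler01 ac2 A2) (ac_onZ (-1) (ac_onM ler01 ac1 A1)).
  rewrite /= H10 H20 phi1 ph'1 !(mul0r, mulr0) !add0r ler01 lexx => /(_ isT)/esym I1.
  have W := laplace_weak_equation qi sol hl st; rewrite -/v -/ph'' in W.
  pose w x := ((lambda + q x) * phi x - ph'' x) * v x.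
  have wi : L1_on `[0, 1] w.
    apply: (@eq_L1_on _ _ (fun x => hh x * phi x + -1 * (v x * ph'' x))) => //.
      by move=> y _; rewrite /w /hh; ring.
    apply: L1_onD => //.
      by apply: L1_onM_continuous => //; exact: continuous_subspaceT.
    apply: L1_onZ => //; apply: L1_on_continuous; apply: within_continuousM => //.
    exact: continuous_subspaceT.
  transitivity (-1 * \int[leb R]_(y in `[0, 1]) (w y +
      (H1 y * ph' y + H2 y * ph'' y + -1 * (hh y * phi y + H1 y * ph' y)))); last first.
    by rewrite RintegralD// I1 W addr0 mulr0.
  rewrite -RintegralZl//; last exact: L1_onD.
  by apply: eq_Rintegral => y _; rewrite -[derive1 _ y]/(ph'' y) /z /w /hh; ring.
have z0 : z 0 = 0 by rewrite /z v0 H20 mulr0 addr0.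
have vE x : 0 <= x <= 1 -> v x = H2 x + x * z 1.
  by move=> /affine; rewrite z0 /z; lra.
have acl : ac_on 1 (fun x => z 1 * x) (fun=> z 1).
  apply: is_derive_ac_on; last exact: cst_continuous.
  move=> x; have := is_derive_scale (z 1) (is_derive_id x (1 : R)).
  by apply: eq_is_derive => //; rewrite mulr1.
have acc : ac_on 1 (fun=> z 1) (fun=> 0).
  by apply: is_derive_ac_on; exact: cst_continuous.
exists (fun x => H1 x + z 1); split => //.
  apply: eq_ac_on (ac_onD ac2 acl) => // x x01.
  by rewrite vE// mulrC.
apply: eq_ac_on (ac_onD ac1 acc) => // x _.
by rewrite addr0.
Unshelve. all: by end_near. Qed.

(** Let B be the maximum of |v| exp (- L x). Two integrations bound |v| by (N B / L) exp (L x) at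
    the maximum point, and N / L <= 1/2 forces B <= B / 2. *)
Lemma ivp_unique (R : realType) (Q v psi : R -> R) :
  ac_on 1 v psi -> ac_on 1 psi (fun x => Q x * v x) -> L1_on `[0, 1] Q ->
  v 0 = 0 -> psi 0 = 0 -> forall x, 0 <= x <= 1 -> v x = 0.
Proof.
move=> acv acp Qi v0 p0.
have cv := ac_on_continuous ler01 acv; have cp := ac_on_continuous ler01 acp.
pose N := \int[leb R]_(s in `[0, 1]) `|Q s|.
have N0 : 0 <= N by exact: Rintegral_ge0.
pose L := 2 * N + 1; have L0 : 0 < L by rewrite /L; lra.
have cE : continuous (fun x => expR (- L * x)).
  apply: (@is_derive_continuous _ _ (fun x => - L * expR (- L * x))) => x.
  have := @is_derive_affine _ (- L) 0 expR x _ (is_derive_expR _).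
  by apply: eq_is_derive => [y|]; rewrite addr0.
have cw : {within `[0, 1], continuous (fun x => `|v x| * expR (- L * x))}.
  apply: within_continuousM; last exact: continuous_subspaceT.
  by move=> x; exact: (continuous_comp (cv x) (@norm_continuous _ _ _)).
have [c] := EVT_max ler01 cw.
rewrite in_itv/= => c01; set B := `|v c| * _ => vB.
have B0 : 0 <= B by rewrite mulr_ge0// expR_ge0.
have {}vB x : 0 <= x <= 1 -> `|v x| <= B * expR (L * x).
  move=> x01; have := vB x; rewrite in_itv/= x01 => /(_ isT).
  by rewrite mulNr expRN ler_pdivrMr ?expR_gt0.
have pB x : 0 <= x <= 1 -> `|psi x| <= N * (B * expR (L * x)).
  move=> /[dup] x01 /andP[x0 x1]; rewrite acp.2// p0 add0r.
  apply: ler_norm_Rintegral_cst => //.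
  - exact: L1_on_le acp.1.
  - by rewrite mulr_ge0// expR_ge0.
  - move=> s /andP[s0 sx]; rewrite normrM; apply: ler_wpM2l => //.
    apply: le_trans (vB _ _) _; first by rewrite s0 (le_trans sx).
    by apply: ler_wpM2l => //; rewrite ler_expR; apply: ler_wpM2l => //; exact: ltW.
have dE (x : R) : is_derive x 1 (fun x => N * B / L * expR (L * x)) (N * (B * expR (L * x))).
  have := is_derive_scale (N * B / L) (@is_derive_affine _ L 0 expR x _ (is_derive_expR _)).
  apply: eq_is_derive => [y|]; rewrite addr0//.
  by field; rewrite gt_eqF.
have cE' : continuous (fun x => N * (B * expR (L * x))).
  apply: (@is_derive_continuous _ _ (fun x => N * (B * (L * expR (L * x))))) => x.
  have := is_derive_scale N (is_derive_scale B (@is_derive_affine _ L 0 expR x _ (is_derive_expR _))).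
  by apply: eq_is_derive => [y|]; rewrite addr0.
have [Ei EE] := is_derive_ac_on 1 dE cE'.
have vc : `|v c| <= N * B / L * expR (L * c).
  have /andP[c0 c1] := c01; rewrite acv.2// v0 add0r.
  apply: (@le_trans _ _ (\int[leb R]_(s in `[0, c]) (N * (B * expR (L * s))))).
    apply: ler_norm_Rintegral => //; [exact: L1_on_le acv.1|exact: L1_on_le Ei|].
    by move=> s; rewrite /= in_itv/= => /andP[s0 sc]; apply: pB; rewrite s0 (le_trans sc).
  rewrite EE// addrC -[leLHS]addr0; apply: lerD => //.
  by rewrite !mulr_ge0 ?expR_ge0// invr_ge0 ltW.
have {}B0 : B = 0.
  have : B <= B / 2.
    rewrite {1}/B mulNr expRN ler_pdivrMr ?expR_gt0//; apply: le_trans vc _.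
    apply: ler_wpM2r; first exact: expR_ge0.
    rewrite ler_pdivrMr//; have : N * B <= B * (2 * N + 1) / 2 by nra.
    by rewrite /L mulrAC.
  by lra.
by move=> x /vB; rewrite B0 mul0r normr_le0 => /eqP.
Qed.

(** * Recovery of the potential *)

(** The quotient is the mean of psi over [x, 1], and psi is continuous up to 1. This identifies
    [data_B] with the value psi 1 of the Sturm-Liouville pair. *)
Lemma ac_on_left_derivative (R : realType) (v psi : R -> R) :
  ac_on 1 v psi -> {within `[0, 1], continuous psi} ->
  (v x - v 1) / (x - 1) @[x --> (1 : R)^'-] --> psi 1.
Proof.
move=> [pi vE] cp; apply/cvgrPdist_le => e e0.
have [r r0 pr] := @within_continuous_dist _ _ 1 _ cp ltac:(lra) e0.
near=> x.
have x1 : x < 1 by near: x; exact: nbhs_left_lt.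
have x0 : 0 < x by near: x; apply: nbhs_left_gt; exact: ltr01.
have xr : 1 - r < x by near: x; apply: nbhs_left_gt; lra.
have x01 : 0 <= x <= 1 by lra.
have pxi : L1_on `[x, 1] psi.
  by apply: L1_onS pi => // s /=; rewrite !in_itv/= => /andP[sx ->]; rewrite (le_trans _ sx)// ltW.
have ci (c : R) : L1_on `[x, 1] (fun=> c).
  by apply: L1_on_continuous; apply: continuous_subspaceT; exact: cst_continuous.
have mx : fine (leb R `[x, 1]) = 1 - x.
  by rewrite lebesgue_measure_itv/= lte_fin x1.
have cI (c : R) : \int[leb R]_(s in `[x, 1]) c = c * (1 - x) by rewrite Rintegral_cst// mx.
have vx : v 1 - v x = \int[leb R]_(s in `[x, 1]) psi s.
  by rewrite (vE 1) ?ler01 ?lexx// (vE x)// (Rintegral_split x01 pi); ring.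
have : `|\int[leb R]_(s in `[x, 1]) (psi s + - psi 1)| <= e * (1 - x).
  rewrite -cI; apply: ler_norm_Rintegral => //; first exact: L1_onD.
  move=> s; rewrite /= in_itv/= => /andP[sx s1]; apply: pr; first by lra.
  by rewrite ler_norml; lra.
have -> : \int[leb R]_(s in `[x, 1]) (psi s + - psi 1) = v 1 - v x + - psi 1 * (1 - x).
  rewrite vx -(cI (- psi 1)); apply: RintegralD => //; exact: ci.
move=> bd.
have nz : x - 1 != 0 by rewrite subr_eq0 lt_eqF.
have -> : psi 1 - (v x - v 1) / (x - 1) = (v 1 - v x + - psi 1 * (1 - x)) / (x - 1) by field.
rewrite normrM normfV ler_pdivrMr ?normr_gt0//.
by rewrite [`|x - 1|]distrC [`|1 - x|]gtr0_norm// subr_gt0.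
Unshelve. all: by end_near. Qed.

(* Each solution is a nonzero multiple of the one normalized by psi 0 = 1, so
   only the ratio B / A of the data matters. *)
Lemma laplace_normalized_solution (R : realType) (q a : R -> R) (u : R -> R -> R)
    (lambda0 mu : R) :
  L1_on `[0, 1] q -> solves_ibvp q a u -> has_laplace u (lambda0 + mu) ->
  data_A u (lambda0 + mu) != 0 ->
  exists beta phi psi, [/\ beta != 0, sl_solution (fun x => q x + lambda0) mu phi psi,
    data_A u (lambda0 + mu) = beta * phi 1 & data_B u (lambda0 + mu) = beta * psi 1].
Proof.
move=> qi sol hl A0.
have [psi [acv acp v0]] := laplace_sturm_liouville qi sol hl.
set v := fun x => laplace_v u x (lambda0 + mu) in acv acp.
have ci (c : R) : L1_on `[0, 1] (fun=> c).
  by apply: L1_on_continuous; apply: continuous_subspaceT; exact: cst_continuous.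
(* Were psi 0 zero, v would vanish on [0, 1] by uniqueness, and with it A = v 1. *)
have b0 : psi 0 != 0.
  apply: contraNneq A0 => p0; apply/eqP.
  by apply: (ivp_unique acv acp) => //; [exact: L1_onD|rewrite ler01 lexx].
exists (psi 0), (fun x => (psi 0)^-1 * v x), (fun x => (psi 0)^-1 * psi x); split => //.
- split; [exact: ac_onZ| |by rewrite /v v0 mulr0|by rewrite mulVf].
  by apply: eq_ac_on (ac_onZ (psi 0)^-1 acp) => // x _; rewrite -/(v x); ring.
- by rewrite mulVKf.
- rewrite mulVKf//; apply/cvg_lim => //.
  by apply: (ac_on_left_derivative acv); exact: ac_on_continuous acp.
Qed.

(** The derivative of psi1 phi2 - phi1 psi2 is (q1 - q2) phi1 phi2, the terms in mu cancelling; at 0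
    both phi1 and phi2 vanish. *)
Lemma wronskian_identity (R : realType) (q1 q2 phi1 psi1 phi2 psi2 : R -> R) (mu : R) :
  L1_on `[0, 1] q1 -> L1_on `[0, 1] q2 ->
  sl_solution q1 mu phi1 psi1 -> sl_solution q2 mu phi2 psi2 ->
  \int[leb R]_(x in `[0, 1]) ((q1 x - q2 x) * (phi1 x * phi2 x)) =
  psi1 1 * phi2 1 - phi1 1 * psi2 1.
Proof.
move=> q1i q2i [f1 p1 f10 _] [f2 p2 f20 _].
have [_ /(_ 1)] := ac_onD (ac_onM ler01 p1 f2) (ac_onZ (-1) (ac_onM ler01 f1 p2)).
rewrite ler01 lexx f10 f20 !(mul0r, mulr0) !add0r mulN1r => /(_ isT) ->.
by apply: eq_Rintegral => x _; ring.
Qed.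

Theorem theorem10p1p1 (R : realType) (q1 q2 a1 a2 : R -> R)
    (u1 u2 : R -> R -> R) (Lambda : set R)
    (q1_L1 : L1_on `[0, 1] q1) (q2_L1 : L1_on `[0, 1] q2)
    (a1_datum : boundary_datum a1) (a2_datum : boundary_datum a2)
    (u1_sol : solves_ibvp q1 a1 u1) (u2_sol : solves_ibvp q2 a2 u2)
    (Lambda_pos : Lambda `<=` `]0, +oo[)
    (Lambda_lim : exists2 lambda0 : R, 0 < lambda0 & limit_point Lambda lambda0)
    (v_def : forall lambda, Lambda lambda ->
       has_laplace u1 lambda /\ has_laplace u2 lambda)
    (same_data : forall lambda, Lambda lambda ->
       data_A u1 lambda = data_A u2 lambda /\
       data_B u1 lambda = data_B u2 lambda) :
  {ae (@lebesgue_measure R), forall x, 0 <= x <= 1 -> q1 x = q2 x}.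
Proof.
have [lambda0 _ lim0] := Lambda_lim.
have [eps eps0 A0] := boundary_datum_laplace_neq0 lambda0 a1_datum.
(* Offsets of the data points from the limit point: mu = 0 is left out, and |mu| <= eps keeps A
   nonzero. *)
pose M : set R := [set mu | [/\ Lambda (lambda0 + mu), mu != 0 & `|mu| <= eps]].
pose good mu (s : (R -> R) * (R -> R) * ((R -> R) * (R -> R))) :=
  [/\ sl_solution (fun x => q1 x + lambda0) mu s.1.1 s.1.2,
      sl_solution (fun x => q2 x + lambda0) mu s.2.1 s.2.2 &
      s.1.2 1 * s.2.1 1 - s.1.1 1 * s.2.2 1 = 0].
have data mu : M mu -> exists s, good mu s.
  move=> [Lmu mu0 mue]; have [hl1 hl2] := v_def _ Lmu; have [sA sB] := same_data _ Lmu.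
  have [a1i _ _] := a1_datum; have [_ _ _ tr1 _] := u1_sol.
  have A1 : data_A u1 (lambda0 + mu) != 0.
    rewrite /data_A (laplace_v_ae _ a1i tr1); first exact: A0.
    by apply: hl1.1; rewrite ler01 lexx.
  have A2 : data_A u2 (lambda0 + mu) != 0 by rewrite -sA.
  have [b1 [phi1 [psi1 [b10 s1 eA1 eB1]]]] := laplace_normalized_solution q1_L1 u1_sol hl1 A1.
  have [b2 [phi2 [psi2 [b20 s2 eA2 eB2]]]] := laplace_normalized_solution q2_L1 u2_sol hl2 A2.
  exists ((phi1, psi1), (phi2, psi2)); split => //=.
  (* Multiplied by b1 b2, the Wronskian at 1 reads B1 A2 - A1 B2, which is zero by equality of the
     data. *)
  apply: (mulfI (mulf_neq0 b10 b20)); rewrite mulr0.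
  have -> : b1 * b2 * (psi1 1 * phi2 1 - phi1 1 * psi2 1) =
    (b1 * psi1 1) * (b2 * phi2 1) - (b1 * phi1 1) * (b2 * psi2 1) by ring.
  by rewrite -eA1 -eA2 -eB1 -eB2 sA sB; ring.
(* Arbitrary values off M make the existence statement total, so that choice yields families indexed
   by all mu. *)
have {}data mu : exists s, M mu -> good mu s.
  by have [/data[s ?]|nM] := pselect (M mu); [exists s|exists ((id, id), (id, id))].
have [s sE] := choice data.
have ci : L1_on `[0, 1] (fun=> lambda0).
  by apply: L1_on_continuous; apply: continuous_subspaceT; exact: cst_continuous.
have q1i : L1_on `[0, 1] (fun x => q1 x + lambda0) by exact: L1_onD.
have q2i : L1_on `[0, 1] (fun x => q2 x + lambda0) by exact: L1_onD.
(* Shifting both potentials by [lambda0] moves the limit point to mu = 0 and leaves their difference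
   unchanged. *)
suff: {ae leb R, forall x, 0 <= x <= 1 -> (q1 x + lambda0) - (q2 x + lambda0) = 0}.
  apply: filterS; first exact: (ae_filter_ringOfSetsType (leb R)).
  by move=> x H /H /eqP; rewrite subr_eq0 => /eqP/addIr.
apply: (@product_completeness R (fun x => q1 x + lambda0) (fun x => q2 x + lambda0)
  (fun x => (q1 x + lambda0) - (q2 x + lambda0)) M (fun mu => (s mu).1.1) (fun mu => (s mu).1.2)
  (fun mu => (s mu).2.1) (fun mu => (s mu).2.2) q1i q2i).
- apply: (@eq_L1_on _ _ (fun x => (q1 x + lambda0) + -1 * (q2 x + lambda0))) => //.
    by move=> x _; rewrite mulN1r.
  by apply: L1_onD => //; exact: L1_onZ.
- move=> e e0.
  have : nbhs lambda0 (ball lambda0 (Num.min e eps)).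
    by apply: nbhsx_ballx; rewrite lt_min e0.
  move=> /lim0[y [y0 Ly]]; rewrite /ball/= lt_min => /andP[ye yeps].
  exists (y - lambda0); split; [|by rewrite subr_eq0|by rewrite distrC ltW].
  by split; [rewrite addrC subrK|rewrite subr_eq0|rewrite distrC ltW].
- by move=> mu /sE[].
- by move=> mu /sE[].
- by move=> mu /sE[s1 s2 W]; rewrite (wronskian_identity q1i q2i s1 s2).
Qed.
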